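(* Consider a binary tree stochastic block model (see context) on $n$ nodes with $K=2^{d}$ communities of equal size, $K$ fixed, and parameters $p_j=\rho_na_j$, $j=0,\dots,d$, with constants $a_0,\dots,a_d$ and $\rho_n=\log n/n$. Assume either $a_0>a_1>\dots>a_d>0$ (assortative) or $0<a_0<a_1<\dots<a_d$ (dis-assortative). Fix any $\ell\in[d]$. If $$|\sqrt{\bar a_r}-\sqrt{a_r}|>\sqrt{2^{d-r+1}},\qquad r=d,d-1,\dots,d-\ell+1,$$ where $$\bar a_r=\frac{a_0+\sum_{j=1}^{r-1}2^{j-1}a_j}{2^{r-1}},$$ then all mega-communities up to layer $\ell+1$ are exactly recovered by HCD-Sign with probability $1-o(1)$ as $n\to\infty$.
   Context: Binary tree SBM (BTSBM): there are $K=2^{d}$ clusters, identified with the leaves of a full binary tree with $d+1$ layers (layer $1$ is the root, layer $d+1$ the leaves) and encoded by binary strings $x_d\cdots x_1$. Each cluster has $n/K$ nodes. For clusters $c,c'$ with strings $x,x'$, the connection probability is $B_{c,c'}=p_{D(c,c')}$ with $D(c,c')=\max\{i:x_i\ne x_i'\}$ if $c\ne c'$ and $D(c,c)=0$. The adjacency matrix $A$ is symmetric with zero diagonal and independent entries $A_{ij}\sim\mathrm{Ber}(B_{c_ic_j})$, $i<j$, where $c_i$ is the cluster of node $i$. A mega-community at layer $q$ ($1\le q\le d+1$) is the set of all nodes whose cluster string has a given prefix $x_dx_{d-1}\cdots x_{d-q+2}$ of length $q-1$ (the whole network for $q=1$, single clusters for $q=d+1$). HCD-Sign: a divisive hierarchical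 algorithm that starts from the whole network and recursively splits each current mega-community into two parts, according to the signs of the entries of the eigenvector of the adjacency matrix of its induced subgraph corresponding to the second largest eigenvalue in absolute value. The mega-communities up to layer $\ell+1$ are exactly recovered if, for every mega-community at layers $1,\dots,\ell$, this sign split of its induced subgraph gives exactly its two child mega-communities. *)

(* Defs.v *)
From HB Require Import structures.
From mathcomp Require Import all_boot all_order all_algebra.
From mathcomp Require Import all_classical all_reals all_analysis.
Import Order.TTheory GRing.Theory Num.Theory.
Import numFieldNormedType.Exports.

Set Implicit Arguments.
Unset Strict Implicit.
Unset Printing Implicit Defensive.

Local Open Scope ring_scope.

(* A cluster label x : d.-tuple bool lists the string x_d, ..., x_1 in this
   order, so position j (counted from 0) holds x_(d - j). *)
Definition tree_dist (d : nat) (x y : d.-tuple bool) : nat :=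
  (\max_(j < d | tnth x j != tnth y j) (d - j))%N.

(* The mega-community with prefix w; its layer is (size w).+1. *)
Definition mega_community (n d : nat) (c : 'I_n -> d.-tuple bool)
  (w : seq bool) : {set 'I_n} := [set v | prefix w (c v)].

Definition mega_children (n d : nat) (c : 'I_n -> d.-tuple bool)
  (w : seq bool) : {set {set 'I_n}} :=
  [set mega_community c (rcons w false); mega_community c (rcons w true)].

Definition simple_graph (n : nat) (A : 'M[bool]_n) : bool :=
  [forall i, forall j, A i j == A j i] && [forall i, ~~ A i i].

(* Probability of the event E when the entries A i j, i < j, of a simple graph
   are independent Bernoulli variables with parameter p (tree_dist (c i) (c j)).
   It is a genuine probability as soon as 0 <= p k <= 1 for all k <= d. *)
Definition btsbm_prob (R : realType) (n d : nat) (c : 'I_n -> d.-tuple bool)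
  (p : nat -> R) (E : 'M[bool]_n -> Prop) : R :=
  \sum_(A : 'M[bool]_n | simple_graph A && `[< E A >])
    \prod_(i < n) \prod_(j < n | (i < j)%N)
      bernoulli_pmf (p (tree_dist (c i) (c j))) (A i j).

Definition induced_adjacency (R : realType) (n : nat) (A : 'M[bool]_n)
  (S : {set 'I_n}) : 'M[R]_#|S| :=
  \matrix_(i, j) (A (enum_val i) (enum_val j))%:R.

(* s lists the eigenvalues with multiplicity, by decreasing absolute value; such
   an s exists for every real symmetric matrix.  The predicate allows every
   way of breaking ties between absolute values. *)
Definition second_eigenvector (R : realType) (m : nat) (M : 'M[R]_m)
  (u : 'rV[R]_m) : Prop :=
  exists s : seq R,
    [/\ char_poly M = \prod_(x <- s) ('X - x%:P),
        sorted (fun x y : R => `|y| <= `|x|) s,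
        u != 0 &
        u *m M = s`_1 *: u].

Definition sign_split (R : realType) (n : nat) (S : {set 'I_n})
  (u : 'rV[R]_#|S|) : {set {set 'I_n}} :=
  [set [set enum_val k | k : 'I_#|S| & 0 <= u 0 k];
       [set enum_val k | k : 'I_#|S| & u 0 k < 0]].

(* The split has to be correct for every admissible eigenvector, in particular
   for both u and - u, so a zero entry never yields a correct split when both
   children are nonempty. *)
Definition sign_splits_correctly (R : realType) (n d : nat)
  (c : 'I_n -> d.-tuple bool) (A : 'M[bool]_n) (w : seq bool) : Prop :=
  forall u : 'rV[R]_#|mega_community c w|,
    second_eigenvector (induced_adjacency R A (mega_community c w)) u ->
    sign_split u = mega_children c w.

Definition hcd_sign_exact_recovery (R : realType) (n d : nat)
  (c : 'I_n -> d.-tuple bool) (l : nat) (A : 'M[bool]_n) : Prop :=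
  forall w : seq bool, (size w < l)%N -> sign_splits_correctly R c A w.

Definition rho (R : realType) (n : nat) : R := ln n%:R / n%:R.

Definition abar (R : realType) (a : nat -> R) (r : nat) : R :=
  (a 0%N + \sum_(1 <= j < r) 2 ^+ (j - 1) * a j) / 2 ^+ (r - 1).

Definition assortative (R : realType) (d : nat) (a : nat -> R) : Prop :=
  (forall j, (j < d)%N -> a j.+1 < a j) /\ 0 < a d.

Definition disassortative (R : realType) (d : nat) (a : nat -> R) : Prop :=
  0 < a 0%N /\ (forall j, (j < d)%N -> a j < a j.+1).

(* Main.v *)
Require Import Defs.
From mathcomp Require Import all_boot all_order all_algebra.
From mathcomp Require Import all_classical all_reals all_analysis.
From mathcomp Require Import complex ring lra zify.
Import Order.TTheory GRing.Theory Num.Theory.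
Import numFieldNormedType.Exports.

Set Implicit Arguments.
Unset Strict Implicit.
Unset Printing Implicit Defensive.

Local Open Scope classical_set_scope.
Local Open Scope ring_scope.

(** Fix a mega-community with prefix [w] and let [L = ln n].  Inside it the edge
    probabilities depend on the tree distance only, so the expected matrix has
    the constant vector and the vector of sides (the sign that tells the two
    children apart) as eigenvectors, and is controlled on their orthogonal
    complement ([ref_mx_const], [ref_mx_side], [ref_mx_compl]).  Monotonicity of
    [a] makes the constant vector the first and the vector of sides the second
    in absolute value of the eigenvalue, with gaps of order [L]
    ([spectral_gap_constant]).

    With high probability the adjacency matrix differs from its expectation by a
    matrix of norm at most a small multiple of [L].  This needs no sharp
    estimate: degrees are of order [L] ([degree_tail]), the number of edges
    between any two sets of vertices deviates little from its mean
    ([discrepancy_tail], a Chernoff bound for each pair of sets), and a matrix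
    with these two properties has small norm ([discrepancy_nrm]).  Hence the
    second eigenvector is close to the vector of sides in Euclidean norm
    ([second_eigenvalue_near], [eigenvector_near]).

    Closeness in norm does not determine the sign of every entry.  The
    eigenvector equation at a vertex [v] says that [lam * u_v] is the sum of the
    entries of [u] over the neighbours of [v].  If [u] is replaced by the vector
    of sides, this sum becomes the difference between the numbers of neighbours
    on the two sides.  The hypothesis on the square roots is exactly what the
    optimal Chernoff bound requires for this difference to exceed a positive
    multiple of [L], in the right direction, at all [n] vertices at once
    ([tilt_exponent], [threshold_excess], [margin_tail]).

    The error of the replacement depends on the row of [v] as [u] does, and this
    dependence is removed by a leave-one-out argument.  The eigenvector is
    compared with that of the graph in which [v] is isolated.  The latter is
    independent of the row of [v], so its deviation from the vector of sides,
    summed over the neighbours of [v], has a good exponential moment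
    ([row_tail], [refs_tail]); and replacing one by the other changes the
    equation by a small multiple of [u_v] only ([leave_one_out_equation]).  The
    signs follow ([normalised_eigenvector_sign], [split_correct]).

    Each of these events fails with probability at most a constant times a
    negative power of [n] ([split_failure_bound], [split_failure_rate]), and a
    union bound over the finitely many prefixes of length less than [l] gives
    the theorem. *)

(** * Euclidean norm and the spectral theorem *)

Definition dot (R : realType) n (x y : 'rV[R]_n) : R := \sum_i x 0 i * y 0 i.

Definition nrm (R : realType) n (x : 'rV[R]_n) : R := Num.sqrt (dot x x).

Lemma mulmx_tr_dot (R : realType) n (x y : 'rV[R]_n) : x *m y^T = (dot x y)%:M.
Proof.
apply/matrixP => i j; rewrite !ord1 !mxE eqxx mulr1n.
by apply: eq_bigr => k _; rewrite mxE.
Qed.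

Lemma dotC (R : realType) n (x y : 'rV[R]_n) : dot x y = dot y x.
Proof. by apply: eq_bigr => i _; rewrite mulrC. Qed.

Lemma dotDl (R : realType) n (x y z : 'rV[R]_n) :
  dot (x + y) z = dot x z + dot y z.
Proof. by rewrite -big_split; apply: eq_bigr => i _; rewrite mxE mulrDl. Qed.

Lemma dotZl (R : realType) n a (x y : 'rV[R]_n) : dot (a *: x) y = a * dot x y.
Proof. by rewrite mulr_sumr; apply: eq_bigr => i _; rewrite mxE mulrA. Qed.

Lemma dotDr (R : realType) n (x y z : 'rV[R]_n) :
  dot z (x + y) = dot z x + dot z y.
Proof. by rewrite dotC dotDl !(dotC _ z). Qed.

Lemma dotZr (R : realType) n a (x y : 'rV[R]_n) : dot x (a *: y) = a * dot x y.
Proof. by rewrite dotC dotZl dotC. Qed.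

Lemma dotNl (R : realType) n (x y : 'rV[R]_n) : dot (- x) y = - dot x y.
Proof. by rewrite -scaleN1r dotZl mulN1r. Qed.

Lemma dotNr (R : realType) n (x y : 'rV[R]_n) : dot x (- y) = - dot x y.
Proof. by rewrite dotC dotNl dotC. Qed.

Lemma dotBl (R : realType) n (x y z : 'rV[R]_n) :
  dot (x - y) z = dot x z - dot y z.
Proof. by rewrite dotDl dotNl. Qed.

Lemma dotBr (R : realType) n (x y z : 'rV[R]_n) :
  dot z (x - y) = dot z x - dot z y.
Proof. by rewrite dotDr dotNr. Qed.

Lemma dot0l (R : realType) n (y : 'rV[R]_n) : dot 0 y = 0.
Proof. by rewrite -(scale0r 0) dotZl mul0r. Qed.

Definition dotE := (dotDl, dotDr, dotBl, dotBr, dotZl, dotZr, dotNl, dotNr).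

Lemma dot_mulmx (R : realType) n k (x : 'rV[R]_n) (y : 'rV[R]_k) (A : 'M[R]_(n, k)) :
  dot (x *m A) y = dot x (y *m A^T).
Proof.
have h : (dot (x *m A) y)%:M = (dot x (y *m A^T))%:M :> 'M[R]_1.
  by rewrite -!mulmx_tr_dot trmx_mul trmxK mulmxA.
by have := congr1 (fun M : 'M[R]_1 => M 0 0) h; rewrite !mxE eqxx !mulr1n.
Qed.

Lemma dot_ge0 (R : realType) n (x : 'rV[R]_n) : 0 <= dot x x.
Proof. by apply: sumr_ge0 => i _; rewrite -expr2 sqr_ge0. Qed.

Lemma dot_eq0 (R : realType) n (x : 'rV[R]_n) : (dot x x == 0) = (x == 0).
Proof.
apply/idP/eqP => [|->]; last by rewrite dot0l.
rewrite psumr_eq0 => [/allP x0|i _]; last by rewrite -expr2 sqr_ge0.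
apply/rowP => i; rewrite mxE.
by have := x0 i (mem_index_enum _); rewrite mulf_eq0 orbb => /eqP.
Qed.

Lemma nrm_ge0 (R : realType) n (x : 'rV[R]_n) : 0 <= nrm x.
Proof. exact: sqrtr_ge0. Qed.

Lemma nrm_sqr (R : realType) n (x : 'rV[R]_n) : nrm x ^+ 2 = dot x x.
Proof. by rewrite sqr_sqrtr ?dot_ge0. Qed.

Lemma nrm_eq0 (R : realType) n (x : 'rV[R]_n) : (nrm x == 0) = (x == 0).
Proof. by rewrite -(sqrf_eq0 (nrm x)) nrm_sqr dot_eq0. Qed.

Lemma nrm_gt0 (R : realType) n (x : 'rV[R]_n) : (0 < nrm x) = (x != 0).
Proof. by rewrite lt_def nrm_ge0 andbT nrm_eq0. Qed.

Lemma nrmZ (R : realType) n a (x : 'rV[R]_n) : nrm (a *: x) = `|a| * nrm x.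
Proof. by rewrite /nrm !dotE mulrA -expr2 sqrtrM ?sqr_ge0 // sqrtr_sqr. Qed.

(** Cauchy--Schwarz: the vector [(x.x) y - (x.y) x] has a nonnegative square. *)
Lemma dot_CS (R : realType) n (x y : 'rV[R]_n) : `|dot x y| <= nrm x * nrm y.
Proof.
rewrite -ler_sqr ?nnegrE ?mulr_ge0 ?nrm_ge0 // real_normK ?num_real //.
rewrite exprMn !nrm_sqr.
have [x0|x0] := eqVneq (dot x x) 0.
  by move/eqP: x0; rewrite dot_eq0 => /eqP->; rewrite !dot0l mul0r expr0n.
have xp : 0 < dot x x by rewrite lt_def x0 dot_ge0.
rewrite -(ler_pM2l xp) -subr_ge0.
have := dot_ge0 (dot x x *: y - dot x y *: x).
rewrite !dotE (dotC y x); congr (_ <= _); ring.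
Qed.

Lemma nrmD (R : realType) n (x y : 'rV[R]_n) : nrm (x + y) <= nrm x + nrm y.
Proof.
rewrite -ler_sqr ?nnegrE ?addr_ge0 ?nrm_ge0 // sqrrD !nrm_sqr !dotE (dotC y x).
by have := le_trans (ler_norm _) (dot_CS x y); lra.
Qed.

Lemma entry_le_nrm (R : realType) n (x : 'rV[R]_n) i : `|x 0 i| <= nrm x.
Proof.
rewrite -ler_sqr ?nnegrE ?nrm_ge0 // real_normK ?num_real // nrm_sqr.
rewrite /dot (bigD1 i) //= -expr2 lerDl; apply: sumr_ge0 => j _.
by rewrite -expr2 sqr_ge0.
Qed.

(** An eigenvector [v] exists over the complex numbers, and its eigenvalue is
    the quotient of the real numbers [v A v^*] and [v v^*]. *)
Lemma sym_real_eigenvalue (R : realType) n (A : 'M[R]_n.+1) :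
  A^T = A -> exists mu, eigenvalue A mu.
Proof.
move=> symA.
pose f : {rmorphism R -> R[i]} := real_complex R.
pose AC := map_mx f A.
have [mu mu_eig] := eigenvalue_closed AC (ltn0Sn n).
have /eigenvalueP [v vA v0] := mu_eig.
have mu_real : mu \is Num.real.
  pose s := \sum_j v 0 j * (v 0 j)^*.
  pose t := \sum_j \sum_i v 0 i * AC i j * (v 0 j)^*.
  have st : t = mu * s.
    rewrite mulr_sumr; apply: eq_bigr => j _; rewrite -mulr_suml.
    by have /rowP/(_ j) := vA; rewrite !mxE => ->; rewrite mulrA.
  have tr : t^* = t.
    rewrite /t rmorph_sum exchange_big /=; apply: eq_bigr => i _.
    rewrite rmorph_sum; apply: eq_bigr => j _; rewrite !rmorphM /= conjCK.
    have -> : AC i j = AC j i by rewrite !mxE -{1}symA mxE.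
    have -> : (AC j i)^* = AC j i.
      by rewrite mxE; exact: conjc_real.
    by rewrite mulrAC [X in X * _]mulrC mulrAC.
  have s_ge0 : 0 <= s by apply: sumr_ge0 => j _; exact: mul_conjC_ge0.
  have s0 : s != 0.
    apply: contraNneq v0 => /eqP.
    rewrite psumr_eq0 => [/allP h|j _]; last exact: mul_conjC_ge0.
    apply/eqP/rowP => j; rewrite mxE; apply/eqP; rewrite -mul_conjC_eq0.
    exact: h (mem_index_enum j).
  have -> : mu = t / s by rewrite st mulfK.
  by rewrite rpred_div // ?(ger0_real s_ge0) //; apply/CrealP.
have := mu_eig; rewrite eigenvalue_root_char.
rewrite /AC -map_char_poly -(RRe_real mu_real).
rewrite fmorph_root -eigenvalue_root_char => h; by exists (complex.Re mu).
Qed.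

(** The reflection in the hyperplane orthogonal to [e - v], where [e] is the
    first basis vector, exchanges [e] and [v]. *)
Lemma householder (R : realType) n (v : 'rV[R]_n.+1) : dot v v = 1 ->
  exists H : 'M[R]_n.+1, [/\ H^T = H, H *m H = 1%:M & delta_mx 0 0 *m H = v].
Proof.
move=> vv.
pose e : 'rV[R]_n.+1 := delta_mx 0 0.
have ee : dot e e = 1.
  rewrite /dot (bigD1 0) //= big1 => [|i i0]; rewrite !mxE ?eqxx ?addr0 ?mulr1 //.
  by rewrite (negbTE i0) mulr0.
have [->|ev] := eqVneq v e.
  by exists 1%:M; rewrite trmx1 !mulmx1.
have [z zE] : exists z, z = e - v by exists (e - v).
pose q : R := dot z z.
have q0 : q != 0 by rewrite dot_eq0 zE subr_eq0 eq_sym.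
have qE : z *m z^T = q%:M by rewrite mulmx_tr_dot.
have ez : e *m z^T = (q / 2)%:M.
  rewrite mulmx_tr_dot; congr (_%:M); rewrite /q zE !dotE ee vv (dotC v e).
  by field.
exists (1%:M - (2 / q) *: (z^T *m z)); split.
- by rewrite linearB /= linearZ /= trmx1 trmx_mul trmxK.
- rewrite mulmxBl mul1mx mulmxBr mulmx1 -scalemxAl -scalemxAr.
  rewrite mulmxA -[z^T *m z *m z^T]mulmxA qE mul_mx_scalar -scalemxAl !scalerA.
  set Z := z^T *m z.
  have -> : 2 / q * (2 / q * q) = (2 / q) *+ 2 by field.
  by apply/matrixP => i j; rewrite !mxE; ring.
- rewrite -/e mulmxBr mulmx1 -scalemxAr mulmxA ez mul_scalar_mx scalerA.
  have -> : 2 / q * (q / 2) = 1 by field.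
  by rewrite scale1r zE subKr.
Qed.

Lemma block_diag_conj (R : realType) n (mu : R) (Q : 'M[R]_n) (D : 'rV[R]_n) :
  (block_mx (1%:M : 'M[R]_1) 0 0 Q)^T *m diag_mx (row_mx (mu%:M : 'M[R]_1) D)
    *m block_mx (1%:M : 'M[R]_1) 0 0 Q =
  block_mx (mu%:M : 'M[R]_1) 0 0 (Q^T *m diag_mx D *m Q).
Proof.
rewrite diag_mx_row (_ : diag_mx _ = mu%:M); last first.
  by apply/matrixP => i j; rewrite !ord1 !mxE eqxx.
rewrite tr_block_mx !trmx0 trmx1 !mulmx_block.
rewrite !(mulmx0, mul0mx, addr0, add0r).
by rewrite mulmx1 mul1mx.
Qed.

(** A reflection takes the first basis vector to a unit eigenvector; in the new
    coordinates the matrix is block diagonal, and the induction goes on in the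
    orthogonal complement of that eigenvector. *)
Lemma sym_spectral (R : realType) n (A : 'M[R]_n) : A^T = A ->
  exists (Q : 'M[R]_n) (D : 'rV[R]_n),
    Q *m Q^T = 1%:M /\ A = Q^T *m diag_mx D *m Q.
Proof.
elim: n A => [|n IH] A symA.
  by exists 1%:M, 0; split; apply/matrixP => -[].
have [mu /eigenvalueP [v0 v0A v0n]] := sym_real_eigenvalue symA.
have [v [vA vv]] : exists v : 'rV[R]_n.+1, v *m A = mu *: v /\ dot v v = 1.
  exists ((nrm v0)^-1 *: v0); split.
    by rewrite -scalemxAl v0A scalerA mulrC -scalerA.
  rewrite !dotE -nrm_sqr; have : nrm v0 != 0 by rewrite nrm_eq0.
  by move=> ?; field.
have [H [symH HH eH]] := householder vv.
pose B : 'M[R]_(1 + n) := H *m A *m H.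
have symB : B^T = B by rewrite /B !trmx_mul symA symH mulmxA.
have vH : v *m H = delta_mx 0 0 by rewrite -eH -mulmxA HH mulmx1.
have B0 : row 0 B = mu *: delta_mx 0 0.
  by rewrite rowE /B !mulmxA eH vA -scalemxAl vH.
have ur0 : ursubmx B = 0.
  apply/matrixP => i j; rewrite ord1 mxE mxE.
  have /rowP/(_ (rshift 1 j)) := B0.
  rewrite !mxE => h; rewrite (_ : lshift n 0 = 0) ?h ?mulr0 //.
  exact/val_inj.
have BE : B = block_mx mu%:M 0 0 (drsubmx B).
  rewrite -[LHS]submxK ur0; congr block_mx.
    apply/matrixP => i j; rewrite !ord1 !mxE.
    have /rowP/(_ (lshift n 0)) := B0.
    rewrite !mxE => h; rewrite (_ : lshift n 0 = 0) in h *; last exact/val_inj.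
    by rewrite h mulr1.
  by rewrite -symB -trmx_ursub ur0 trmx0.
have [|Q [D [QQ QD]]] := IH (drsubmx B).
  by rewrite trmx_drsub symB.
pose Q1 : 'M[R]_(1 + n) := block_mx 1%:M 0 0 Q.
pose D1 : 'rV[R]_(1 + n) := row_mx mu%:M D.
have QQ1 : Q1 *m Q1^T = 1%:M.
  rewrite tr_block_mx !trmx0 trmx1 mulmx_block !mulmx0 !mul0mx !addr0 !add0r.
  by rewrite mulmx1 QQ -scalar_mx_block.
have BQ1 : B = Q1^T *m diag_mx D1 *m Q1 by rewrite block_diag_conj -QD.
exists (Q1 *m H), D1; split.
  by rewrite trmx_mul symH mulmxA -[_ *m H *m H]mulmxA HH mulmx1.
rewrite trmx_mul symH.
have -> : A = H *m B *m H by rewrite /B !mulmxA HH mul1mx -mulmxA HH mulmx1.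
by rewrite BQ1 !mulmxA.
Qed.

(** * Perturbation of the second eigenvector *)

Lemma perm_eq_XsubC (R : realType) (s t : seq R) :
  \prod_(x <- s) ('X - x%:P) = \prod_(x <- t) ('X - x%:P) -> perm_eq s t.
Proof.
elim: s t => [|x s IH] t.
  rewrite big_nil; case: t => // y t /(congr1 (fun p : {poly R} => p.[y])).
  by rewrite big_cons !hornerE subrr mul0r => /eqP; rewrite oner_eq0.
move=> E; have xt : x \in t.
  rewrite -root_prod_XsubC -E big_cons rootM; apply/orP; left.
  by rewrite root_XsubC.
apply: (perm_trans _ (_ : perm_eq (x :: rem x t) t)); last first.
  by rewrite perm_sym perm_to_rem.
rewrite perm_cons; apply: IH; have := E.
rewrite big_cons (perm_big _ (perm_to_rem xt)) big_cons /=.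
by apply: mulfI; rewrite polyXsubC_eq0.
Qed.

Lemma char_poly_spectral (R : realType) n (A Q : 'M[R]_n) (D : 'rV[R]_n) :
  Q *m Q^T = 1%:M -> A = Q^T *m diag_mx D *m Q ->
  char_poly A = \prod_(x <- [seq D 0 k | k : 'I_n]) ('X - x%:P).
Proof.
move=> QQ AE; have QQ' : Q^T *m Q = 1%:M by exact: mulmx1C.
have dQ : \det Q^T * \det Q = 1 by rewrite -det_mulmx QQ' det1.
rewrite /char_poly /char_poly_mx.
have -> : 'X%:M - map_mx polyC A =
    map_mx polyC Q^T *m ('X%:M - map_mx polyC (diag_mx D)) *m map_mx polyC Q.
  rewrite mulmxBr mulmxBl AE !map_mxM; congr (_ - _).
  by rewrite mul_mx_scalar -scalemxAl -map_mxM QQ' map_mx1 scalemx1.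
rewrite !det_mulmx !det_map_mx /= mulrAC -polyCM dQ polyC1 mul1r.
have -> : 'X%:M - map_mx polyC (diag_mx D) = diag_mx (\row_k ('X - (D 0 k)%:P)).
  apply/matrixP => i j; rewrite !mxE; case: eqP => _; rewrite ?mulr1n //.
  by rewrite !mulr0n subr0.
rewrite det_diag big_map big_enum /=.
by apply: eq_bigr => i _; rewrite !mxE.
Qed.

Lemma row_spectral (R : realType) n (A Q : 'M[R]_n) (D : 'rV[R]_n) :
  Q *m Q^T = 1%:M -> A = Q^T *m diag_mx D *m Q ->
  forall k, row k Q *m A = D 0 k *: row k Q /\ dot (row k Q) (row k Q) = 1.
Proof.
move=> QQ -> k; split.
  rewrite -row_mul !mulmxA QQ mul1mx; apply/rowP => m.
  by rewrite mul_diag_mx !mxE.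
have /matrixP/(_ k k) := QQ; rewrite [RHS]mxE eqxx mulr1n => <-; rewrite mxE.
by apply: eq_bigr => m _; rewrite !mxE.
Qed.

(** [P] stands for an expected adjacency matrix, with [f1] constant and [f2] the
    vector to be recovered.  The eigenvalues [l1] and [l2] and the rest of the
    spectrum are [2 delta] apart in absolute value, so a perturbation of norm
    [kappa <= delta / 16] cannot mix the three parts. *)
Section SpectralGap.
Variables (R : realType) (N : nat) (P : 'M[R]_N) (f1 f2 : 'rV[R]_N).
Variables (l1 l2 l3 delta kappa : R).
Hypothesis (symP : P^T = P) (f11 : dot f1 f1 = 1) (f22 : dot f2 f2 = 1).
Hypothesis (f12 : dot f1 f2 = 0).
Hypothesis (f1P : f1 *m P = l1 *: f1) (f2P : f2 *m P = l2 *: f2).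
Hypothesis (complP : forall x : 'rV[R]_N, dot x f1 = 0 -> dot x f2 = 0 ->
  `|dot (x *m P) x| <= l3 * dot x x).
Hypothesis (l3_ge0 : 0 <= l3) (delta_gt0 : 0 < delta).
Hypothesis (gap32 : l3 + 2 * delta <= `|l2|) (gap21 : `|l2| + 2 * delta <= l1).
Hypothesis (kappa_ge0 : 0 <= kappa) (kappa_small : 16 * kappa <= delta).

Definition near_mx (B : 'M[R]_N) : Prop :=
  B^T = B /\ forall x : 'rV[R]_N, nrm (x *m (B - P)) <= kappa * nrm x.

Lemma nrm_f1 : nrm f1 = 1. Proof. by rewrite /nrm f11 sqrtr1. Qed.
Lemma nrm_f2 : nrm f2 = 1. Proof. by rewrite /nrm f22 sqrtr1. Qed.

(** The component of [y] along each part of the splitting [f1, f2, rest] is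
    controlled by testing [lam y - y P] against that part. *)
Lemma resolvent_components (lam : R) (y : 'rV[R]_N) :
  let F := nrm (lam *: y - y *m P) in
  let r := y - dot y f1 *: f1 - dot y f2 *: f2 in
  [/\ `|lam - l1| * `|dot y f1| <= F, `|lam - l2| * `|dot y f2| <= F &
      (`|lam| - l3) * nrm r <= F].
Proof.
move=> F r.
have d1 : dot (lam *: y - y *m P) f1 = (lam - l1) * dot y f1.
  by rewrite !dotE dot_mulmx symP f1P !dotE; ring.
have d2 : dot (lam *: y - y *m P) f2 = (lam - l2) * dot y f2.
  by rewrite !dotE dot_mulmx symP f2P !dotE; ring.
have rf1 : dot r f1 = 0 by rewrite /r !dotE f11 (dotC f2) f12; ring.
have rf2 : dot r f2 = 0 by rewrite /r !dotE f22 f12; ring.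
have rPf1 : dot (r *m P) f1 = 0 by rewrite dot_mulmx symP f1P dotZr rf1 mulr0.
have rPf2 : dot (r *m P) f2 = 0 by rewrite dot_mulmx symP f2P dotZr rf2 mulr0.
have yE : y = r + dot y f1 *: f1 + dot y f2 *: f2.
  by rewrite /r [_ - _ - _ + _]addrAC subrK subrK.
clearbody r; split.
- by rewrite -normrM -d1 (le_trans (dot_CS _ _)) // nrm_f1 mulr1.
- by rewrite -normrM -d2 (le_trans (dot_CS _ _)) // nrm_f2 mulr1.
have [r0|r0] := eqVneq (nrm r) 0; first by rewrite r0 mulr0 nrm_ge0.
have rp : 0 < nrm r by rewrite lt_def r0 nrm_ge0.
rewrite -(ler_pM2r rp) -mulrA -expr2 nrm_sqr.
have d3 : dot (lam *: y - y *m P) r = lam * dot r r - dot (r *m P) r.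
  rewrite [in LHS]yE !mulmxDl -!scalemxAl f1P f2P !dotE (dotC f1) (dotC f2).
  by rewrite rf1 rf2; ring.
have := dot_CS (lam *: y - y *m P) r; rewrite d3 -/F => h.
apply: le_trans h; apply: le_trans (lerB_dist _ _).
rewrite normrM [X in `|lam| * X]ger0_norm ?dot_ge0 // mulrBl lerB //.
exact: complP.
Qed.

(** If [lam] stays [delta] away from [l1] and from the small part of the
    spectrum, then [lam - P] is invertible off the line of [f2], and passing
    from [P] to [B] costs [kappa * nrm y]. *)
Lemma resolvent_bound (B : 'M[R]_N) (lam : R) (y : 'rV[R]_N) :
  near_mx B -> l3 + delta <= `|lam| -> delta <= `|lam - l1| ->
  nrm (y - dot y f2 *: f2) <=
    2 / delta * (nrm (lam *: y - y *m B) + kappa * nrm y).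
Proof.
move=> [symB nB] h3 h1; have [c1 _ c3] := resolvent_components lam y.
set F := nrm _ in c1 c3; set r := _ - _ - _ in c3.
have FB : F <= nrm (lam *: y - y *m B) + kappa * nrm y.
  apply: le_trans (lerD (lexx _) (nB y)).
  rewrite /F; have -> : lam *: y - y *m P = (lam *: y - y *m B) + y *m (B - P).
    by rewrite mulmxBr addrA subrK.
  exact: nrmD.
have -> : y - dot y f2 *: f2 = dot y f1 *: f1 + r.
  by rewrite /r addrA addrCA subrr addr0.
apply: le_trans (nrmD _ _) _; rewrite nrmZ nrm_f1 mulr1.
rewrite mulrC mulrA ler_pdivlMr //.
have d1 : delta * `|dot y f1| <= F by apply: le_trans c1; rewrite ler_wpM2r.
have d3 : delta * nrm r <= F.
  by apply: le_trans c3; rewrite ler_wpM2r ?nrm_ge0 // lerBrDl.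
by move: d1 d3 FB; lra.
Qed.

(** Were [mu] far from both [l1] and [l2], all three components of [y] would be
    small compared with [y]. *)
Lemma eigenvalue_location (B : 'M[R]_N) (mu : R) (y : 'rV[R]_N) :
  near_mx B -> y *m B = mu *: y -> y != 0 -> l3 + delta <= `|mu| ->
  `|mu - l1| <= 4 * kappa \/ `|mu - l2| <= 4 * kappa.
Proof.
move=> [symB nB] yB y0 h3; have [c1 c2 c3] := resolvent_components mu y.
have yp : 0 < nrm y by rewrite nrm_gt0.
set F := nrm _ in c1 c2 c3; set r := _ - _ - _ in c3.
have FB : F <= kappa * nrm y by apply: le_trans (nB y); rewrite mulmxBr yB.
have [h1|h1] := lerP (`|mu - l1|) (4 * kappa); first by left.
have [h2|h2] := lerP (`|mu - l2|) (4 * kappa); first by right.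
exfalso.
have ky : 0 <= kappa * nrm y by rewrite mulr_ge0 ?nrm_ge0.
have c3' : delta * nrm r <= F.
  by apply: le_trans c3; rewrite ler_wpM2r ?nrm_ge0 // lerBrDl.
have yE : nrm y <= `|dot y f1| + `|dot y f2| + nrm r.
  have {1}-> : y = dot y f1 *: f1 + dot y f2 *: f2 + r.
    by rewrite /r; apply/rowP => i; rewrite !mxE; ring.
  rewrite (le_trans (nrmD _ _)) // lerD2r (le_trans (nrmD _ _)) //.
  by rewrite !nrmZ nrm_f1 nrm_f2 !mulr1.
have q (a t : R) : 4 * kappa < t -> t * a <= F -> 0 <= a -> 4 * a <= nrm y.
  move=> ht hta a0; have t0 : 0 < t by move: ht kappa_ge0; lra.
  rewrite -(ler_pM2l t0) mulrCA.
  have := ler_wpM2r (ltW yp) (ltW ht); move: hta FB; lra.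
have := q _ _ h1 c1 (normr_ge0 _); have := q _ _ h2 c2 (normr_ge0 _).
have : 16 * nrm r <= nrm y.
  rewrite -(ler_pM2l delta_gt0) mulrCA.
  have := ler_wpM2r (ltW yp) kappa_small; move: c3' FB; lra.
by move: yE yp; lra.
Qed.

(** Eigenvalues beyond [l2] belong to vectors that carry more than half of
    [f1].  Two orthonormal vectors cannot both do so, hence there is at most one
    such eigenvalue. *)
Lemma top_eigenvector (B : 'M[R]_N) (mu : R) (y : 'rV[R]_N) :
  near_mx B -> y *m B = mu *: y -> dot y y = 1 -> `|l2| + delta <= `|mu| ->
  2^-1 < dot y f1 ^+ 2.
Proof.
move=> [symB nB] yB y1 h2; have [_ c2 c3] := resolvent_components mu y.
have ny : nrm y = 1 by rewrite /nrm y1 sqrtr1.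
set F := nrm _ in c2 c3; set r := _ - _ - _ in c3.
have FB : F <= kappa.
  by rewrite -[kappa]mulr1 -ny; apply: le_trans (nB y); rewrite mulmxBr yB.
have c2' : delta * `|dot y f2| <= F.
  apply: le_trans c2; rewrite ler_wpM2r //.
  by rewrite (le_trans _ (lerB_dist _ _)) // lerBrDl.
have c3' : delta * nrm r <= F.
  apply: le_trans c3; rewrite ler_wpM2r ?nrm_ge0 //.
  by move: gap32 h2 delta_gt0; lra.
have q (a : R) : delta * a <= F -> 16 * a <= 1.
  move=> h; rewrite -(ler_pM2l delta_gt0) mulrCA mulr1.
  by move: h FB kappa_small; lra.
have yE : nrm y <= `|dot y f1| + `|dot y f2| + nrm r.
  have {1}-> : y = dot y f1 *: f1 + dot y f2 *: f2 + r.
    by rewrite /r; apply/rowP => i; rewrite !mxE; ring.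
  rewrite (le_trans (nrmD _ _)) // lerD2r (le_trans (nrmD _ _)) //.
  by rewrite !nrmZ nrm_f1 nrm_f2 !mulr1.
have h := q _ c2'; have h' := q _ c3'.
have : 3 / 4 <= `|dot y f1| by move: yE h h'; rewrite ny; lra.
rewrite -real_normK ?num_real // => h4; nra.
Qed.

(** If every eigenvalue were further than [kappa] from [l], then [B - l] would
    stretch [f] by more than [kappa], whereas [f (B - l) = f (B - P)]. *)
Lemma spectral_near (B Q : 'M[R]_N) (D : 'rV[R]_N) (f : 'rV[R]_N) l :
  near_mx B -> Q *m Q^T = 1%:M -> B = Q^T *m diag_mx D *m Q ->
  dot f f = 1 -> f *m P = l *: f -> exists k, `|D 0 k - l| <= kappa.
Proof.
move=> [_ nB] QQ BE ff fP; have QQ' : Q^T *m Q = 1%:M by exact: mulmx1C.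
pose g := f *m Q^T.
have gg : dot g g = 1 by rewrite /g dot_mulmx trmxK -mulmxA QQ' mulmx1.
pose h : 'rV[R]_N := g *m diag_mx D - l *: g.
have hE : dot h h <= kappa ^+ 2.
  have -> : dot h h = nrm (f *m (B - P)) ^+ 2.
    have -> : h = f *m (B - P) *m Q^T.
      by rewrite mulmxBr fP mulmxBl BE !mulmxA -(mulmxA _ Q) QQ mulmx1 -scalemxAl.
    by rewrite nrm_sqr dot_mulmx trmxK -mulmxA QQ' mulmx1.
  rewrite ler_sqr ?nnegrE ?nrm_ge0 //.
  by have := nB f; rewrite /(nrm f) ff sqrtr1 mulr1.
apply: contrapT => /forallNP far.
have far' k : kappa ^+ 2 < (D 0 k - l) ^+ 2.
  have /negP := far k; rewrite -ltNge => fk.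
  by rewrite -[X in _ < X]real_normK ?num_real // ltr_sqr ?nnegrE.
have hk k : h 0 k = g 0 k * (D 0 k - l).
  rewrite /h mxE mul_mx_diag !mxE; ring.
have s0 : \sum_k g 0 k ^+ 2 * ((D 0 k - l) ^+ 2 - kappa ^+ 2) <= 0.
  have -> : \sum_k g 0 k ^+ 2 * ((D 0 k - l) ^+ 2 - kappa ^+ 2) =
            dot h h - kappa ^+ 2 * dot g g.
    by rewrite mulr_sumr -sumrB; apply: eq_bigr => k _; rewrite !hk; ring.
  by rewrite gg mulr1 subr_le0.
have t0 k : 0 <= g 0 k ^+ 2 * ((D 0 k - l) ^+ 2 - kappa ^+ 2).
  by rewrite mulr_ge0 ?sqr_ge0 // subr_ge0 ltW.
have : \sum_k g 0 k ^+ 2 * ((D 0 k - l) ^+ 2 - kappa ^+ 2) == 0.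
  by rewrite eq_le s0 sumr_ge0.
rewrite psumr_eq0 // => /allP z.
have g0 : g = 0.
  apply/rowP => k; rewrite [RHS]mxE; have := z k (mem_index_enum _).
  rewrite /= mulf_eq0 sqrf_eq0 subr_eq0 [_ ^+ 2 == kappa ^+ 2]gt_eqF // orbF.
  by move/eqP.
by move: gg; rewrite g0 dot0l => /esym/eqP; rewrite oner_eq0.
Qed.

(** The eigenvalues of [B] near [l1] and [l2] are two whose absolute value is at
    least [l3 + delta], and by [top_eigenvector] at most one reaches
    [`|l2| + delta]; the second largest one lies in between. *)
Lemma second_eigenvalue_near (B : 'M[R]_N) (s : seq R) :
  near_mx B -> char_poly B = \prod_(x <- s) ('X - x%:P) ->
  sorted (fun x y : R => `|y| <= `|x|) s ->
  l3 + delta <= `|s`_1| < `|l2| + delta.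
Proof.
move=> nB sB srt; have [Q [D [QQ BE]]] := sym_spectral nB.1.
have sD : perm_eq s [seq D 0 k | k : 'I_N].
  by apply: perm_eq_XsubC; rewrite -sB (char_poly_spectral QQ BE).
pose C (t : R) := count (fun x : R => t <= `|x|) s.
have CE t : C t = #|[pred k | t <= `|D 0 k|]|.
  rewrite /C (permP sD) count_map -sum1_count big_enum_cond -sum1_card.
  by apply: eq_bigl => k; rewrite !inE.
(* A sorted list whose entry of index [k] is below [t] has at most [k] entries
   above [t]. *)
have lead (t : R) k : (k < size s)%N -> `|s`_k| < t -> (C t <= k)%N.
  move=> ks sk; rewrite /C -(cat_take_drop k s) count_cat.
  rewrite (_ : count _ (drop k s) = 0%N) ?addn0; last first.
    apply/eqP; rewrite eqn0Ngt -has_count -all_predC.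
    apply/allP => x xs /=; rewrite -ltNge (le_lt_trans _ sk) //.
    have tr : transitive (fun x y : R => `|y| <= `|x|).
      by move=> a b c h1 h2; apply: le_trans h2 h1.
    have := drop_sorted k srt; rewrite (drop_nth 0 ks) /=.
    move=> /(order_path_min tr)/allP h.
    by move: xs; rewrite (drop_nth 0 ks) inE => /predU1P[->//|/h].
  by rewrite (leq_trans (count_size _ _)) // size_takel // ltnW.
have two : (1 < C (l3 + delta)%R)%N.
  have [i hi] := spectral_near nB QQ BE f11 f1P.
  have [j hj] := spectral_near nB QQ BE f22 f2P.
  rewrite CE; apply/card_gt1P; exists i, j.
  have l10 : `|l1| = l1 by rewrite ger0_norm //; move: gap21 delta_gt0 (normr_ge0 l2); lra.
  have di : `|l1| - kappa <= `|D 0 i|.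
    by move: (lerB_dist l1 (l1 - D 0 i)); rewrite subKr distrC; move: hi; lra.
  have dj : `|l2| - kappa <= `|D 0 j|.
    by move: (lerB_dist l2 (l2 - D 0 j)); rewrite subKr distrC; move: hj; lra.
  rewrite !inE; split.
  - by move: gap21 gap32 kappa_small delta_gt0 di; rewrite l10; lra.
  - by move: gap32 kappa_small delta_gt0 dj; lra.
  apply/eqP => ij; move: di; rewrite ij l10 => di.
  have : `|D 0 j| <= `|l2| + kappa.
    by move: (ler_normD (D 0 j - l2) l2); rewrite subrK; move: hj; lra.
  by move: gap21 kappa_small delta_gt0 di; lra.
apply/andP; split.
  rewrite leNgt; apply/negP => h; have [s1|s1] := ltnP 1 (size s).
    by move: two; rewrite ltnNge lead.
  by move: two; rewrite ltnNge (leq_trans (count_size _ _)).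
rewrite ltNge; apply/negP => h.
(* On a list with fewer than two entries [s`_1] is the default value [0]. *)
have s1 : (1 < size s)%N.
  rewrite ltnNge; apply/negP => s1; move: h; rewrite (nth_default _ s1) normr0.
  by move: delta_gt0 (normr_ge0 l2); lra.
have : (1 < C (`|l2| + delta)%R)%N.
  case: s s1 h srt @C {sB sD CE lead two} => [|x [|y s]] //= _ h /andP[xy _].
  by rewrite h (le_trans h xy).
rewrite CE => /card_gt1P[i [j []]]; rewrite !inE => hi hj ij.
have rowQ := row_spectral QQ BE.
have ti := top_eigenvector nB (rowQ i).1 (rowQ i).2 hi.
have tj := top_eigenvector nB (rowQ j).1 (rowQ j).2 hj.
have : dot (f1 *m Q^T) (f1 *m Q^T) = 1.
  by rewrite dot_mulmx trmxK -mulmxA (mulmx1C QQ) mulmx1.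
rewrite /dot (bigD1 i) // (bigD1 j) ?(eq_sym j) //=.
have cE k : (f1 *m Q^T) 0 k = dot (row k Q) f1.
  by rewrite mxE; apply: eq_bigr => m _; rewrite !mxE mulrC.
rewrite !cE -!expr2; set rest := \sum_(k < N | _) _.
have : 0 <= rest by apply: sumr_ge0 => k _; rewrite -expr2 sqr_ge0.
by move: ti tj; lra.
Qed.

(** Every eigenvector with eigenvalue near [l2] is, once normalised by its
    component along [f2], close to [f2]. *)
Lemma eigenvector_near (B : 'M[R]_N) (mu : R) (y : 'rV[R]_N) :
  near_mx B -> y *m B = mu *: y -> y != 0 -> `|mu - l2| <= 4 * kappa ->
  dot y f2 != 0 /\ nrm ((dot y f2)^-1 *: y - f2) <= 4 * kappa / delta.
Proof.
move=> nB yB y0 hmu.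
have m2 : `|l2| - 4 * kappa <= `|mu|.
  by move: (lerB_dist l2 (l2 - mu)); rewrite subKr distrC; move: hmu; lra.
have m2' : `|mu| <= `|l2| + 4 * kappa.
  by move: (ler_normD (mu - l2) l2); rewrite subrK; move: hmu; lra.
have h3 : l3 + delta <= `|mu| by move: gap32 kappa_small delta_gt0; lra.
have h1 : delta <= `|mu - l1|.
  rewrite distrC (le_trans _ (lerB_dist _ _)) //.
  by move: (ler_norm l1) gap21 kappa_small delta_gt0; lra.
have := resolvent_bound y nB h3 h1.
rewrite yB subrr (_ : nrm 0 = 0) ?add0r; last by apply/eqP; rewrite nrm_eq0.
set b := dot y f2 => hb; set c := 2 / delta * (kappa * nrm y) in hb.
have yp : 0 < nrm y by rewrite nrm_gt0.
have cE : c <= nrm y / 8.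
  rewrite /c mulrAC ler_pdivrMr //.
  by have := ler_wpM2r (ltW yp) kappa_small; lra.
have yb : nrm y <= `|b| + c.
  by move: (nrmD (b *: f2) (y - b *: f2)); rewrite subrKC nrmZ nrm_f2 mulr1; move: hb; lra.
have b0 : 0 < `|b| by move: yb cE yp; lra.
split; first by rewrite -normr_gt0.
have bn : b != 0 by rewrite -normr_gt0.
have -> : b^-1 *: y - f2 = b^-1 *: (y - b *: f2).
  by rewrite scalerBr scalerA mulVf // scale1r.
rewrite nrmZ normfV mulrC ler_pdivrMr //; apply: le_trans hb _.
rewrite /c -(ler_pM2r delta_gt0).
have -> : 2 / delta * (kappa * nrm y) * delta = 2 * (kappa * nrm y).
  by field; rewrite gt_eqF.
have -> : 4 * kappa / delta * `|b| * delta = 4 * (kappa * `|b|).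
  by field; rewrite gt_eqF.
have : nrm y <= 2 * `|b| by move: yb cE; lra.
by move/(ler_wpM2l kappa_ge0); lra.
Qed.

(** The vector with which eigenvectors are compared in the leave-one-out
    argument. *)
Lemma reference_eigenvector (B : 'M[R]_N) : near_mx B ->
  exists mu w, [/\ w *m B = mu *: w, `|mu - l2| <= 4 * kappa,
    dot w f2 = 1 & nrm (w - f2) <= 4 * kappa / delta].
Proof.
move=> nB; have [Q [D [QQ BE]]] := sym_spectral nB.1.
have [k hk] := spectral_near nB QQ BE f22 f2P.
have [eig unit] := row_spectral QQ BE k.
have hk4 : `|D 0 k - l2| <= 4 * kappa by move: hk kappa_ge0; lra.
have q0 : row k Q != 0.
  by rewrite -dot_eq0 unit oner_eq0.
have [b0 hw] := eigenvector_near nB eig q0 hk4.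
exists (D 0 k), ((dot (row k Q) f2)^-1 *: row k Q); split => //.
  by rewrite -scalemxAl eig !scalerA mulrC.
by rewrite dotZl mulVf.
Qed.

(** [B] is [A] with vertex [i] isolated, and [u], [w] are their eigenvectors near
    [f2].  With [u'] the vector [u] without its entry [i], [y] is the part of
    [u'] that is orthogonal to [w]. *)
Section LeaveOneOut.
Variables (A B : 'M[R]_N) (i : 'I_N).
Hypothesis (nA : near_mx A) (nB : near_mx B).
Hypothesis (BE : forall j k, B j k = if (j == i) || (k == i) then 0 else A j k).
Hypothesis (Aii : A i i = 0).
Variables (lam mu Delta : R) (u w : 'rV[R]_N).
Hypothesis (uA : u *m A = lam *: u) (wB : w *m B = mu *: w).
Hypothesis (lam_near : `|lam - l2| <= 4 * kappa).
Hypothesis (mu_near : `|mu - l2| <= 4 * kappa).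
Hypothesis (uf2 : dot u f2 = 1) (wf2 : dot w f2 = 1).
Hypothesis (u_near : nrm (u - f2) <= 4 * kappa / delta).
Hypothesis (w_near : nrm (w - f2) <= 4 * kappa / delta).
Hypothesis (row_sqr : dot (row i A) (row i A) <= Delta).

Let alpha := dot u w / dot w w.

Lemma kappa_delta : 0 <= 4 * kappa / delta <= 4^-1.
Proof.
rewrite divr_ge0 ?(ltW delta_gt0) ?mulr_ge0 //= ler_pdivrMr //.
by move: kappa_small; lra.
Qed.

Lemma overlap_bounds : 2^-1 <= alpha <= 3 / 2.
Proof.
have [e0 e4] := andP kappa_delta.
have sq (x y : R) : 0 <= y -> x <= y -> y <= 4^-1 -> 0 <= x -> x ^+ 2 <= 16^-1.
  by move=> *; nra.
have hw : dot w w = 1 + nrm (w - f2) ^+ 2.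
  by rewrite nrm_sqr !dotE (dotC f2 w) wf2 f22; ring.
have hu : dot u w = 1 + dot (u - f2) (w - f2).
  by rewrite !dotE (dotC f2 w) wf2 uf2 f22; ring.
have hw2 := sq _ _ e0 w_near e4 (nrm_ge0 _).
have hw1 := sqr_ge0 (nrm (w - f2)).
have hu2 : `|dot (u - f2) (w - f2)| <= 16^-1.
  apply: le_trans (dot_CS _ _) _.
  have : nrm (u - f2) <= 4^-1 by apply: le_trans u_near e4.
  have : nrm (w - f2) <= 4^-1 by apply: le_trans w_near e4.
  by have := nrm_ge0 (u - f2); have := nrm_ge0 (w - f2); nra.
have [lo hi] : - 16^-1 <= dot (u - f2) (w - f2) /\ dot (u - f2) (w - f2) <= 16^-1.
  by move: hu2; rewrite ler_norml => /andP.
have wp : 0 < dot w w by rewrite hw; lra.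
rewrite /alpha ler_pdivlMr // ler_pdivrMr // hu hw.
by apply/andP; split; lra.
Qed.

Let u' : 'rV[R]_N := \row_j (if j == i then 0 else u 0 j).
Let y : 'rV[R]_N := u' - alpha *: w.

Lemma nearby_eigenvalue (t : R) : `|t - l2| <= 4 * kappa ->
  [/\ l3 + delta <= `|t|, delta <= `|t - l1|, delta <= `|t| & 0 < t * l2].
Proof.
move=> ht.
have m2 : `|l2| - 4 * kappa <= `|t|.
  by move: (lerB_dist l2 (l2 - t)); rewrite subKr distrC; move: ht; lra.
have m2' : `|t| <= `|l2| + 4 * kappa.
  by move: (ler_normD (t - l2) l2); rewrite subrK; move: ht; lra.
split.
- by move: gap32 kappa_small delta_gt0; lra.
- rewrite distrC (le_trans _ (lerB_dist _ _)) //.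
  by move: (ler_norm l1) gap21 kappa_small delta_gt0; lra.
- by move: l3_ge0 gap32 kappa_small delta_gt0; lra.
have tl : t * l2 = (t ^+ 2 + l2 ^+ 2 - (t - l2) ^+ 2) / 2 by field.
have l2p : delta <= `|l2| by move: l3_ge0 gap32 delta_gt0; lra.
have h1 : (t - l2) ^+ 2 < l2 ^+ 2.
  rewrite -(real_normK (num_real (t - l2))) -(real_normK (num_real l2)).
  by rewrite ltr_sqr ?nnegrE //; move: ht kappa_small delta_gt0; lra.
by rewrite tl divr_gt0 // -addrA; have := sqr_ge0 t; move: h1; lra.
Qed.

Lemma ref_vanishes : w 0 i = 0.
Proof.
have [_ _ m0 _] := nearby_eigenvalue mu_near.
have /rowP/(_ i) := wB; rewrite !mxE big1 => [/esym/eqP|j _]; last first.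
  by rewrite BE eqxx orbT mulr0.
rewrite mulf_eq0 => /orP[/eqP mu0|/eqP//].
by move: m0 delta_gt0; rewrite mu0 normr0; lra.
Qed.

(** Deleting vertex [i] leaves [u] an eigenvector up to the error [u_i] times
    the deleted row, and this error is amplified at most by the spectral gap. *)
Lemma leave_one_out_residual : nrm y <= 4 / delta * (`|u 0 i| * Num.sqrt Delta).
Proof.
have [h3 h1 _ _] := nearby_eigenvalue lam_near.
have [e0 e4] := andP kappa_delta.
have wp : dot w w != 0.
  rewrite dot_eq0; apply/eqP => w0; move: wf2; rewrite w0 dot0l => /esym/eqP.
  by rewrite oner_eq0.
have u'w : dot u' w = dot u w.
  by apply: eq_bigr => j _; rewrite mxE; case: eqP => // ->; rewrite ref_vanishes !mulr0.
have yw : dot y w = 0 by rewrite /y !dotE u'w /alpha mulfVK // subrr.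
(* [u'] satisfies the eigenvector equation of [B] up to the deleted row. *)
have res : lam *: u' - u' *m B = u 0 i *: row i A.
  apply/rowP => j; rewrite !mxE.
  have [->|ji] := eqVneq j i.
    rewrite Aii !mulr0 big1 ?subr0 // => k _.
    by rewrite BE eqxx orbT mulr0.
  have /rowP/(_ j) := uA; rewrite !mxE => <-; rewrite (bigD1 i) //=.
  rewrite [X in _ - X](bigD1 i) //= !mxE eqxx mul0r add0r.
  rewrite (_ : \sum_(k | k != i) _ = \sum_(k | k != i) u' 0 k * B k j) ?addrK //.
  apply: eq_bigr => k ki; rewrite BE (negbTE ki) (negbTE ji) /= mxE.
  by rewrite (negbTE ki).
pose z := lam *: y - y *m B.
have zE : z = u 0 i *: row i A - (alpha * (lam - mu)) *: w.
  rewrite /z /y -res mulmxBl -scalemxAl wB.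
  by apply/rowP => j; rewrite !mxE; ring.
(* [z] is the component of [u_i * row i A] orthogonal to [w], so it is no longer
   than that vector. *)
have zw : dot z w = 0.
  by rewrite /z dotBl dotZl yw dot_mulmx nB.1 wB dotZr yw !mulr0 subrr.
have nz : nrm z <= `|u 0 i| * Num.sqrt Delta.
  have zz : dot z z = u 0 i * dot z (row i A).
    by rewrite {2}zE dotBr !dotZr zw mulr0 subr0.
  have [->|z0] := eqVneq (nrm z) 0; first by rewrite mulr_ge0 ?sqrtr_ge0.
  have zp : 0 < nrm z by rewrite lt_def z0 nrm_ge0.
  rewrite -(ler_pM2l zp) -expr2 nrm_sqr zz (le_trans (ler_norm _)) //.
  rewrite normrM mulrCA ler_wpM2l // (le_trans (dot_CS _ _)) //.
  by rewrite ler_wpM2l ?nrm_ge0 // ler_wsqrtr.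
have hy := resolvent_bound y nB h3 h1; rewrite -/z in hy.
have yb : `|dot y f2| <= 4 * kappa / delta * nrm y.
  have -> : dot y f2 = - dot y (w - f2) by rewrite dotBr yw sub0r opprK.
  by rewrite normrN (le_trans (dot_CS _ _)) // mulrC ler_wpM2r ?nrm_ge0.
have ny : nrm y <= `|dot y f2| + nrm (y - dot y f2 *: f2).
  by move: (nrmD (dot y f2 *: f2) (y - dot y f2 *: f2)); rewrite subrKC nrmZ nrm_f2 mulr1.
have k4 : 4 * kappa / delta * nrm y <= 4^-1 * nrm y by rewrite ler_wpM2r ?nrm_ge0.
have E : 2 / delta * (nrm z + kappa * nrm y) =
    2 / delta * nrm z + 2^-1 * (4 * kappa / delta * nrm y).
  by field; rewrite gt_eqF.
rewrite E in hy.
have : nrm y <= 4 / delta * nrm z.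
  rewrite (_ : 4 / delta * nrm z = 2 * (2 / delta * nrm z)); last by ring.
  by move: ny hy yb k4 (nrm_ge0 y); lra.
move=> h; apply: le_trans h _; rewrite ler_wpM2l //.
by rewrite divr_ge0 // ltW.
Qed.

Hypothesis (Delta_small : 16 * Delta <= delta ^+ 2).

Lemma leave_one_out_nrm : nrm y <= `|u 0 i|.
Proof.
apply: le_trans leave_one_out_residual _.
rewrite (_ : 4 / _ * _ = `|u 0 i| * (4 * Num.sqrt Delta / delta)); last by ring.
rewrite ler_piMr // ler_pdivrMr // mul1r.
rewrite -ler_sqr ?nnegrE ?mulr_ge0 ?sqrtr_ge0 ?(ltW delta_gt0) // exprMn.
rewrite sqr_sqrtr; first by move: Delta_small; lra.
exact: le_trans (dot_ge0 _) row_sqr.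
Qed.

(** Entries of [w] are bounded by the largest entry of [u], which makes the later
    estimates on neighbourhoods homogeneous in that entry. *)
Lemma leave_one_out_entry (j : 'I_N) (X : R) : (forall j, `|u 0 j| <= X) ->
  `|w 0 j| <= 4 * X.
Proof.
move=> uX; have [a1 a2] := andP overlap_bounds.
have X0 : 0 <= X := le_trans (normr_ge0 _) (uX i).
have u'X : `|u' 0 j| <= X.
  by rewrite mxE; case: eqP => _ //; rewrite normr0.
have yj : `|y 0 j| <= X.
  exact: le_trans (entry_le_nrm _ _) (le_trans leave_one_out_nrm (uX i)).
have aw : alpha * w 0 j = u' 0 j - y 0 j by rewrite /y !mxE; ring.
have : `|alpha * w 0 j| <= 2 * X.
  by rewrite aw (le_trans (ler_normB _ _)) //; move: u'X yj; lra.
rewrite normrM ger0_norm; last by move: a1; lra.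
by have := normr_ge0 (w 0 j); move: a1; nra.
Qed.

(** In the eigenvector equation at [i], [u] may be replaced by a multiple of
    [w].  The error is a small multiple of [u_i] itself, so it can be absorbed
    in the left-hand side [lam * u_i]. *)
Lemma leave_one_out_equation :
  `|lam * u 0 i - alpha * dot (row i A) w| <= delta / 4 * `|u 0 i|.
Proof.
have D0 : 0 <= Delta := le_trans (dot_ge0 _) row_sqr.
have -> : lam * u 0 i - alpha * dot (row i A) w = dot (row i A) y.
  have /rowP/(_ i) := uA; rewrite !mxE => <-.
  rewrite /y !dotE; congr (_ - _); apply: eq_bigr => j _; rewrite !mxE.
  have -> : A i j = A j i by rewrite -{1}nA.1 mxE.
  by case: eqP => [->|_]; rewrite ?Aii ?mulr0 ?mul0r // mulrC.
apply: le_trans (dot_CS _ _) _.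
have rA : nrm (row i A) <= Num.sqrt Delta by rewrite ler_wsqrtr.
apply: le_trans (ler_pM (nrm_ge0 _) (nrm_ge0 _) rA leave_one_out_residual) _.
have -> : Num.sqrt Delta * (4 / delta * (`|u 0 i| * Num.sqrt Delta)) =
    4 / delta * Num.sqrt Delta ^+ 2 * `|u 0 i| by ring.
rewrite sqr_sqrtr // ler_wpM2r // mulrAC ler_pdivrMr //.
by move: Delta_small; lra.
Qed.

End LeaveOneOut.

(** [margin] says that the neighbours of each vertex vote for its own side when
    weighted by [f2] (up to the sign of [l2]), and [refs] says that replacing
    [f2] by the reference vector of the vertex does not change the vote much. *)
Section EntrywiseSign.
Variables (A : 'M[R]_N) (tau Delta eta xi : R).
Hypothesis (nA : near_mx A) (A01 : forall i j, A i j = 0 \/ A i j = 1).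
Hypothesis (Aii : forall i, A i i = 0).
Hypothesis (tau_gt0 : 0 < tau) (f2_abs : forall i, `|f2 0 i| = tau).
Hypothesis (row_sum : forall i, \sum_j A i j <= Delta).
Hypothesis (Delta_small : 16 * Delta <= delta ^+ 2).
Hypothesis (eta_ge0 : 0 <= eta) (eta_small : 24 * eta <= delta).
Hypothesis (xi_gt0 : 0 < xi).
Hypothesis (eta_xi : eta * (4 * (3 * (Delta + delta) / delta) + 1) <= xi).
Hypothesis (margin : forall i,
  2 * xi * tau ^+ 2 <= Num.sg l2 * (f2 0 i * dot (row i A) f2)).
Hypothesis (refs : forall i, exists (B : 'M[R]_N) mu w,
  [/\ near_mx B,
      forall j k, B j k = if (j == i) || (k == i) then 0 else A j k,
      [/\ w *m B = mu *: w, `|mu - l2| <= 4 * kappa, dot w f2 = 1 &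
          nrm (w - f2) <= 4 * kappa / delta] &
      forall Y, tau <= Y -> (forall j, `|w 0 j - f2 0 j| <= Y) ->
        \sum_j A i j * `|w 0 j - f2 0 j| <= eta * Y]).

(** The eigenvector equation at a vertex reads [lam * u_i = vote + error].  First
    it is used at the largest entry, to bound all entries by a multiple of
    [tau]; then the errors at every vertex are smaller than the vote, and [u_i]
    takes its sign. *)
Lemma normalised_eigenvector_sign (lam : R) (u : 'rV[R]_N) :
  u *m A = lam *: u -> `|lam - l2| <= 4 * kappa -> dot u f2 = 1 ->
  nrm (u - f2) <= 4 * kappa / delta -> forall i, 0 < f2 0 i * u 0 i.
Proof.
move=> uA hlam uf2 hu i0.
have A_ge0 i j : 0 <= A i j by case: (A01 i j) => ->.
have Delta0 : 0 <= Delta by apply: le_trans (row_sum i0); apply: sumr_ge0.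
have row_sqr i : dot (row i A) (row i A) <= Delta.
  apply: le_trans (row_sum i); apply: ler_sum => j _; rewrite !mxE.
  by case: (A01 i j) => ->; rewrite ?mulr0 ?mulr1.
have [l3lam _ dlam lamP] := nearby_eigenvalue hlam.
have [im _ immax] := arg_maxP (P := predT) (fun j => `|u 0 j|) (erefl : predT i0).
pose X : R := `|u 0 im|.
have uX j : `|u 0 j| <= X by exact: immax.
(* Each row equation, with the fluctuation of the row along the reference
   vector of that row bounded in terms of the largest entry of [u]. *)
have key i : exists2 alpha, 2^-1 <= alpha <= 3 / 2 &
    exists2 g : R * R, lam * u 0 i = alpha * (dot (row i A) f2 + g.1) + g.2 &
      `|g.1| <= eta * (4 * X + tau) /\ `|g.2| <= delta / 4 * `|u 0 i|.
  have [B [mu [w [nB BE [wB hmu wf2 hw] hY]]]] := refs i.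
  exists (dot u w / dot w w); first exact: overlap_bounds.
  exists (dot (row i A) (w - f2), lam * u 0 i - dot u w / dot w w * dot (row i A) w).
    by rewrite /= dotBr subrKC subrKC.
  split; last first.
    exact: (leave_one_out_equation nA nB BE (Aii i) uA wB hlam hmu wf2 hw
      (row_sqr i) Delta_small).
  apply: le_trans (hY (4 * X + tau) _ _).
  - rewrite /= (le_trans (ler_norm_sum _ _ _)) //; apply: ler_sum => j _.
    by rewrite !mxE normrM (ger0_norm (A_ge0 _ _)).
  - by rewrite lerDr mulr_ge0 // (le_trans _ (uX i)).
  - move=> j; rewrite (le_trans (ler_normB _ _)) // f2_abs lerD2r.
    exact: (leave_one_out_entry nB BE (Aii i) uA wB hlam hmu uf2 wf2 hu hw
      (row_sqr i) Delta_small).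
have deg i : `|dot (row i A) f2| <= Delta * tau.
  apply: le_trans (ler_norm_sum _ _ _) _.
  apply: le_trans (_ : (\sum_j A i j) * tau <= _); last by rewrite ler_wpM2r // ltW.
  rewrite mulr_suml; apply: ler_sum => j _.
  by rewrite normrM f2_abs mxE (ger0_norm (A_ge0 _ _)).
have X0 : 0 <= X by exact: normr_ge0.
(* The largest entry is of the order of those of [f2]. *)
have Xbound : X <= 3 * (Delta + delta) / delta * tau.
  have [al /andP[al1 al2] [g E [g1 g2]]] := key im.
  have : `|lam| * X <= 3 / 2 * (Delta * tau + eta * (4 * X + tau)) + delta / 4 * X.
    rewrite -normrM E (le_trans (ler_normD _ _)) // lerD // normrM ger0_norm; last by lra.
    apply: ler_pM => //; first by lra.
    by rewrite (le_trans (ler_normD _ _)) // lerD.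
  have h1 := ler_wpM2r X0 dlam.
  have h2 := ler_wpM2r X0 eta_small.
  have h3 := ler_wpM2r (ltW tau_gt0) eta_small.
  have h4 : 0 <= delta * tau by rewrite mulr_ge0 ?ltW.
  move=> h; rewrite mulrAC ler_pdivlMr //.
  by move: h h1 h2 h3 h4; lra.
have [al /andP[al1 al2] [g E [g1 g2]]] := key i0.
have g1' : `|g.1| <= xi * tau.
  apply: le_trans g1 _; apply: le_trans (ler_wpM2r (ltW tau_gt0) eta_xi).
  rewrite -[leRHS]mulrA ler_wpM2l //.
  by move: Xbound; lra.
(* With the wrong sign of [u_i] the equation, multiplied by [sg l2 * f2_i], has
   a nonpositive left-hand side.  On the right the vote wins, because the error
   proportional to [u_i] is at most a quarter of the left-hand side. *)
rewrite ltNge; apply/negP => neg.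
have sgl : Num.sg l2 * lam = `|lam|.
  have l20 : l2 != 0 by apply: contraTneq lamP => ->; rewrite mulr0 ltxx.
  have l0 : lam != 0 by apply: contraTneq lamP => ->; rewrite mul0r ltxx.
  have := lamP; rewrite -sgr_cp0 sgrM => /eqP s1.
  by rewrite {1}[lam]numEsg mulrA (mulrC (Num.sg l2)) s1 mul1r.
have fu : f2 0 i0 * u 0 i0 = - (tau * `|u 0 i0|).
  by rewrite -(f2_abs i0) -normrM ler0_norm // opprK.
have : Num.sg l2 * (f2 0 i0 * (lam * u 0 i0)) = - (`|lam| * (tau * `|u 0 i0|)).
  by rewrite -mulrN -fu -sgl; ring.
rewrite E => EE.
have sg1 : `|Num.sg l2| <= 1 by rewrite normr_sg; case: (_ != 0).
have b1 : `|Num.sg l2 * (f2 0 i0 * g.1)| <= xi * tau ^+ 2.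
  rewrite !normrM f2_abs -[leRHS]mul1r ler_pM ?mulr_ge0 // ?(ltW tau_gt0) //.
  rewrite (_ : xi * tau ^+ 2 = tau * (xi * tau)); last by ring.
  by rewrite ler_wpM2l // ltW.
have b2 : `|Num.sg l2 * (f2 0 i0 * g.2)| <= tau * (delta / 4 * `|u 0 i0|).
  rewrite !normrM f2_abs -[leRHS]mul1r ler_pM ?mulr_ge0 // ?(ltW tau_gt0) //.
  by rewrite ler_wpM2l // ltW.
have m0 := margin i0.
have T0 : 0 <= tau * `|u 0 i0| by rewrite mulr_ge0 // ltW.
have h1 := ler_wpM2r T0 dlam.
have h2 : 0 <= delta * (tau * `|u 0 i0|) by rewrite mulr_ge0 // ltW.
have xt : 0 < xi * tau ^+ 2 by rewrite mulr_gt0 ?exprn_gt0.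
have S : xi * tau ^+ 2 <= Num.sg l2 * (f2 0 i0 * (dot (row i0 A) f2 + g.1)).
  by move: b1; rewrite ler_norml => /andP[b1 _]; move: m0 b1; lra.
have S2 : 2^-1 * (xi * tau ^+ 2) <=
    al * (Num.sg l2 * (f2 0 i0 * (dot (row i0 A) f2 + g.1))).
  by apply: ler_pM => //; exact: ltW.
move: b2; rewrite ler_norml => /andP[b2 _].
by move: EE S2 b2 h1 h2 xt; lra.
Qed.

Lemma second_eigenvector_sign (u : 'rV[R]_N) :
  second_eigenvector A u ->
  exists2 c, c != 0 & forall i, 0 < c * (f2 0 i * u 0 i).
Proof.
move=> [s [sA srt u0 us]].
have /andP[lo hi] := second_eigenvalue_near nA sA srt.
have hlam : `|s`_1 - l2| <= 4 * kappa.
  have [h|//] := eigenvalue_location nA us u0 lo; exfalso.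
  have : `|l1| - 4 * kappa <= `|s`_1|.
    by move: (lerB_dist l1 (l1 - s`_1)); rewrite subKr distrC; move: h; lra.
  by move: (ler_norm l1) gap21 kappa_small delta_gt0 hi; lra.
have [b0 hu] := eigenvector_near nA us u0 hlam.
exists (dot u f2)^-1; first by rewrite invr_eq0.
move=> i; rewrite mulrCA.
have := @normalised_eigenvector_sign s`_1 ((dot u f2)^-1 *: u).
rewrite -scalemxAl us dotZl mulVf // !scalerA mulrC => /(_ erefl hlam erefl hu i).
by rewrite mxE.
Qed.

End EntrywiseSign.

End SpectralGap.

(** * From discrepancy to the operator norm *)

Lemma sum_ltn (m c : nat) : (\sum_(l < m) (l < c) = minn m c)%N.
Proof.
elim: m => [|m IH]; first by rewrite big_ord0 min0n.
rewrite big_ord_recr /= IH; case: ltnP => h.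
  by rewrite (minn_idPl h) addn1.
by rewrite addn0 (minn_idPr (leqW h)).
Qed.

(** A bound on all sums over rectangles and a bound on absolute row sums together
    bound the operator norm.  The integer [K] is free: it trades the
    contribution [alpha * K] of the former against [Delta / K] of the latter. *)
Section Discrepancy.
Variables (R : realType) (n : nat) (M : 'M[R]_n) (alpha Delta : R) (K : nat).
Hypothesis (symM : M^T = M) (alpha_gt0 : 0 < alpha) (K_gt0 : (0 < K)%N).
Hypothesis (disc : forall S T : {set 'I_n},
  `|\sum_(i in S) \sum_(j in T) M i j| <= alpha * (#|S| + #|T|)%:R).
Hypothesis (row_abs : forall i, \sum_j `|M i j| <= Delta).

Definition bilin (x y : 'I_n -> R) : R := \sum_i \sum_j x i * M i j * y j.

Let beta := alpha * K%:R + Delta / K%:R.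

Lemma symME i j : M i j = M j i. Proof. by rewrite -{1}symM mxE. Qed.

Lemma bilinC x y : bilin x y = bilin y x.
Proof.
rewrite /bilin exchange_big; apply: eq_bigr => i _; apply: eq_bigr => j _.
by rewrite symME; ring.
Qed.

Lemma bilinDl x x' y :
  bilin (fun i => x i + x' i) y = bilin x y + bilin x' y.
Proof.
rewrite /bilin -big_split; apply: eq_bigr => i _.
by rewrite -big_split; apply: eq_bigr => j _ /=; ring.
Qed.

Lemma bilinZl c x y : bilin (fun i => c * x i) y = c * bilin x y.
Proof.
rewrite /bilin mulr_sumr; apply: eq_bigr => i _.
by rewrite mulr_sumr; apply: eq_bigr => j _ /=; ring.
Qed.

Lemma bilinDr x y y' :
  bilin x (fun i => y i + y' i) = bilin x y + bilin x y'.
Proof. by rewrite bilinC bilinDl !(bilinC _ x). Qed.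

Lemma bilinZr c x y : bilin x (fun i => c * y i) = c * bilin x y.
Proof. by rewrite bilinC bilinZl bilinC. Qed.

Lemma eq_bilin x x' y y' : x =1 x' -> y =1 y' -> bilin x y = bilin x' y'.
Proof. by move=> ex ey; apply: eq_bigr => i _; apply: eq_bigr => j _; rewrite ex ey. Qed.

Lemma bilin_row_bound (S T : {set 'I_n}) :
  `|\sum_(i in S) \sum_(j in T) M i j| <= Delta * #|S|%:R.
Proof.
apply: le_trans (ler_norm_sum _ _ _) _; rewrite mulr_natr -sumr_const.
apply: ler_sum => i _; apply: le_trans (row_abs i).
apply: le_trans (ler_norm_sum _ _ _) _.
by rewrite big_mkcond; apply: ler_sum => j _; case: ifP.
Qed.

Lemma bilin_col_bound (S T : {set 'I_n}) :
  `|\sum_(i in S) \sum_(j in T) M i j| <= Delta * #|T|%:R.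
Proof.
rewrite exchange_big /= (_ : \sum_(j in T) _ = \sum_(j in T) \sum_(i in S) M j i).
  exact: bilin_row_bound.
by apply: eq_bigr => j _; apply: eq_bigr => i _; rewrite symME.
Qed.

(** What a vertex of the level set of height [k] is charged when that set is
    paired with the level set of height [l] of the other vector: [alpha] if [l]
    is not much larger than [k], and [Delta] if [l] is smaller by the factor
    [K]. *)
Let phi (k l : nat) : R :=
  alpha * (l < K * k.+1)%N%:R + Delta * (l < k.+1 %/ K)%N%:R.

Lemma phi_sum m k : 0 <= Delta -> \sum_(l < m) phi k l <= beta * k.+1%:R.
Proof.
move=> D0; rewrite big_split /= -!mulr_sumr -!natr_sum /beta mulrDl; apply: lerD.
  rewrite -mulrA -natrM ler_wpM2l ?(ltW alpha_gt0) // ler_nat.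
  by rewrite sum_ltn geq_minr.
rewrite -mulrA ler_wpM2l // mulrC ler_pdivlMr ?ltr0n // -natrM ler_nat.
apply: leq_trans (leq_trunc_div k.+1 K).
by rewrite leq_mul2r sum_ltn geq_minr orbT.
Qed.

(** Cut both vectors into their level sets.  For two level sets of comparable
    heights use the discrepancy; for very different heights the cruder bound by
    row sums is enough, because the lower heights add up to a small factor. *)
Lemma bilin_nat (x y : 'I_n -> nat) :
  `|bilin (fun i => (x i)%:R) (fun i => (y i)%:R)| <=
    beta * (\sum_i (x i)%:R ^+ 2 + \sum_i (y i)%:R ^+ 2).
Proof.
case: (posnP n) => [n0|n_gt0].
  have e (F : 'I_n -> R) : \sum_i F i = 0.
    by apply: big1 => i; move: (ltn_ord i); rewrite {2}n0.
  by rewrite /bilin !e addr0 mulr0 normr0.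
have D0 : 0 <= Delta.
  by apply: le_trans (row_abs (Ordinal n_gt0)); apply: sumr_ge0.
pose m := (\max_i maxn (x i) (y i))%N.
have xm i : (x i <= m)%N by rewrite (leq_trans (leq_maxl _ (y i))) // (leq_bigmax i).
have ym i : (y i <= m)%N by rewrite (leq_trans (leq_maxr (x i) _)) // (leq_bigmax i).
have lay z : (z <= m)%N -> z%:R = \sum_(k < m) (k < z)%N%:R :> R.
  by move=> zm; rewrite -natr_sum sum_ltn (minn_idPr zm).
pose S k := [set i | (k < x i)%N]%SET; pose T l := [set j | (l < y j)%N]%SET.
have BE : bilin (fun i => (x i)%:R) (fun i => (y i)%:R) =
    \sum_(k < m) \sum_(l < m) \sum_(i in S k) \sum_(j in T l) M i j.
  rewrite /bilin.
  under eq_bigr => i _ do under eq_bigr => j _ do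
    rewrite (lay _ (xm i)) (lay _ (ym j)).
  transitivity (\sum_(k < m) \sum_i \sum_(l < m) \sum_j
     (k < x i)%N%:R * M i j * (l < y j)%N%:R).
    rewrite [RHS]exchange_big /=; apply: eq_bigr => i _.
    under [RHS]eq_bigr => k _ do rewrite exchange_big /=.
    rewrite [RHS]exchange_big /=; apply: eq_bigr => j _.
    rewrite mulr_suml mulr_suml; apply: eq_bigr => k _.
    by rewrite mulr_sumr.
  apply: eq_bigr => k _; rewrite exchange_big /=; apply: eq_bigr => l _.
  rewrite [RHS]big_mkcond /=; apply: eq_bigr => i _; rewrite /S inE.
  case: ifP => _; last by rewrite big1 // => j _; rewrite !mul0r.
  rewrite [RHS]big_mkcond /=; apply: eq_bigr => j _; rewrite /T inE.
  by case: ifP => _; rewrite ?mul1r ?mulr1 ?mulr0.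
have piece k l : `|\sum_(i in S k) \sum_(j in T l) M i j| <=
    #|S k|%:R * phi k l + #|T l|%:R * phi l k.
  have p0 a b : 0 <= phi a b.
    by rewrite addr_ge0 // mulr_ge0 // ?(ltW alpha_gt0).
  have [h1|h1] := ltnP l (K * k.+1); last first.
    apply: le_trans (bilin_col_bound _ _) _.
    rewrite mulrC ler_wpDl ?mulr_ge0 // ler_wpM2l // /phi.
    have -> : (k < l.+1 %/ K)%N by rewrite leq_divRL // mulnC ltnW.
    by rewrite mulr1 lerDr mulr_ge0 // ltW.
  have [h2|h2] := ltnP k (K * l.+1); last first.
    apply: le_trans (bilin_row_bound _ _) _.
    rewrite mulrC ler_wpDr ?mulr_ge0 // ler_wpM2l // /phi.
    have -> : (l < k.+1 %/ K)%N by rewrite leq_divRL // mulnC ltnW.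
    by rewrite mulr1 lerDr mulr_ge0 // ltW.
  apply: le_trans (disc _ _) _; rewrite natrD mulrDr lerD //.
    by rewrite mulrC ler_wpM2l // /phi h1 mulr1 lerDl mulr_ge0.
  by rewrite mulrC ler_wpM2l // /phi h2 mulr1 lerDl mulr_ge0.
have tri z : (z <= m)%N -> \sum_(k < m) (k < z)%N%:R * k.+1%:R <= z%:R ^+ 2 :> R.
  move=> zm; rewrite expr2 {2}(lay _ zm) mulr_sumr; apply: ler_sum => k _.
  by case: ltnP => h; rewrite ?mul0r ?mulr0 // mul1r mulr1 ler_nat.
have lvl (z : 'I_n -> nat) : (forall i, (z i <= m)%N) ->
    \sum_(k < m) #|[set i | (k < z i)%N]%SET|%:R * (beta * k.+1%:R) <=
    beta * \sum_i (z i)%:R ^+ 2.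
  move=> zm; have b0 : 0 <= beta.
    by rewrite addr_ge0 ?mulr_ge0 ?(ltW alpha_gt0) // invr_ge0.
  apply: le_trans (_ : beta * \sum_i \sum_(k < m) (k < z i)%N%:R * k.+1%:R <= _).
    rewrite exchange_big /= mulr_sumr; apply: ler_sum => k _.
    rewrite mulrCA ler_wpM2l // -mulr_suml ler_wpM2r // -sum1_card natr_sum.
    by rewrite big_mkcond; apply: ler_sum => i _; rewrite inE; case: ifP.
  by rewrite ler_wpM2l //; apply: ler_sum => i _; exact: tri.
rewrite BE mulrDr; apply: le_trans (ler_norm_sum _ _ _) _.
apply: le_trans (_ : \sum_(k < m) \sum_(l < m)
   (#|S k|%:R * phi k l + #|T l|%:R * phi l k) <= _).
  apply: ler_sum => k _; apply: le_trans (ler_norm_sum _ _ _) _.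
  by apply: ler_sum => l _; exact: piece.
under eq_bigr => k _ do rewrite big_split /=.
rewrite big_split /=; apply: lerD.
  apply: le_trans (lvl _ xm); apply: ler_sum => k _.
  by rewrite -mulr_sumr ler_wpM2l // phi_sum.
rewrite exchange_big /=; apply: le_trans (lvl _ ym); apply: ler_sum => k _.
by rewrite -mulr_sumr ler_wpM2l // phi_sum.
Qed.

(** Multiply by a large integer [N] and round down.  Both sides grow like [N ^ 2]
    and the rounding error only like [N], so a violation of the inequality
    would persist for natural numbers. *)
Lemma bilin_ge0 (x y : 'I_n -> R) :
  (forall i, 0 <= x i) -> (forall i, 0 <= y i) ->
  `|bilin x y| <= beta * (\sum_i x i ^+ 2 + \sum_i y i ^+ 2).
Proof.
move=> x0 y0; rewrite leNgt; apply/negP => gap.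
pose C := \sum_i \sum_j `|M i j| * (x i + y j).
have C0 : 0 <= C.
  by apply: sumr_ge0 => i _; apply: sumr_ge0 => j _; rewrite mulr_ge0 ?addr_ge0.
pose e : R := `|bilin x y| - beta * (\sum_i x i ^+ 2 + \sum_i y i ^+ 2).
have e0 : 0 < e by rewrite subr_gt0.
pose N := (Num.truncn (C / e)).+1.
have NC : C < N%:R * e.
  by rewrite -ltr_pdivrMr // truncnS_gt.
pose a i := Num.truncn (N%:R * x i); pose b i := Num.truncn (N%:R * y i).
have N0 : 0 < N%:R :> R by rewrite ltr0n.
have b0 : 0 <= beta.
  rewrite addr_ge0 ?mulr_ge0 ?(ltW alpha_gt0) ?invr_ge0 //.
  case: (posnP n) => [n0|n_gt0]; last first.
    by apply: le_trans (row_abs (Ordinal n_gt0)); apply: sumr_ge0.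
  exfalso; move: e0; rewrite /e /bilin !big1 ?normr0 ?addr0 ?mulr0 ?subrr ?ltxx //;
    by move=> i; move: (ltn_ord i); rewrite {2}n0.
have fl (z : R) : 0 <= z -> (Num.truncn z)%:R <= z /\ z - (Num.truncn z)%:R <= 1.
  move=> z0; have /andP[h1 h2] := truncn_itv z0; split => //.
  by move: h2; rewrite -natr1; lra.
have Nx i : 0 <= N%:R * x i by rewrite mulr_ge0 // ltW.
have Ny i : 0 <= N%:R * y i by rewrite mulr_ge0 // ltW.
have hb := bilin_nat a b.
have split_a : bilin (fun i => N%:R * x i) (fun i => N%:R * y i) =
   bilin (fun i => (a i)%:R) (fun i => (b i)%:R) +
   (bilin (fun i => N%:R * x i - (a i)%:R) (fun i => N%:R * y i) +
    bilin (fun i => (a i)%:R) (fun i => N%:R * y i - (b i)%:R)).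
  rewrite addrCA -bilinDr [X in _ + X](eq_bilin (x' := fun i => (a i)%:R)
    (y' := fun i => N%:R * y i)) // => [|i]; last by rewrite subrKC.
  rewrite -bilinDl; apply: eq_bilin => // i; by rewrite subrK.
have r1 : `|bilin (fun i => N%:R * x i - (a i)%:R) (fun i => N%:R * y i)| <=
    N%:R * \sum_i \sum_j `|M i j| * y j.
  rewrite mulr_sumr; apply: le_trans (ler_norm_sum _ _ _) _; apply: ler_sum => i _.
  rewrite mulr_sumr; apply: le_trans (ler_norm_sum _ _ _) _; apply: ler_sum => j _.
  have [h1 h2] := fl _ (Nx i).
  rewrite !normrM (ger0_norm (y0 j)) (ger0_norm (ltW N0)).
  rewrite [X in X * _ * _]ger0_norm ?subr_ge0 //.
  rewrite [leRHS]mulrCA -mulrA ler_piMl // mulr_ge0 // mulr_ge0 // ltW //.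
have r2 : `|bilin (fun i => (a i)%:R) (fun i => N%:R * y i - (b i)%:R)| <=
    N%:R * \sum_i \sum_j `|M i j| * x i.
  rewrite mulr_sumr; apply: le_trans (ler_norm_sum _ _ _) _; apply: ler_sum => i _.
  rewrite mulr_sumr; apply: le_trans (ler_norm_sum _ _ _) _; apply: ler_sum => j _.
  have [h1 h2] := fl _ (Ny j); have [h3 _] := fl _ (Nx i).
  rewrite !normrM [X in _ * X]ger0_norm ?subr_ge0 // [X in X * _ * _]ger0_norm //.
  apply: le_trans (_ : (a i)%:R * `|M i j| <= _).
    by rewrite ler_piMr // mulr_ge0.
  by rewrite mulrCA mulrC ler_wpM2l.
have big : N%:R ^+ 2 * `|bilin x y| <=
    N%:R ^+ 2 * (beta * (\sum_i x i ^+ 2 + \sum_i y i ^+ 2)) + N%:R * C.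
  have -> : N%:R ^+ 2 * `|bilin x y| =
      `|bilin (fun i => N%:R * x i) (fun i => N%:R * y i)|.
    by rewrite bilinZl bilinZr mulrA -expr2 normrM (ger0_norm (sqr_ge0 _)).
  rewrite split_a; apply: le_trans (ler_normD _ _) _; apply: lerD.
    apply: le_trans hb _; rewrite mulrCA ler_wpM2l // mulrDr !mulr_sumr.
    by apply: lerD; apply: ler_sum => i _; rewrite -exprMn ler_sqr ?nnegrE // (fl _ _).1.
  apply: le_trans (ler_normD _ _) _.
  have -> : C = \sum_i \sum_j `|M i j| * y j + \sum_i \sum_j `|M i j| * x i.
    rewrite -big_split; apply: eq_bigr => i _; rewrite -big_split.
    by apply: eq_bigr => j _ /=; ring.
  by rewrite mulrDr lerD.
move: big; rewrite -lerBlDl -mulrBr -/e expr2 -mulrA ler_pM2l // leNgt NC.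
by [].
Qed.

(** Split into positive and negative parts; each square then occurs twice. *)
Lemma bilin_bound (x y : 'I_n -> R) :
  `|bilin x y| <= 2 * beta * (\sum_i x i ^+ 2 + \sum_i y i ^+ 2).
Proof.
pose p (z : 'I_n -> R) i : R := Num.max (z i) 0.
pose q (z : 'I_n -> R) i : R := Num.max (- z i) 0.
have p0 z i : 0 <= p z i by rewrite le_max lexx orbT.
have q0 z i : 0 <= q z i by rewrite le_max lexx orbT.
have zE (z : 'I_n -> R) i : z i = p z i + (-1) * q z i.
  by rewrite /p /q !maxEle; do 2 case: ifP; lra.
have z2 (z : 'I_n -> R) : \sum_i z i ^+ 2 = \sum_i p z i ^+ 2 + \sum_i q z i ^+ 2.
  rewrite -big_split; apply: eq_bigr => i _ /=.
  rewrite /p /q; case: (lerP 0 (z i)) => h.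
    by rewrite max_r ?oppr_le0 // expr0n addr0.
  by rewrite max_l ?oppr_ge0 ?(ltW h) // expr0n add0r sqrrN.
have -> : bilin x y = bilin (p x) (p y) + -1 * bilin (p x) (q y) +
    (-1 * bilin (q x) (p y) + -1 * (-1 * bilin (q x) (q y))).
  rewrite (eq_bilin (zE x) (zE y)) (bilinDl (p x) (fun i => -1 * q x i)).
  rewrite 2!(bilinDr _ (p y) (fun i => -1 * q y i)) 2!(bilinZr (-1) _ (q y)).
  by rewrite 2!(bilinZl (-1) (q x)) mulrCA.
rewrite (z2 x) (z2 y).
have b1 := bilin_ge0 (p0 x) (p0 y); have b2 := bilin_ge0 (p0 x) (q0 y).
have b3 := bilin_ge0 (q0 x) (p0 y); have b4 := bilin_ge0 (q0 x) (q0 y).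
have t (r1 r2 r3 r4 : R) : `|r1 + -1 * r2 + (-1 * r3 + -1 * (-1 * r4))| <=
    `|r1| + `|r2| + `|r3| + `|r4|.
  rewrite mulrA mulrNN !mul1r !mulN1r -!addrA.
  apply: le_trans (ler_normD _ _) _; rewrite lerD2l.
  apply: le_trans (ler_normD _ _) _; rewrite normrN lerD2l.
  by apply: le_trans (ler_normD _ _) _; rewrite normrN.
apply: le_trans (t _ _ _ _) _.
by move: b1 b2 b3 b4; lra.
Qed.

(** Test the bilinear form against the multiple of [x *m M] whose length would
    equal that of [x] if the bound were attained. *)
Lemma discrepancy_nrm (x : 'rV[R]_n) : 0 <= Delta ->
  nrm (x *m M) <= 4 * beta * nrm x.
Proof.
move=> D0; have b0 : 0 < beta.
  by rewrite ltr_wpDr ?mulr_gt0 ?ltr0n // mulr_ge0 // invr_ge0.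
pose z := x *m M; pose t := (4 * beta)^-1.
have t0 : 0 < t by rewrite invr_gt0 mulr_gt0.
have hb := bilin_bound (fun i => x 0 i) (fun i => t * z 0 i).
have bE : bilin (fun i => x 0 i) (fun i => t * z 0 i) = t * nrm z ^+ 2.
  rewrite bilinZr nrm_sqr; congr (_ * _); rewrite /bilin exchange_big.
  by apply: eq_bigr => j _; rewrite /= -mulr_suml {3}/z mxE.
have sE : \sum_i (t * z 0 i) ^+ 2 = t ^+ 2 * nrm z ^+ 2.
  by rewrite nrm_sqr mulr_sumr; apply: eq_bigr => i _; rewrite exprMn -expr2.
have xE : \sum_i x 0 i ^+ 2 = nrm x ^+ 2.
  by rewrite nrm_sqr; apply: eq_bigr => i _; rewrite expr2.
move: hb; rewrite bE sE xE ger0_norm; last by rewrite mulr_ge0 ?sqr_ge0 // ltW.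
have -> : t * nrm z ^+ 2 = 4 * beta * (t ^+ 2 * nrm z ^+ 2).
  by rewrite /t; field; rewrite gt_eqF.
move=> h; rewrite -/z -ler_sqr ?nnegrE ?nrm_ge0 ?mulr_ge0 ?nrm_ge0 ?(ltW b0) //.
have -> : nrm z ^+ 2 = (4 * beta) ^+ 2 * (t ^+ 2 * nrm z ^+ 2).
  by rewrite /t; field; rewrite gt_eqF.
rewrite [leRHS]exprMn ler_pM2l ?exprn_gt0 ?mulr_gt0 //.
rewrite -(ler_pM2l b0); move: h; lra.
Qed.

End Discrepancy.

(** * Random graphs with independent edges *)

Section RandomGraph.
Variables (R : realType) (n : nat).
Implicit Types (A B : 'M[bool]_n) (g : 'I_n -> 'I_n -> bool -> R).

Lemma simple_graphP A :
  reflect ((forall i j, A i j = A j i) /\ (forall i, A i i = false)) (simple_graph A).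
Proof.
apply: (iffP andP) => [[/forallP s /forallP z]|[s z]].
  split=> [i j|i]; last exact/negbTE.
  exact/eqP/(forallP (s i)).
split; apply/forallP => i; last by rewrite z.
by apply/forallP => j; rewrite s.
Qed.

(** A simple graph is a free choice of the entries above the diagonal. *)
Lemma sum_simple_graph_prod g :
  \sum_(A | simple_graph A) \prod_(i < n) \prod_(j < n | (i < j)%N) g i j (A i j) =
  \prod_(i < n) \prod_(j < n | (i < j)%N) (g i j true + g i j false).
Proof.
pose above (e : 'I_n * 'I_n) := (e.1 < e.2)%N.
have flat (G : 'I_n -> 'I_n -> R) :
    \prod_(i < n) \prod_(j < n | (i < j)%N) G i j = \prod_(e | above e) G e.1 e.2.
  by rewrite pair_big_dep.
rewrite flat.
have -> : \prod_(e | above e) (g e.1 e.2 true + g e.1 e.2 false) =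
    \prod_(e | above e) \sum_(b : bool | true) g e.1 e.2 b.
  by apply: eq_bigr => e _; rewrite big_bool.
rewrite (big_distr_big_dep false) /=.
pose mat (f : {ffun 'I_n * 'I_n -> bool}) : 'M[bool]_n :=
  \matrix_(i, j) (if (i < j)%N then f (i, j) else if (j < i)%N then f (j, i) else false).
pose fam A : {ffun 'I_n * 'I_n -> bool} := [ffun e => above e && A e.1 e.2].
rewrite (reindex_onto mat fam) /=; last first.
  move=> A /simple_graphP[s z]; apply/matrixP => i j; rewrite !mxE !ffunE /above /=.
  by case: ltngtP => //= /val_inj ->; rewrite z.
apply: eq_big => [f|f _].
  have -> : simple_graph (mat f).
    apply/simple_graphP; split=> [i j|i]; rewrite !mxE ?ltnn //.
    by case: ltngtP.
  apply/eqP/pfamilyP => [<-|[sup _]].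
    split=> // ; apply/supportP => e; rewrite unfold_in => /negbTE ae.
    by rewrite ffunE /above ae.
  apply/ffunP => -[i j]; rewrite ffunE mxE /above /=.
  case: ltnP => //= h; apply/esym/negbTE/negP => fe.
  have /supportP := sup; move=> /(_ (i, j)); rewrite unfold_in /above /= ltnNge h /=.
  by rewrite fe => /(_ isT).
rewrite flat; apply: eq_bigr => -[i j]; rewrite /above /= => ij.
by rewrite mxE ij.
Qed.

Variable p : 'I_n -> 'I_n -> R.

Definition graph_weight A : R :=
  \prod_(i < n) \prod_(j < n | (i < j)%N) bernoulli_pmf (p i j) (A i j).

Definition graph_E (f : 'M[bool]_n -> R) : R :=
  \sum_(A | simple_graph A) graph_weight A * f A.

Definition graph_Pr (E : 'M[bool]_n -> Prop) : R :=
  \sum_(A | simple_graph A && `[< E A >]) graph_weight A.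

(** Independence of the entries above the diagonal. *)
Lemma graph_E_prod g :
  graph_E (fun A => \prod_(i < n) \prod_(j < n | (i < j)%N) g i j (A i j)) =
  \prod_(i < n) \prod_(j < n | (i < j)%N) (p i j * g i j true + (1 - p i j) * g i j false).
Proof.
rewrite -(sum_simple_graph_prod (fun i j b => bernoulli_pmf (p i j) b * g i j b)).
apply: eq_bigr => A _; rewrite -big_split; apply: eq_bigr => i _.
by rewrite -big_split.
Qed.

Lemma graph_E1 : graph_E (fun=> 1) = 1.
Proof.
transitivity (graph_E (fun=> \prod_(i < n) \prod_(j < n | (i < j)%N) 1)).
  apply: eq_bigr => A _; congr (_ * _); rewrite big1 // => i _; exact: big1.
rewrite (graph_E_prod (fun _ _ _ => 1)) big1 // => i _.
by apply: big1 => j _; rewrite !mulr1 subrKC.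
Qed.

Hypothesis p01 : forall i j, 0 <= p i j <= 1.

Lemma graph_weight_ge0 A : 0 <= graph_weight A.
Proof.
apply: prodr_ge0 => i _; apply: prodr_ge0 => j _; exact: bernoulli_pmf_ge0.
Qed.

Lemma ler_graph_E f f' : (forall A, simple_graph A -> f A <= f' A) ->
  graph_E f <= graph_E f'.
Proof.
by move=> ff'; apply: ler_sum => A sA; rewrite ler_wpM2l ?graph_weight_ge0 ?ff'.
Qed.

Lemma graph_PrE E : graph_Pr E = graph_E (fun A => (`[< E A >])%:R).
Proof.
rewrite /graph_Pr big_mkcondr; apply: eq_bigr => A _.
by case: ifP => _; rewrite ?mulr1 ?mulr0.
Qed.

Lemma graph_Pr_ge0 E : 0 <= graph_Pr E.
Proof. by apply: sumr_ge0 => A _; exact: graph_weight_ge0. Qed.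

Lemma graph_markov E f :
  (forall A, simple_graph A -> 0 <= f A) ->
  (forall A, simple_graph A -> E A -> 1 <= f A) -> graph_Pr E <= graph_E f.
Proof.
move=> f0 f1; rewrite graph_PrE; apply: ler_graph_E => A sA.
by case: asboolP => [/(f1 _ sA)|_] //; exact: f0.
Qed.

Lemma ler_graph_Pr (E F : 'M[bool]_n -> Prop) :
  (forall A, simple_graph A -> E A -> F A) -> graph_Pr E <= graph_Pr F.
Proof.
move=> EF; rewrite graph_PrE [leRHS]graph_PrE; apply: ler_graph_E => A sA.
by case: asboolP => [/(EF _ sA)/asboolP->|_] //; rewrite ler0n.
Qed.

Lemma graph_PrC (E : 'M[bool]_n -> Prop) :
  graph_Pr E = 1 - graph_Pr (fun A => ~ E A).
Proof.
apply/eqP; rewrite eq_sym subr_eq eq_sym -[X in _ == X]graph_E1 !graph_PrE -big_split.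
apply/eqP/eq_bigr => A _ /=; rewrite -mulrDr; congr (_ * _).
by case: (asboolP (E A)) => h; case: asboolP => // _; rewrite ?addr0 ?add0r.
Qed.

Lemma graph_PrU (E F : 'M[bool]_n -> Prop) :
  graph_Pr (fun A => E A \/ F A) <= graph_Pr E + graph_Pr F.
Proof.
rewrite !graph_PrE -big_split; apply: ler_sum => A _ /=.
rewrite -mulrDr ler_wpM2l ?graph_weight_ge0 // -natrD ler_nat.
case: (asboolP (_ \/ _)) => // -[h|h].
  by move/asboolP: h => ->.
by move/asboolP: h => ->; rewrite addn1.
Qed.

Lemma graph_PrU_fin (I : finType) (E : I -> 'M[bool]_n -> Prop) :
  graph_Pr (fun A => exists i, E i A) <= \sum_i graph_Pr (E i).
Proof.
under eq_bigr do rewrite graph_PrE.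
rewrite graph_PrE exchange_big; apply: ler_sum => A _ /=.
rewrite -mulr_sumr ler_wpM2l ?graph_weight_ge0 //.
case: asboolP => [[i /asboolP Ei]|_]; last by apply: sumr_ge0.
by rewrite (bigD1 i) //= Ei lerDl; apply: sumr_ge0.
Qed.

Lemma exp_bernoulli_le (q c : R) : 0 <= q -> q * expR c + (1 - q) <= expR (q * (expR c - 1)).
Proof. by move=> q0; apply: le_trans (expR_ge1Dx _); rewrite mulrBr; lra. Qed.

(** Chernoff bound for a weighted sum of independent edges, with the weights
    already scaled by the exponential parameter. *)
Lemma graph_tail (c : 'I_n -> 'I_n -> R) (t : R) :
  graph_Pr (fun A => t <= \sum_(i < n) \sum_(j < n | (i < j)%N) c i j * (A i j)%:R) <=
  expR (\sum_(i < n) \sum_(j < n | (i < j)%N) p i j * (expR (c i j) - 1) - t).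
Proof.
pose f A := expR (- t) * \prod_(i < n) \prod_(j < n | (i < j)%N) expR (c i j * (A i j)%:R).
apply: le_trans (graph_markov (f := f) _ _) _.
- move=> A _; rewrite mulr_ge0 ?expR_ge0 // prodr_ge0 // => i _.
  by rewrite prodr_ge0 // => j _; exact: expR_ge0.
- move=> A _ h; rewrite /f; under eq_bigr do rewrite -expR_sum.
  by rewrite -expR_sum -expRD -[leLHS]expR0 ler_expR addrC subr_ge0.
have -> : graph_E f = expR (- t) *
    graph_E (fun A => \prod_(i < n) \prod_(j < n | (i < j)%N) expR (c i j * (A i j)%:R)).
  by rewrite /graph_E mulr_sumr; apply: eq_bigr => A _; rewrite mulrCA.
rewrite (graph_E_prod (fun i j b => expR (c i j * b%:R))) addrC expRD.
rewrite ler_wpM2l ?expR_ge0 // expR_sum; apply: ler_prod => i _.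
have [q0 q1] : (forall j, 0 <= p i j) /\ (forall j, 0 <= 1 - p i j).
  by split=> j; have /andP[] := p01 i j; rewrite ?subr_ge0.
rewrite prodr_ge0 /= => [|j _]; last by rewrite addr_ge0 // mulr_ge0 ?expR_ge0.
rewrite expR_sum; apply: ler_prod => j _.
rewrite addr_ge0 ?mulr_ge0 ?expR_ge0 //= !mulr1 mulr0 expR0 mulr1.
exact: exp_bernoulli_le.
Qed.

Definition isolate (i : 'I_n) A : 'M[bool]_n :=
  \matrix_(j, k) [&& j != i, k != i & A j k].

Lemma sum_incident (i : 'I_n) (a : 'I_n -> R) :
  \sum_(k < n) \sum_(l < n | (k < l)%N)
     (if k == i then a l else if l == i then a k else 0) = \sum_(j | j != i) a j.
Proof.
rewrite (bigD1 i) //= eqxx.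
have -> : \sum_(k < n | k != i) \sum_(l < n | (k < l)%N)
    (if k == i then a l else if l == i then a k else 0) =
    \sum_(k < n | (k != i) && (k < i)%N) a k.
  rewrite [RHS]big_mkcondr /=; apply: eq_bigr => k /negbTE ki; rewrite ki.
  rewrite big_mkcond (bigD1 i) //= eqxx big1 ?addr0 // => l /negbTE li.
  by rewrite li; case: ifP.
rewrite [RHS](bigID (fun j : 'I_n => (i < j)%N)) /=; congr (_ + _).
  by apply: eq_bigl => j; rewrite -val_eqE /=; case: ltngtP.
by apply: eq_bigl => j; rewrite -val_eqE /=; case: ltngtP.
Qed.

Hypothesis p_sym : forall i j, p i j = p j i.

(** Condition on the graph with vertex [i] isolated: given it, the entries of
    row [i] are still independent, so a statistic of row [i] whose coefficients
    depend on the rest of the graph has an exponential moment. *)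
Lemma row_exp_moment (i : 'I_n) (F : 'M[bool]_n -> Prop)
    (h : 'M[bool]_n -> 'I_n -> R) (tau : R) :
  (forall B, F B -> \sum_(j | j != i) p i j * (expR (h B j) - 1) <= tau) ->
  graph_E (fun A => (`[< F (isolate i A) >])%:R *
    expR (\sum_(j | j != i) (A i j)%:R * h (isolate i A) j)) <= expR tau.
Proof.
move=> hF.
(* Split according to the graph [B] that is left when [i] is isolated.  The
   indicator of this event is a product over pairs, with factors [gB] that are
   [1] at the pairs containing [i], while the exponential has factors [gh] that
   are [1] at all other pairs. *)
pose ind B A : R := (isolate i A == B)%:R.
pose gB B (k l : 'I_n) (b : bool) : R := if (k == i) || (l == i) then 1 else (b == B k l)%:R.
pose gh B (k l : 'I_n) (b : bool) : R :=
  expR (if k == i then b%:R * h B l else if l == i then b%:R * h B k else 0).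
have indE B A : simple_graph A -> ind B A =
    (simple_graph B && (isolate i B == B))%:R *
    \prod_(k < n) \prod_(l < n | (k < l)%N) gB B k l (A k l).
  move=> /simple_graphP[sA zA]; rewrite /ind; case: eqP => [<-|ne].
    have -> : simple_graph (isolate i A).
      apply/simple_graphP; split=> [k l|k]; rewrite !mxE ?zA ?andbF //.
      by rewrite sA andbCA.
    have -> : isolate i (isolate i A) == isolate i A.
      by apply/eqP/matrixP => k l; rewrite !mxE; do 2 case: eqP.
    rewrite mul1r big1 // => k _; rewrite big1 // => l _; rewrite /gB mxE.
    by do 2 case: eqP => //= _; rewrite eqxx.
  case: andP => [[/simple_graphP[sB zB] /eqP iB]|_]; last by rewrite mul0r.
  suff [k [l [kl bad]]] : exists k l : 'I_n, (k < l)%N /\ gB B k l (A k l) = 0.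
    by rewrite (bigD1 k) //= (bigD1 l) //= bad !mul0r mulr0.
  apply: contrapT => no; apply: ne; apply/matrixP => k l.
  have eqAB (k' l' : 'I_n) : (k' < l')%N -> isolate i A k' l' = B k' l'.
    move=> kl; rewrite -[in RHS]iB !mxE.
    case: eqP => //= ki; case: eqP => //= li.
    apply: contrapT => /eqP/negbTE AB; apply: no; exists k', l'; split => //.
    by rewrite /gB (introF eqP ki) (introF eqP li) /= AB.
  case: (ltngtP k l) => [|lk|/val_inj->]; first exact: eqAB.
    by rewrite sB -eqAB // !mxE sA andbCA.
  by rewrite zB mxE zA !andbF.
have expE B A : simple_graph A ->
    expR (\sum_(j | j != i) (A i j)%:R * h B j) =
    \prod_(k < n) \prod_(l < n | (k < l)%N) gh B k l (A k l).
  move=> /simple_graphP[sA zA]; rewrite -sum_incident expR_sum.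
  apply: eq_bigr => k _; rewrite expR_sum; apply: eq_bigr => l _.
  by rewrite /gh; case: eqP => [->//|_]; case: eqP => // ->; rewrite (sA k).
apply: le_trans (_ : \sum_B graph_E (fun A => ind B A) * expR tau <= _); last first.
  rewrite -mulr_suml ler_piMl ?expR_ge0 // /graph_E exchange_big -graph_E1.
  apply: ler_sum => A _ /=; rewrite -mulr_sumr ler_wpM2l ?graph_weight_ge0 //.
  rewrite (bigD1 (isolate i A)) //= /ind eqxx big1 ?addr0 // => B.
  by rewrite eq_sym => /negbTE->.
apply: le_trans (_ : \sum_(B | `[< F B >])
    graph_E (fun A => ind B A * expR (\sum_(j | j != i) (A i j)%:R * h B j)) <= _).
  rewrite exchange_big /=; apply: ler_sum => A sA; rewrite -mulr_sumr.
  rewrite ler_wpM2l ?graph_weight_ge0 //; case: asboolP => [FA|_]; last first.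
    by rewrite mul0r; apply: sumr_ge0 => B _; rewrite mulr_ge0 ?expR_ge0.
  rewrite mul1r (bigD1 (isolate i A)) /=; last exact/asboolP.
  rewrite /ind eqxx mul1r lerDl; apply: sumr_ge0 => B _.
  by rewrite mulr_ge0 ?expR_ge0.
rewrite big_mkcond; apply: ler_sum => B _.
have E0 : 0 <= graph_E (ind B) * expR tau.
  rewrite mulr_ge0 ?expR_ge0 //; apply: sumr_ge0 => A _.
  by rewrite mulr_ge0 ?graph_weight_ge0.
case: asboolP => // /hF hB.
pose good : R := (simple_graph B && (isolate i B == B))%:R.
have -> : graph_E (fun A => ind B A * expR (\sum_(j | j != i) (A i j)%:R * h B j)) =
    good * graph_E (fun A => \prod_(k < n) \prod_(l < n | (k < l)%N)
                     (gB B k l (A k l) * gh B k l (A k l))).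
  rewrite mulr_sumr; apply: eq_bigr => A sA; rewrite indE // expE // mulrCA -mulrA.
  rewrite [X in _ * X]mulrCA; congr (_ * (_ * _)); rewrite -big_split; apply: eq_bigr => k _.
  by rewrite -big_split.
have -> : graph_E (ind B) =
    good * graph_E (fun A => \prod_(k < n) \prod_(l < n | (k < l)%N) gB B k l (A k l)).
  by rewrite mulr_sumr; apply: eq_bigr => A sA; rewrite indE // mulrCA.
rewrite -mulrA ler_wpM2l // (graph_E_prod (gB B)).
rewrite (graph_E_prod (fun k l b => gB B k l b * gh B k l b)).
have [q0 q1] : (forall k l, 0 <= p k l) /\ (forall k l, 0 <= 1 - p k l).
  by split=> k l; have /andP[] := p01 k l; rewrite ?subr_ge0.
have gB0 k l b : 0 <= gB B k l b by rewrite /gB; case: ifP.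
have P0 k l : 0 <= p k l * gB B k l true + (1 - p k l) * gB B k l false.
  by rewrite addr_ge0 ?mulr_ge0.
apply: (@le_trans _ _ ((\prod_(k < n) \prod_(l < n | (k < l)%N)
    (p k l * gB B k l true + (1 - p k l) * gB B k l false)) *
    expR (\sum_(j | j != i) p i j * (expR (h B j) - 1)))); last first.
  rewrite ler_wpM2l ?ler_expR //.
  by rewrite prodr_ge0 // => k _; rewrite prodr_ge0.
rewrite -sum_incident expR_sum -big_split; apply: ler_prod => k _.
rewrite prodr_ge0 /= => [|l _]; last by rewrite addr_ge0 ?mulr_ge0 ?expR_ge0.
rewrite expR_sum -big_split; apply: ler_prod => l _.
rewrite addr_ge0 ?mulr_ge0 ?expR_ge0 //= /gB /gh.
have [->|ki] := eqVneq k i => /=.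
  rewrite !mul1r !mul0r !mulr1 expR0 !mulr1 subrKC mul1r; exact: exp_bernoulli_le.
have [->|li] := eqVneq l i => /=; last by rewrite expR0 !mulr1.
rewrite !mul1r !mul0r !mulr1 expR0 !mulr1 subrKC mul1r (p_sym k).
exact: exp_bernoulli_le.
Qed.

Lemma row_tail (i : 'I_n) (F : 'M[bool]_n -> Prop)
    (h : 'M[bool]_n -> 'I_n -> R) (tau t : R) :
  (forall B, F B -> \sum_(j | j != i) p i j * (expR (h B j) - 1) <= tau) ->
  graph_Pr (fun A => F (isolate i A) /\
    t <= \sum_j (A i j)%:R * h (isolate i A) j) <= expR (tau - t).
Proof.
move=> hF; apply: le_trans (graph_markov (f := fun A => expR (- t) *
  ((`[< F (isolate i A) >])%:R *
   expR (\sum_(j | j != i) (A i j)%:R * h (isolate i A) j))) _ _) _.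
- by move=> A _; rewrite !mulr_ge0 ?expR_ge0.
- move=> A /simple_graphP[_ zA] [/asboolP -> ht]; rewrite mul1r -expRD.
  rewrite -[leLHS]expR0 ler_expR addrC subr_ge0.
  by move: ht; rewrite (bigD1 i) //= zA mul0r add0r.
rewrite (_ : graph_E _ = expR (- t) * graph_E (fun A => (`[< F (isolate i A) >])%:R *
    expR (\sum_(j | j != i) (A i j)%:R * h (isolate i A) j))); last first.
  by rewrite [in RHS]/graph_E mulr_sumr; apply: eq_bigr => A _; rewrite mulrCA.
by rewrite addrC expRD ler_wpM2l ?expR_ge0 // row_exp_moment.
Qed.

End RandomGraph.

(** * Balls of the tree distance *)

(** Balls of the tree distance are the classes of labels with a common prefix. *)
Lemma tree_dist_le d (x y : d.-tuple bool) k : (k <= d)%N ->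
  (tree_dist x y <= k)%N = (take (d - k) x == take (d - k) y).
Proof.
move=> kd; apply/bigmax_leqP/eqP => [h|h j xy].
  apply: (@eq_from_nth _ false); first by rewrite !size_take !size_tuple.
  move=> j; rewrite size_take size_tuple => jk.
  have jdk : (j < d - k)%N by move: jk; case: ifP => // /negbT; rewrite -leqNgt; lia.
  have jd : (j < d)%N by lia.
  rewrite !nth_take //; apply/eqP/negPn/negP => ne.
  have := h (Ordinal jd); rewrite !(tnth_nth false) /= ne => /(_ isT); lia.
rewrite leqNgt; apply/negP => kj; move: xy; rewrite !(tnth_nth false).
have jdk : (j < d - k)%N by have := ltn_ord j; lia.
by rewrite -(nth_take _ jdk) h nth_take // eqxx.
Qed.

Lemma tree_distC d (x y : d.-tuple bool) : tree_dist x y = tree_dist y x.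
Proof. by apply: eq_bigl => j; rewrite eq_sym. Qed.

Lemma tree_dist_ub d (x y : d.-tuple bool) : (tree_dist x y <= d)%N.
Proof. by rewrite tree_dist_le // subnn !take0. Qed.

Lemma prefix_rcons_nth (w s : seq bool) b : (size w < size s)%N ->
  prefix (rcons w b) s = prefix w s && (nth false s (size w) == b).
Proof.
by move=> ws; rewrite !prefixE size_rcons (take_nth false) // eqseq_rcons.
Qed.

Lemma andb_leqS a k : (a <= k.+1)%N && (a <= k)%N = (a <= k)%N.
Proof. lia. Qed.

Section Tree.
Variables (R : realType) (n d m : nat) (c : 'I_n -> d.-tuple bool).
Hypothesis c_bal : forall x : d.-tuple bool, #|[set v | c v == x]%SET| = m.

Let dist i j := tree_dist (c i) (c j).

Lemma card_mega (w : seq bool) : (size w <= d)%N ->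
  #|mega_community c w| = (m * 2 ^ (d - size w))%N.
Proof.
move kE : (d - size w)%N => k; elim: k w kE => [|k IH] w kE wd.
  have wE : size w == d by lia.
  rewrite expn0 muln1 -(c_bal (Tuple wE)); apply: eq_card => v; rewrite !inE.
  by rewrite prefixE take_oversize ?size_tuple ?(eqP wE) // -val_eqE.
have sw : (size w < d)%N by lia.
have sE : mega_community c w =
    mega_community c (rcons w false) :|: mega_community c (rcons w true).
  apply/setP => v; rewrite !inE !prefix_rcons_nth ?size_tuple //.
  by case: prefix; case: nth.
have dis : #|mega_community c (rcons w false) :&: mega_community c (rcons w true)| = 0%N.
  apply: eq_card0 => v; rewrite !inE !prefix_rcons_nth ?size_tuple //.
  by case: prefix; case: nth.
rewrite sE cardsU dis subn0.
rewrite !IH ?size_rcons //; [rewrite expnS; lia | lia | lia].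
Qed.

Lemma mem_mega_take i j k : (k <= d)%N ->
  (j \in mega_community c (take (d - k) (c i))) = (dist i j <= k)%N.
Proof.
move=> kd; rewrite inE prefixE tree_dist_le // size_take size_tuple.
by rewrite (_ : (if _ then _ else _) = (d - k)%N) 1?eq_sym //; case: ifP => //; lia.
Qed.

Lemma card_ball i k : (k <= d)%N -> #|[set j | (dist i j <= k)%N]%SET| = (m * 2 ^ k)%N.
Proof.
move=> kd; rewrite -(_ : mega_community c (take (d - k) (c i)) = [set j | (dist i j <= k)%N]%SET).
  rewrite card_mega; last by rewrite size_take size_tuple; case: ifP; lia.
  congr (m * 2 ^ _)%N; rewrite size_take size_tuple; case: ifP; lia.
by apply/setP => j; rewrite mem_mega_take // inE.
Qed.

(** The sum of [psi] of the distance over a ball of radius [k], per node of a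
    cluster: [2 ^ (t - 1)] clusters are at distance [t] from a given one. *)
Definition ball_sum (psi : nat -> R) (k : nat) : R :=
  psi 0%N + \sum_(1 <= t < k.+1) 2 ^+ (t - 1) * psi t.

Lemma sum_ball i k (psi : nat -> R) : (k <= d)%N ->
  \sum_(j | (dist i j <= k)%N) psi (dist i j) = m%:R * ball_sum psi k.
Proof.
elim: k => [|k IH] kd.
  rewrite /ball_sum big_geq // addr0.
  rewrite (eq_bigr (fun=> psi 0%N)) => [|j]; last by rewrite leqn0 => /eqP ->.
  have := card_ball i kd; rewrite expn0 muln1 => <-.
  by rewrite -sum1_card natr_sum mulr_suml; apply: eq_big => [j|j _]; rewrite ?inE ?mul1r.
rewrite (bigID (fun j => (dist i j <= k)%N)) /=.
rewrite (eq_bigl (fun j => (dist i j <= k)%N)) => [|j]; last first.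
  exact: andb_leqS.
rewrite IH ?(ltnW kd) // [ball_sum _ k.+1]/ball_sum big_nat_recr //= addrA [RHS]mulrDr.
congr (_ + _).
rewrite (eq_bigr (fun=> psi k.+1)) => [|j]; last first.
  by rewrite -ltnNge => /andP[h1 h2]; congr psi; apply/eqP; rewrite eqn_leq h1 h2.
rewrite sumr_const subSS subn0 -[psi k.+1 *+ _]mulr_natl [RHS]mulrA; congr (_ * _).
have e1 := card_ball i kd; have e2 := card_ball i (ltnW kd).
rewrite -natrX -natrM; congr (_%:R).
move: e1; rewrite -(cardID [pred j | (dist i j <= k)%N] [set j | (dist i j <= k.+1)%N]%SET).
rewrite (_ : #|[predI _ & _]| = (m * 2 ^ k)%N); last first.
  rewrite -e2; apply: eq_card => j; rewrite !inE.
  by rewrite andb_leqS.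
rewrite (_ : #|[predD _ & _]| = #|[pred j | (dist i j <= k.+1)%N & ~~ (dist i j <= k)%N]|).
  by move=> h; apply: (@addnI (m * 2 ^ k)%N); apply: etrans h _; rewrite expnS; lia.
by apply: eq_card => j; rewrite !inE andbC.
Qed.

Variables (w : seq bool) (r : nat).
Hypothesis (rE : (size w + r.+1)%N = d).

Let S := mega_community c w.

Lemma card_mega_split : #|S| = (m * 2 ^ r.+1)%N.
Proof. by rewrite card_mega; [congr (m * 2 ^ _)%N; lia | lia]. Qed.

Lemma mem_mega_dist i j : i \in S -> (j \in S) = (dist i j <= r.+1)%N.
Proof.
rewrite inE prefixE => /eqP iw; rewrite -mem_mega_take; last by lia.
by rewrite (_ : (d - r.+1)%N = size w) ?iw //; lia.
Qed.

(** Inside the mega-community of [w] the next bit of the label decides the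
    child. *)
Definition side (v : 'I_n) : R := (-1) ^+ nth false (c v) (size w).

Lemma side_sqr v : side v * side v = 1.
Proof. by rewrite /side; case: nth; rewrite ?expr0 ?expr1; ring. Qed.

Lemma side_mul i j : i \in S -> j \in S ->
  side i * side j = if (dist i j <= r)%N then 1 else -1.
Proof.
rewrite !inE => wi wj; rewrite /side tree_dist_le; last by lia.
rewrite (_ : (d - r)%N = (size w).+1); last by lia.
rewrite !(take_nth false) ?size_tuple; try lia.
move: wi wj; rewrite !prefixE => /eqP -> /eqP ->; rewrite eqseq_rcons eqxx /=.
by do 2 case: nth; rewrite ?expr0 ?expr1 /=; ring.
Qed.

Lemma sum_mega i (psi : nat -> R) : i \in S ->
  \sum_(j in S) psi (dist i j) =
  m%:R * (ball_sum psi r + 2 ^+ r * psi r.+1).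
Proof.
move=> iS; rewrite (eq_bigl (fun j => (dist i j <= r.+1)%N)); last by move=> j; exact: mem_mega_dist.
rewrite sum_ball; last by lia.
by rewrite [ball_sum _ r.+1]/ball_sum big_nat_recr //= addrA subSS subn0.
Qed.

(** Nodes of the same child are those within distance [r], and all nodes of the
    other child are at distance [r + 1]. *)
Lemma sum_mega_side i (psi : nat -> R) : i \in S ->
  \sum_(j in S) side j * psi (dist i j) =
  side i * (m%:R * (ball_sum psi r - 2 ^+ r * psi r.+1)).
Proof.
move=> iS; have own : \sum_(j | (dist i j <= r)%N) psi (dist i j) = m%:R * ball_sum psi r.
  by rewrite sum_ball //; lia.
have := sum_mega psi iS; rewrite (bigID (fun j => (dist i j <= r)%N)) /=.
have ballS : (fun j => (j \in S) && (dist i j <= r)%N) =1 (fun j => (dist i j <= r)%N).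
  by move=> j; rewrite (mem_mega_dist _ iS) andb_leqS.
rewrite (eq_bigl _ _ ballS) own => tot.
have oth : \sum_(j in S | ~~ (dist i j <= r)%N) psi (dist i j) =
    m%:R * (2 ^+ r * psi r.+1).
  by apply: (addrI (m%:R * ball_sum psi r)); rewrite tot mulrDr.
rewrite (bigID (fun j => (dist i j <= r)%N)) /= (eq_bigl _ _ ballS).
rewrite mulrBr -own -oth mulrBr !mulr_sumr -sumrN; congr (_ + _).
  apply: eq_bigr => j jr; congr (_ * _).
  have jS : j \in S by rewrite (mem_mega_dist _ iS) leqW.
  have := side_mul iS jS; rewrite jr => h.
  by rewrite -[LHS]mul1r -(side_sqr i) -mulrA h mulr1.
apply: eq_bigr => j /andP[jS /negbTE jr].
have := side_mul iS jS; rewrite jr => h.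
by rewrite -mulNr; congr (_ * _); rewrite -[LHS]mul1r -(side_sqr i) -mulrA h mulrN1.
Qed.

End Tree.

(** * The expected matrix of a mega-community *)

(** Summation by parts: for monotone [p] all terms have the same sign, which is
    how the second eigenvalue gets its sign and its size. *)
Lemma ball_sum_abel (R : realType) (p : nat -> R) r :
  ball_sum p r - 2 ^+ r * p r.+1 = \sum_(k < r.+1) 2 ^+ k * (p k - p k.+1).
Proof.
elim: r => [|r IH].
  by rewrite /ball_sum big_geq // big_ord1 addr0 mulrBr !expr0 !mul1r.
rewrite big_ord_recr /= -IH [ball_sum _ r.+1]/ball_sum big_nat_recr //= addrA.
by rewrite -/(ball_sum p r) subSS subn0 exprS; ring.
Qed.

Lemma telescope_tail (R : realType) (p : nat -> R) r t : (t <= r)%N ->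
  p t = p r + \sum_(k < r) (p k - p k.+1) * (t <= k)%N%:R.
Proof.
elim: r => [|r IH]; first by rewrite leqn0 => /eqP->; rewrite big_ord0 addr0.
rewrite leq_eqVlt => /predU1P[->|].
  by rewrite big1 ?addr0 // => k _; rewrite leqNgt ltn_ord mulr0.
rewrite ltnS => tr; rewrite big_ord_recr /= tr mulr1 {1}(IH tr); ring.
Qed.

(** The matrix of edge probabilities inside a mega-community depends on the tree
    distance only.  The constant vector and the vector of sides are
    eigenvectors, with eigenvalues [ref_l1] and [ref_l2], and [ref_l3] bounds
    the matrix on their orthogonal complement. *)
Section ReferenceMatrix.
Variables (R : realType) (n d m : nat) (c : 'I_n -> d.-tuple bool).
Hypothesis c_bal : forall x : d.-tuple bool, #|[set v | c v == x]%SET| = m.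
Hypothesis m_gt0 : (0 < m)%N.
Variables (w : seq bool) (r : nat).
Hypothesis (rE : (size w + r.+1)%N = d).
Variable p : nat -> R.

Let S := mega_community c w.
Let N := #|S|.
Let v (a : 'I_N) : 'I_n := enum_val a.
Let dist i j := tree_dist (c i) (c j).

Definition ref_mx : 'M[R]_N := \matrix_(a, b) p (dist (v a) (v b)).
Definition ref_scale : R := (Num.sqrt N%:R)^-1.
Definition ref_const : 'rV[R]_N := const_mx ref_scale.
Definition ref_side : 'rV[R]_N := \row_a (ref_scale * side R c w (v a)).
Definition ref_l1 : R := m%:R * (ball_sum p r + 2 ^+ r * p r.+1).
Definition ref_l2 : R := m%:R * (ball_sum p r - 2 ^+ r * p r.+1).
Definition ref_l3 : R := \sum_(k < r) `|p k - p k.+1| * (m%:R * 2 ^+ k).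

Lemma enum_mega a : v a \in S. Proof. exact: enum_valP. Qed.

Lemma card_mega_gt0 : 0 < N%:R :> R.
Proof. by rewrite ltr0n /N (card_mega_split c_bal rE) muln_gt0 m_gt0 expn_gt0. Qed.

Lemma ref_scale_gt0 : 0 < ref_scale.
Proof. by rewrite invr_gt0 sqrtr_gt0 card_mega_gt0. Qed.

Lemma ref_scale_sqr : N%:R * ref_scale ^+ 2 = 1.
Proof.
rewrite exprVn sqr_sqrtr ?(ltW card_mega_gt0) // mulfV //.
by rewrite gt_eqF // card_mega_gt0.
Qed.

Lemma ref_mx_sym : ref_mx^T = ref_mx.
Proof. by apply/matrixP => a b; rewrite !mxE /dist tree_distC. Qed.

Lemma sum_enum_mega (F : 'I_n -> R) : \sum_a F (v a) = \sum_(j in S) F j.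
Proof. by rewrite [RHS]big_enum_val. Qed.

Lemma dot_ref_const : dot ref_const ref_const = 1.
Proof.
rewrite -[RHS]ref_scale_sqr /dot; under eq_bigr do rewrite !mxE -expr2.
by rewrite sumr_const card_ord mulr_natl.
Qed.

Lemma dot_ref_side : dot ref_side ref_side = 1.
Proof.
rewrite -dot_ref_const; apply: eq_bigr => a _; rewrite !mxE mulrACA side_sqr.
by rewrite mulr1.
Qed.

Lemma ref_mx_const : ref_const *m ref_mx = ref_l1 *: ref_const.
Proof.
apply/rowP => b; rewrite !mxE mulrC /ref_l1 -(sum_mega c_bal rE p (enum_mega b)) mulr_sumr.
rewrite -sum_enum_mega; apply: eq_bigr => a _; rewrite !mxE /dist tree_distC; ring.
Qed.

Lemma ref_mx_side : ref_side *m ref_mx = ref_l2 *: ref_side.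
Proof.
apply/rowP => b; rewrite !mxE mulrCA (mulrC ref_l2).
rewrite /ref_l2 -(sum_mega_side c_bal rE p (enum_mega b)) mulr_sumr.
rewrite -sum_enum_mega; apply: eq_bigr => a _; rewrite !mxE /dist tree_distC; ring.
Qed.

Lemma sum_side0 : \sum_a side R c w (v a) = 0.
Proof.
case: (pickP (fun a : 'I_N => true)) => [a _|no]; last first.
  by apply: big1 => a; have := no a.
have := sum_mega_side c_bal rE (fun=> 1 : R) (enum_mega a).
rewrite sum_enum_mega => h; transitivity (\sum_(j in S) side R c w j * 1).
  by apply: eq_bigr => j _; rewrite mulr1.
rewrite h ball_sum_abel big1 ?mulr0 // => k _; by rewrite subrr mulr0.
Qed.

Lemma dot_ref_orth : dot ref_const ref_side = 0.
Proof.
rewrite /dot; under eq_bigr do rewrite !mxE mulrA.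
by rewrite -mulr_sumr sum_side0 mulr0.
Qed.

(** The indicator of a ball has row sums [m * 2 ^ k]; bound the product of two
    entries by the mean of their squares. *)
Lemma ball_form_bound (x : 'rV[R]_N) k : (k <= d)%N ->
  `|\sum_a \sum_b x 0 a * x 0 b * (dist (v a) (v b) <= k)%N%:R| <=
  m%:R * 2 ^+ k * dot x x.
Proof.
move=> kd; pose I a b : R := (dist (v a) (v b) <= k)%N%:R.
have symI a b : I a b = I b a by rewrite /I /dist tree_distC.
apply: (@le_trans _ _ (\sum_a \sum_b (x 0 a ^+ 2 * I a b / 2 + x 0 b ^+ 2 * I a b / 2))).
  apply: le_trans (ler_norm_sum _ _ _) _; apply: ler_sum => a _.
  apply: le_trans (ler_norm_sum _ _ _) _; apply: ler_sum => b _.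
  rewrite -/(I a b) -mulrDl -mulrDl [leRHS]mulrAC normrM [X in _ * X]ger0_norm ?ler0n //.
  rewrite ler_wpM2r ?ler0n //.
  rewrite ler_pdivlMr // normrM -(real_normK (num_real (x 0 a))).
  rewrite -(real_normK (num_real (x 0 b))).
  by have := sqr_ge0 (`|x 0 a| - `|x 0 b|); rewrite sqrrB; lra.
rewrite (eq_bigr (fun a => \sum_b (x 0 a ^+ 2 * I a b / 2) +
  \sum_b (x 0 b ^+ 2 * I a b / 2))); last by move=> a _; rewrite big_split.
rewrite big_split /= [X in _ + X]exchange_big /=.
rewrite [X in _ + X](_ : _ = \sum_a \sum_b x 0 a ^+ 2 * I a b / 2); last first.
  by apply: eq_bigr => a _; apply: eq_bigr => b _; rewrite symI.
rewrite -big_split mulr_sumr; apply: ler_sum => a _ /=.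
rewrite -mulr_suml -splitr -mulr_sumr mulrC -expr2 ler_wpM2r ?sqr_ge0 //.
rewrite -natrX -natrM -(card_ball c_bal (v a) kd).
rewrite (sum_enum_mega (fun j => (dist (v a) j <= k)%N%:R)).
rewrite -sum1_card natr_sum big_mkcond [leRHS]big_mkcond /=; apply: ler_sum => j _.
by rewrite [in leRHS]inE /dist; case: ifP => _; case: (_ <= k)%N.
Qed.

(** Write the entries as a combination of the indicators of the balls of the
    tree metric.  On vectors that are orthogonal to both reference vectors the
    two coarsest indicators vanish, and the other ones have norm at most the
    size of their blocks. *)
Lemma ref_mx_compl (x : 'rV[R]_N) :
  dot x ref_const = 0 -> dot x ref_side = 0 ->
  `|dot (x *m ref_mx) x| <= ref_l3 * dot x x.
Proof.
move=> x1 x2.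
have s1 : \sum_a x 0 a = 0.
  apply/eqP; have := x1; rewrite /dot; under eq_bigr do rewrite mxE.
  by rewrite -mulr_suml => /eqP; rewrite mulf_eq0 (gt_eqF ref_scale_gt0) orbF.
have s2 : \sum_a x 0 a * side R c w (v a) = 0.
  apply/eqP; have := x2; rewrite /dot; under eq_bigr do rewrite mxE mulrCA.
  by rewrite -mulr_sumr => /eqP; rewrite mulf_eq0 (gt_eqF ref_scale_gt0).
pose q k := \sum_a \sum_b x 0 a * x 0 b * (dist (v a) (v b) <= k)%N%:R.
have sq (F : 'I_N -> R) : \sum_a \sum_b F a * F b = (\sum_a F a) ^+ 2.
  by rewrite expr2 mulr_suml; apply: eq_bigr => a _; rewrite mulr_sumr.
(* Within distance [r] means in the same child, so the indicator is half the sum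
   of the all-ones matrix and of the matrix of products of sides. *)
have qr : q r = 0.
  have -> : q r = 2^-1 * (\sum_a \sum_b x 0 a * x 0 b +
     \sum_a \sum_b (x 0 a * side R c w (v a)) * (x 0 b * side R c w (v b))).
    rewrite -big_split mulr_sumr; apply: eq_bigr => a _ /=.
    rewrite -big_split mulr_sumr; apply: eq_bigr => b _ /=.
    rewrite (mulrACA (x 0 a)) (side_mul R rE (enum_mega a) (enum_mega b)) -/(dist _ _).
    by case: ifP => _; rewrite ?mulrN1 ?mulr1 ?mulr0 ?addrN ?mulr0 //; field.
  by rewrite !sq s1 s2 expr0n addr0 mulr0.
have E : dot (x *m ref_mx) x = \sum_(k < r) (p k - p k.+1) * q k.
  have -> : \sum_(k < r) (p k - p k.+1) * q k =
     p r.+1 * (\sum_a \sum_b x 0 a * x 0 b) + \sum_(k < r.+1) (p k - p k.+1) * q k.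
    by rewrite sq s1 expr0n mulr0 add0r big_ord_recr /= qr mulr0 addr0.
  rewrite /dot; under eq_bigr do rewrite mxE mulr_suml.
  rewrite mulr_sumr.
  under [X in _ = _ + X]eq_bigr do rewrite mulr_sumr.
  rewrite [X in _ = _ + X]exchange_big -big_split; apply: eq_bigr => b _ /=.
  rewrite mulr_sumr; under [X in _ = _ + X]eq_bigr do rewrite mulr_sumr.
  rewrite [X in _ = _ + X]exchange_big -big_split; apply: eq_bigr => a _ /=.
  rewrite mxE (@telescope_tail _ p r.+1); last by rewrite /dist tree_distC -(mem_mega_dist rE _ (enum_mega b)) enum_mega.
  rewrite mulrDr mulrDl; congr (_ + _); first by ring.
  rewrite mulr_sumr mulr_suml; apply: eq_bigr => k _; rewrite /dist tree_distC; ring.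
rewrite E /ref_l3 mulr_suml; apply: le_trans (ler_norm_sum _ _ _) _.
apply: ler_sum => k _; rewrite normrM -mulrA ler_wpM2l //.
by apply: ball_form_bound; have := ltn_ord k; lia.
Qed.

End ReferenceMatrix.

(** * Deviation from the expected matrix *)

(** Passing to an induced subgraph compresses a matrix by [select_mx], whose rows
    are orthonormal, and so does not increase its norm. *)
Section Restriction.
Variables (R : realType) (n : nat) (S : {set 'I_n}).

Definition select_mx : 'M[R]_(#|S|, n) := \matrix_(a, j) (enum_val a == j)%:R.

Lemma select_mx_orth : select_mx *m select_mx^T = 1%:M.
Proof.
apply/matrixP => a b; rewrite !mxE (bigD1 (enum_val a)) //= !mxE eqxx mul1r.
rewrite big1 ?addr0 => [|j ja]; last by rewrite !mxE eq_sym (negbTE ja) mul0r.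
by rewrite eq_sym (inj_eq enum_val_inj).
Qed.

Lemma nrm_select (x : 'rV[R]_#|S|) : nrm (x *m select_mx) = nrm x.
Proof. by rewrite /nrm dot_mulmx -mulmxA select_mx_orth mulmx1. Qed.

Lemma nrm_select_tr (y : 'rV[R]_n) : nrm (y *m select_mx^T) <= nrm y.
Proof.
set z := y *m _; have [->|z0] := eqVneq (nrm z) 0; first exact: nrm_ge0.
have zp : 0 < nrm z by rewrite lt_def z0 nrm_ge0.
rewrite -(ler_pM2r zp) -expr2 nrm_sqr {1}/z dot_mulmx trmxK.
by rewrite (le_trans (ler_norm _)) // (le_trans (dot_CS _ _)) // nrm_select.
Qed.

Lemma restrict_mxE (E : 'M[R]_n) (E' : 'M[R]_#|S|) :
  (forall a b, E' a b = E (enum_val a) (enum_val b)) ->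
  E' = select_mx *m E *m select_mx^T.
Proof.
move=> h; apply/matrixP => a b; rewrite h !mxE (bigD1 (enum_val b)) //= !mxE eqxx.
rewrite mulr1 (bigD1 (enum_val a)) //= !mxE eqxx mul1r.
rewrite [X in _ = _ + X + _]big1 => [|i ia]; last by rewrite mxE eq_sym (negbTE ia) mul0r.
by rewrite big1 ?addr0 // => j jb; rewrite !mxE [_ == j]eq_sym (negbTE jb) mulr0.
Qed.

Lemma restrict_nrm (E : 'M[R]_n) (E' : 'M[R]_#|S|) kappa :
  (forall a b, E' a b = E (enum_val a) (enum_val b)) ->
  (forall y : 'rV[R]_n, nrm (y *m E) <= kappa * nrm y) ->
  forall x : 'rV[R]_#|S|, nrm (x *m E') <= kappa * nrm x.
Proof.
move=> /restrict_mxE -> h x; rewrite !mulmxA (le_trans (nrm_select_tr _)) //.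
by rewrite (le_trans (h _)) // nrm_select.
Qed.

End Restriction.

Section Deviation.
Variables (R : realType) (n : nat) (P : 'I_n -> 'I_n -> R).
Hypothesis (P_sym : forall i j, P i j = P j i) (P_ge0 : forall i j, 0 <= P i j).
Variables (alpha Dg Dp : R).
Hypothesis (alpha_gt0 : 0 < alpha) (P_le : forall i j, P i j <= alpha).
Hypothesis (P_row : forall i, \sum_j P i j <= Dp).

Definition deviation (A : 'M[bool]_n) : 'M[R]_n := \matrix_(i, j) ((A i j)%:R - P i j).

Definition low_discrepancy (A : 'M[bool]_n) : Prop := forall S T : {set 'I_n},
  `|\sum_(i in S) \sum_(j in T) deviation A i j| <= alpha * (#|S| + #|T|)%:R.

(** Isolating [v] leaves the deviation on the rectangle without [v], plus the
    probabilities in one row and one column, which are at most [alpha] each. *)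
Lemma deviation_isolate (A : 'M[bool]_n) v : low_discrepancy A ->
  forall S T : {set 'I_n},
  `|\sum_(i in S) \sum_(j in T) deviation (isolate v A) i j| <=
    2 * alpha * (#|S| + #|T|)%:R.
Proof.
move=> hA S T.
have dE i j : deviation (isolate v A) i j =
    ((i != v) && (j != v))%:R * deviation A i j -
    ((i == v) || (j == v))%:R * P i j.
  rewrite !mxE; case: (i == v) => /=; first by rewrite mul0r mul1r !sub0r.
  by case: (j == v) => /=; rewrite ?mul0r ?mul1r ?sub0r ?subr0.
under eq_bigr do under eq_bigr do rewrite dE.
under eq_bigr do rewrite sumrB.
rewrite sumrB (le_trans (ler_normB _ _)) //.
rewrite -mulrA [2 * _]mulr_natl mulr2n lerD //.
  have -> : \sum_(i in S) \sum_(j in T) ((i != v) && (j != v))%:R * deviation A i j =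
      \sum_(i in S :\ v) \sum_(j in T :\ v) deviation A i j.
    rewrite big_mkcond [RHS]big_mkcond; apply: eq_bigr => i _; rewrite !inE.
    case: (i == v) => /=.
      by case: ifP => // _; rewrite big1 // => j _; rewrite mul0r.
    case: ifP => // _; rewrite big_mkcond [RHS]big_mkcond; apply: eq_bigr => j _.
    by rewrite !inE; case: (j == v) => /=; case: ifP; rewrite ?mul0r ?mul1r.
  apply: le_trans (hA _ _) _; rewrite ler_wpM2l ?(ltW alpha_gt0) // ler_nat.
  by rewrite leq_add // subset_leq_card // subD1set.
have t0 i j : 0 <= ((i == v) || (j == v))%:R * P i j by rewrite mulr_ge0.
rewrite ger0_norm; last by apply: sumr_ge0 => i _; apply: sumr_ge0.
apply: (@le_trans _ _ (\sum_(i in S) \sum_(j in T)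
    ((i == v)%:R * alpha + (j == v)%:R * alpha))).
  apply: ler_sum => i _; apply: ler_sum => j _; have := P_le i j; have := P_ge0 i j.
  by move: alpha_gt0; case: (i == v); case: (j == v) => /=; rewrite ?mul0r ?mul1r; lra.
have one (U : {set 'I_n}) : \sum_(i in U) (i == v)%:R * alpha <= alpha.
  rewrite big_mkcond (bigD1 v) //= big1 ?addr0 => [|i /negbTE ->]; last first.
    by rewrite mul0r; case: ifP.
  by rewrite eqxx mul1r; case: ifP => // _; rewrite ltW.
have -> : \sum_(i in S) \sum_(j in T) ((i == v)%:R * alpha + (j == v)%:R * alpha) =
    (\sum_(i in S) (i == v)%:R * alpha) * #|T|%:R +
    (\sum_(j in T) (j == v)%:R * alpha) * #|S|%:R.
  rewrite (eq_bigr (fun i => (i == v)%:R * alpha *+ #|T| +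
    \sum_(j in T) (j == v)%:R * alpha)) => [|i _]; last first.
    by rewrite big_split /= sumr_const.
  rewrite big_split /= sumr_const mulr_natr; congr (_ + _).
    by rewrite sumrMnl.
  by rewrite mulr_natr.
by rewrite addnC natrD mulrDr lerD // ler_wpM2r // ?one.
Qed.

Variable K : nat.
Hypothesis K_gt0 : (0 < K)%N.

Lemma deviation_nrm_aux (A : 'M[bool]_n) (b : R) :
  0 < b -> simple_graph A ->
  (forall S T : {set 'I_n},
    `|\sum_(i in S) \sum_(j in T) deviation A i j| <= b * (#|S| + #|T|)%:R) ->
  (forall i, \sum_j (A i j)%:R <= Dg) ->
  0 <= Dg -> 0 <= Dp ->
  forall x : 'rV[R]_n,
    nrm (x *m deviation A) <= 4 * (b * K%:R + (Dg + Dp) / K%:R) * nrm x.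
Proof.
move=> b0 /simple_graphP[sA _] hA deg Dg0 Dp0 x.
apply: discrepancy_nrm => //; last exact: addr_ge0.
  by apply/matrixP => i j; rewrite !mxE sA P_sym.
move=> i; apply: le_trans (lerD (deg i) (P_row i)).
rewrite -big_split; apply: ler_sum => j _; rewrite mxE.
by rewrite (le_trans (ler_normB _ _)) // !ger0_norm.
Qed.

Lemma isolate_simple (A : 'M[bool]_n) v : simple_graph A -> simple_graph (isolate v A).
Proof.
move=> /simple_graphP[sA zA]; apply/simple_graphP; split=> [i j|i]; rewrite !mxE.
  by rewrite sA andbCA.
by rewrite zA !andbF.
Qed.

(** One event of low discrepancy controls the graph and all the graphs that
    arise by isolating a vertex. *)
Lemma deviation_nrm (A : 'M[bool]_n) : simple_graph A -> low_discrepancy A ->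
  (forall i, \sum_j (A i j)%:R <= Dg) -> 0 <= Dg -> 0 <= Dp ->
  let k := 4 * (2 * alpha * K%:R + (Dg + Dp) / K%:R) in
  (forall x : 'rV[R]_n, nrm (x *m deviation A) <= k * nrm x) /\
  (forall v (x : 'rV[R]_n), nrm (x *m deviation (isolate v A)) <= k * nrm x).
Proof.
move=> sA hA deg Dg0 Dp0 k; split=> [|v].
  apply: deviation_nrm_aux => //; first by rewrite mulr_gt0.
  move=> S T; apply: le_trans (hA S T) _; rewrite ler_wpM2r //.
  by move: alpha_gt0; lra.
apply: deviation_nrm_aux; rewrite ?isolate_simple ?mulr_gt0 //.
  exact: deviation_isolate.
move=> i; apply: le_trans (deg i); apply: ler_sum => j _; rewrite mxE ler_nat.
by case: (_ != _); case: (_ != _).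
Qed.

End Deviation.

(** * Sufficient conditions for a correct split *)

Section Recovery.
Variables (R : realType) (n d m : nat) (c : 'I_n -> d.-tuple bool).
Hypothesis c_bal : forall x : d.-tuple bool, #|[set v | c v == x]%SET| = m.
Hypothesis m_gt0 : (0 < m)%N.
Variables (w : seq bool) (r : nat).
Hypothesis (rE : (size w + r.+1)%N = d).
Variable p : nat -> R.

Let S := mega_community c w.
Let N := #|S|.
Let P i j : R := p (tree_dist (c i) (c j)).
Let l1 := ref_l1 m r p.
Let l2 := ref_l2 m r p.
Let l3 := ref_l3 m r p.
Let f1 : 'rV[R]_N := ref_const R c w.
Let f2 : 'rV[R]_N := ref_side R c w.
Let tau : R := ref_scale R c w.

Variables (delta kappa Delta eta xi : R).
Hypothesis (delta_gt0 : 0 < delta) (gap32 : l3 + 2 * delta <= `|l2|).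
Hypothesis (gap21 : `|l2| + 2 * delta <= l1).
Hypothesis (kappa_ge0 : 0 <= kappa) (kappa_small : 16 * kappa <= delta).
Hypothesis (Delta_small : 16 * Delta <= delta ^+ 2).
Hypothesis (eta_ge0 : 0 <= eta) (eta_small : 24 * eta <= delta).
Hypothesis (xi_gt0 : 0 < xi).
Hypothesis (eta_xi : eta * (4 * (3 * (Delta + delta) / delta) + 1) <= xi).

Definition is_reference (B : 'M[R]_N) (x : 'rV[R]_N) : Prop :=
  exists mu, [/\ x *m B = mu *: x, `|mu - l2| <= 4 * kappa, dot x f2 = 1 &
    nrm (x - f2) <= 4 * kappa / delta].

(** A choice made once for every graph.  Applied to the graph with [v] isolated it
    is a function of the edges that avoid [v], hence independent of the row of
    [v]. *)
Definition reference (B : 'M[bool]_n) : 'rV[R]_N :=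
  xget 0 [set x | is_reference (induced_adjacency R B S) x].

Variable A : 'M[bool]_n.
Hypothesis (simpleA : simple_graph A).
Hypothesis (devA : forall x : 'rV[R]_n, nrm (x *m deviation P A) <= kappa * nrm x).
Hypothesis (devB : forall v (x : 'rV[R]_n),
  nrm (x *m deviation P (isolate v A)) <= kappa * nrm x).
Hypothesis (deg : forall i, \sum_j (A i j)%:R <= Delta).
Hypothesis (margin : forall v, v \in S ->
  2 * xi <= Num.sg l2 * (side R c w v * \sum_(j in S) (A v j)%:R * side R c w j)).
Hypothesis (refs : forall a : 'I_N,
  let x := reference (isolate (enum_val a) A) in
  is_reference (induced_adjacency R (isolate (enum_val a) A) S) x ->
  forall Y, tau <= Y -> (forall b, `|x 0 b - f2 0 b| <= Y) ->
  \sum_b (A (enum_val a) (enum_val b))%:R * `|x 0 b - f2 0 b| <= eta * Y).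

Lemma near_induced (B : 'M[bool]_n) : simple_graph B ->
  (forall x : 'rV[R]_n, nrm (x *m deviation P B) <= kappa * nrm x) ->
  near_mx (ref_mx c w p) kappa (induced_adjacency R B S).
Proof.
move=> /simple_graphP[sB _] h; split; first by apply/matrixP => a b; rewrite !mxE sB.
by apply: restrict_nrm h => a b; rewrite !mxE.
Qed.

Lemma ref_l3_ge0 : 0 <= l3.
Proof. by apply: sumr_ge0 => k _; rewrite !mulr_ge0 // exprn_ge0. Qed.

Lemma eigenvector_side (u : 'rV[R]_N) :
  second_eigenvector (induced_adjacency R A S) u ->
  exists2 t, t != 0 & forall a, 0 < t * (side R c w (enum_val a) * u 0 a).
Proof.
move=> hu; have [sA zA] := simple_graphP _ simpleA.
have tau0 := ref_scale_gt0 R c_bal m_gt0 rE.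
have := @second_eigenvector_sign R N (ref_mx c w p) f1 f2 l1 l2 l3 delta kappa
  (ref_mx_sym _ _ _) (dot_ref_const R c_bal m_gt0 rE) (dot_ref_side R c_bal m_gt0 rE)
  (dot_ref_orth R c_bal rE) (ref_mx_const c_bal rE p) (ref_mx_side c_bal rE p)
  (ref_mx_compl c_bal m_gt0 rE p) ref_l3_ge0 delta_gt0 gap32 gap21 kappa_ge0 kappa_small
  (induced_adjacency R A S) tau Delta eta xi (near_induced simpleA devA).
move=> main; case: (fun h1 h2 h3 h4 h5 h6 => main h1 h2 tau0 h3 h4 Delta_small
  eta_ge0 eta_small xi_gt0 eta_xi h5 h6 u hu).
- by move=> a b; rewrite mxE; case: (A _ _); [right | left].
- by move=> a; rewrite mxE zA.
- move=> a; rewrite mxE normrM gtr0_norm // /side.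
  by case: nth; rewrite ?expr0 ?expr1 ?normrN normr1 mulr1.
- move=> a; apply: le_trans (deg (enum_val a)).
  have -> : \sum_b induced_adjacency R A S a b = \sum_(j in S) (A (enum_val a) j)%:R.
    by rewrite [RHS]big_enum_val; apply: eq_bigr => b _; rewrite mxE.
  by rewrite [leLHS]big_mkcond; apply: ler_sum => j _; case: ifP.
- move=> a; rewrite mxE.
  have -> : dot (row a (induced_adjacency R A S)) f2 =
      tau * \sum_(j in S) (A (enum_val a) j)%:R * side R c w j.
    rewrite big_enum_val mulr_sumr; apply: eq_bigr => b _; rewrite !mxE.
    by rewrite mulrCA.
  have := margin (enum_valP a); rewrite -/S.
  rewrite -(ler_pM2r (exprn_gt0 2 tau0)).
  by congr (_ <= _); rewrite -/tau; ring.
- move=> a; have sB := isolate_simple (enum_val a) simpleA.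
  have nB := near_induced sB (devB (enum_val a)).
  have ex : exists x, is_reference (induced_adjacency R (isolate (enum_val a) A) S) x.
    have [mu [x [h1 h2 h3 h4]]] := @reference_eigenvector R N (ref_mx c w p) f1 f2
      l1 l2 l3 delta kappa (ref_mx_sym _ _ _) (dot_ref_const R c_bal m_gt0 rE)
      (dot_ref_side R c_bal m_gt0 rE) (dot_ref_orth R c_bal rE)
      (ref_mx_const c_bal rE p) (ref_mx_side c_bal rE p)
      (ref_mx_compl c_bal m_gt0 rE p) delta_gt0 gap32 gap21 kappa_ge0 kappa_small _ nB.
    by exists x, mu.
  have href : is_reference (induced_adjacency R (isolate (enum_val a) A) S)
      (reference (isolate (enum_val a) A)) := xgetPex 0 ex.
  have [mu [h1 h2 h3 h4]] := href.
  exists (induced_adjacency R (isolate (enum_val a) A) S), mu,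
    (reference (isolate (enum_val a) A)); split => //.
    move=> b b'; rewrite !mxE !(inj_eq enum_val_inj).
    by case: (b == a); case: (b' == a).
  move=> Y hY hb; have := refs href hY hb.
  by congr (_ <= _); apply: eq_bigr => b _; rewrite [X in _ = X * _]mxE.
move=> t t0 ht; exists (t * tau); first by rewrite mulf_neq0 // gt_eqF.
by move=> a; have := ht a; rewrite mxE -mulrA mulrA -/tau -!mulrA.
Qed.

(** The eigenvector has, up to a global sign, positive entries on one child and
    negative entries on the other. *)
Lemma split_correct : sign_splits_correctly R c A w.
Proof.
move=> u /eigenvector_side[t t0 ht].
have wc v : (size w < size (c v))%N by rewrite size_tuple -rE addnS ltnS leq_addr.
have child (Q : pred 'I_N) b : (forall a, Q a = (nth false (c (enum_val a)) (size w) == b)) ->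
    [set enum_val a | a : 'I_N & Q a]%SET = mega_community c (rcons w b).
  move=> hQ; apply/setP => v; apply/imsetP/idP => [[a]|].
    rewrite inE hQ => qa ->; rewrite inE prefix_rcons_nth // qa andbT.
    by have := enum_valP a; rewrite inE.
  rewrite inE prefix_rcons_nth // => /andP[wv vb].
  have vS : v \in S by rewrite inE.
  by exists (enum_rank_in vS v); rewrite ?inE ?hQ enum_rankK_in.
have sgn a : t * ((-1) ^+ nth false (c (enum_val a)) (size w) * u 0 a) > 0 := ht a.
rewrite /sign_split /mega_children.
have [tp|tn] := ltP 0 t.
  rewrite (child (fun a => 0 <= u 0 a) false); last first.
    move=> a; have := sgn a; rewrite pmulr_rgt0 //; case: nth => /=.
      by rewrite expr1 mulN1r oppr_gt0 => /lt_geF ->.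
    by rewrite expr0 mul1r => /ltW ->.
  rewrite (child (fun a => u 0 a < 0) true) // => a.
  have := sgn a; rewrite pmulr_rgt0 //; case: nth => /=.
    by rewrite expr1 mulN1r oppr_gt0 => ->.
  by rewrite expr0 mul1r => /lt_gtF ->.
have tneg : t < 0 by rewrite lt_neqAle t0.
rewrite (child (fun a => 0 <= u 0 a) true); last first.
  move=> a; have := sgn a; rewrite nmulr_rgt0 //; case: nth => /=.
    by rewrite expr1 mulN1r oppr_lt0 => /ltW ->.
  by rewrite expr0 mul1r => /lt_geF ->.
rewrite (child (fun a => u 0 a < 0) false); first by rewrite finset.setUC.
move=> a; have := sgn a; rewrite nmulr_rgt0 //; case: nth => /=.
  by rewrite expr1 mulN1r oppr_lt0 => /lt_gtF ->.
by rewrite expr0 mul1r => ->.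
Qed.

End Recovery.

(** * Degrees and discrepancy of the random graph *)

(** A consequence of [expR x * (1 - x) <= 1]. *)
Lemma expR_le_quad (R : realType) (x : R) : x <= 2^-1 -> expR x - 1 - x <= 2 * x ^+ 2.
Proof.
move=> x2; have x1 : 0 < 1 - x by lra.
have := ler_wpM2l (expR_ge0 x) (expR_ge1Dx (- x)); rewrite expRxMexpNx_1 => h.
have h1 : 0 <= x ^+ 2 * (1 - 2 * x) by rewrite mulr_ge0 ?sqr_ge0 //; lra.
rewrite -subr_ge0 -(pmulr_lge0 _ x1).
have -> : (2 * x ^+ 2 - (expR x - 1 - x)) * (1 - x) =
    x ^+ 2 * (1 - 2 * x) + (1 - expR x * (1 + - x)) by ring.
by rewrite addr_ge0 // subr_ge0.
Qed.

Lemma exp_pair_le (R : realType) (t : R) (x y : bool) : 0 <= t ->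
  expR (t * (x%:R + y%:R)) - 1 - t * (x%:R + y%:R) <= expR (2 * t) * (x%:R + y%:R).
Proof.
move=> t0; have E1 : 1 <= expR t by rewrite -[leLHS]expR0 ler_expR.
have E2 : expR (2 * t) = expR t * expR t by rewrite -expRD; congr expR; ring.
have E3 : expR t <= expR t * expR t by rewrite ler_peMr ?expR_ge0.
have one : expR t - 1 - t <= expR (2 * t).
  by rewrite E2; move: E3 t0; lra.
case: x; case: y => /=.
- rewrite (_ : 1%:R + 1%:R = 2 :> R) // (mulrC t) E2.
  by move: (sqr_ge0 (expR t)) t0; rewrite expr2; lra.
- by rewrite addr0 !mulr1.
- by rewrite add0r !mulr1.
- by rewrite addr0 !mulr0 expR0 !subr0 subrr.
Qed.

Section GraphEvents.
Variables (R : realType) (n : nat) (P : 'I_n -> 'I_n -> R) (b L : R).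
Hypothesis (P01 : forall i j, 0 <= P i j <= 1) (P_sym : forall i j, P i j = P j i).
Hypothesis (n_gt0 : (0 < n)%N) (expL : expR L = n%:R) (L_gt0 : 0 < L).
Hypothesis (b_gt0 : 0 < b) (P_le : forall i j, P i j <= b * L / n%:R).

Lemma sum_row_le (h : 'I_n -> R) (D : pred 'I_n) i : (forall j, 0 <= h j) ->
  \sum_(j | D j) P i j * h j <= b * L / n%:R * \sum_j h j.
Proof.
move=> h0; rewrite mulr_sumr big_mkcond; apply: ler_sum => j _.
have [p0 _] := andP (P01 i j); case: ifP => _.
  by rewrite ler_wpM2r.
by rewrite mulr_ge0 // (le_trans _ (P_le i i)) //; case/andP: (P01 i i).
Qed.

Lemma size_neq0 : n%:R != 0 :> R. Proof. by rewrite pnatr_eq0 -lt0n. Qed.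

(** The exponential moment with parameter [1] gives [expR (- 2 L)] for one
    vertex, and there are [n = expR L] vertices. *)
Lemma degree_tail : graph_Pr P (fun A => exists i,
    (2 + b * (expR 1 - 1)) * L <= \sum_j (A i j)%:R) <= expR (- L).
Proof.
apply: le_trans (graph_PrU_fin P01 _) _.
have e1 : 0 <= expR 1 - 1 :> R by rewrite subr_ge0 -[leLHS]expR0 ler_expR.
apply: le_trans (_ : \sum_(i < n) expR (- (2 * L)) <= _); last first.
  rewrite sumr_const card_ord -[_ *+ n]mulr_natl -expL -expRD ler_expR; lra.
apply: ler_sum => i _.
have := @row_tail R n P P01 P_sym i (fun=> True) (fun _ _ => 1) (b * L * (expR 1 - 1))
  ((2 + b * (expR 1 - 1)) * L).
have -> : b * L * (expR 1 - 1) - (2 + b * (expR 1 - 1)) * L = - (2 * L) by ring.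
move=> /(_ _)/(le_trans _); apply; last first.
  move=> _ _; apply: le_trans (sum_row_le _ _ _) _ => //.
  by rewrite sumr_const card_ord -[X in _ * X]mulr_natl mulrA mulfVK ?size_neq0.
apply: (ler_graph_Pr P01) => A _ h; split=> //.
by under eq_bigr do rewrite mulr1.
Qed.

Lemma sum_split_lt (g : 'I_n -> 'I_n -> R) :
  \sum_i \sum_j g i j =
  \sum_(i < n) \sum_(j < n | (i < j)%N) (g i j + g j i) + \sum_i g i i.
Proof.
have E i : \sum_j g i j =
    \sum_(j < n | (i < j)%N) g i j + (\sum_(j < n | (j < i)%N) g i j + g i i).
  rewrite (bigID (fun j : 'I_n => (i < j)%N)) /=; congr (_ + _).
  rewrite (bigD1 i) ?ltnn //= addrC; congr (_ + _).
  by apply: eq_bigl => j; rewrite -val_eqE /=; case: ltngtP.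
under eq_bigr do rewrite E.
rewrite !big_split /= addrA; congr (_ + _).
rewrite [X in _ + X](exchange_big_dep predT) //= -big_split.
by apply: eq_bigr => i _; rewrite -big_split.
Qed.

Section Pair.
Variables (S T : {set 'I_n}).

(** How often the edge [{i, j}] is counted in the rectangle [S * T]. *)
Definition pair_coef (i j : 'I_n) : R :=
  ((i \in S) && (j \in T))%:R + ((j \in S) && (i \in T))%:R.

Lemma pair_sum (g : 'I_n -> 'I_n -> R) : (forall i j, g i j = g j i) ->
  \sum_(i in S) \sum_(j in T) g i j =
  \sum_(i < n) \sum_(j < n | (i < j)%N) pair_coef i j * g i j +
  \sum_(i in S :&: T) g i i.
Proof.
move=> sg; have -> : \sum_(i in S) \sum_(j in T) g i j =
    \sum_i \sum_j ((i \in S) && (j \in T))%:R * g i j.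
  rewrite big_mkcond; apply: eq_bigr => i _; case: ifP => iS; last first.
    by rewrite big1 // => j _; rewrite mul0r.
  rewrite big_mkcond; apply: eq_bigr => j _.
  by case: ifP => _; rewrite ?mul1r ?mul0r.
rewrite sum_split_lt; congr (_ + _).
  apply: eq_bigr => i _; apply: eq_bigr => j _.
  by rewrite (sg j i) -mulrDl.
rewrite [RHS]big_mkcond; apply: eq_bigr => i _; rewrite inE.
by case: ifP => _; rewrite ?mul1r ?mul0r.
Qed.

Lemma pair_coef_ge0 i j : 0 <= pair_coef i j.
Proof. exact: addr_ge0. Qed.

Lemma pair_coef_le2 i j : pair_coef i j <= 2.
Proof.
by rewrite /pair_coef -[2]/(1 + 1); apply: lerD; rewrite lern1 leq_b1.
Qed.

Lemma pair_coef_sqr i j : pair_coef i j ^+ 2 <= 2 * pair_coef i j.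
Proof.
by have := pair_coef_ge0 i j; have := pair_coef_le2 i j; nra.
Qed.

Lemma pair_mass : \sum_(i < n) \sum_(j < n | (i < j)%N) P i j * pair_coef i j <=
  b * L / n%:R * (#|S|%:R * #|T|%:R).
Proof.
have bL : 0 <= b * L / n%:R by rewrite divr_ge0 // mulr_ge0 // ltW.
have := @pair_sum (fun _ _ => 1) (fun _ _ => erefl).
under eq_bigr do rewrite sumr_const.
rewrite sumr_const -[_ *+ #|T| *+ _]mulr_natl mulrC => h.
rewrite h mulrDr ler_wpDr //; first by rewrite mulr_ge0 // sumr_ge0.
rewrite mulr_sumr; apply: ler_sum => i _; rewrite mulr_sumr; apply: ler_sum => j _.
by rewrite mulr1 ler_wpM2r // pair_coef_ge0.
Qed.

Let q : R := (#|S| + #|T|)%:R.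

Lemma pair_mass_n : \sum_(i < n) \sum_(j < n | (i < j)%N) P i j * pair_coef i j <=
  b * L * q.
Proof.
apply: le_trans pair_mass _; rewrite -!mulrA ler_wpM2l ?(ltW b_gt0) //.
rewrite ler_wpM2l ?(ltW L_gt0) // ler_pdivrMl ?ltr0n // -!natrM ler_nat /=.
have h : (#|S| <= n)%N by rewrite -[X in (_ <= X)%N]card_ord max_card.
by rewrite mulnDr (leq_trans (leq_mul h (leqnn _))) // leq_addl.
Qed.

Lemma deviation_sum (A : 'M[bool]_n) : simple_graph A ->
  \sum_(i in S) \sum_(j in T) deviation P A i j =
  \sum_(i < n) \sum_(j < n | (i < j)%N) pair_coef i j * (A i j)%:R -
  \sum_(i < n) \sum_(j < n | (i < j)%N) P i j * pair_coef i j -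
  \sum_(i in S :&: T) P i i.
Proof.
move=> /simple_graphP[sA zA]; rewrite pair_sum => [|i j]; last first.
  by rewrite !mxE sA P_sym.
rewrite -sumrB -[X in _ = _ - X]addr0; congr (_ + _); last first.
  by rewrite addr0 -sumrN; apply: eq_bigr => i _; rewrite mxE zA sub0r.
apply: eq_bigr => i _; rewrite -sumrB; apply: eq_bigr => j _; rewrite mxE; ring.
Qed.

Lemma pair_diag : 0 <= \sum_(i in S :&: T) P i i <= b * L / n%:R * q.
Proof.
have bL : 0 <= b * L / n%:R by rewrite divr_ge0 // mulr_ge0 // ltW.
rewrite sumr_ge0 => [|i _]; last by case/andP: (P01 i i).
apply: le_trans (_ : \sum_(i in S :&: T) b * L / n%:R <= _).
  by apply: ler_sum.
rewrite sumr_const -[_ *+ _]mulr_natr ler_wpM2l // ler_nat.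
by rewrite (leq_trans (subset_leq_card (subsetIl S T))) // leq_addr.
Qed.

Variable eps : R.
Hypothesis eps_gt0 : 0 < eps.

Lemma pair_scale t (g : 'I_n -> 'I_n -> R) :
  \sum_(i < n) \sum_(j < n | (i < j)%N) t * pair_coef i j * g i j =
  t * \sum_(i < n) \sum_(j < n | (i < j)%N) pair_coef i j * g i j.
Proof.
rewrite mulr_sumr; apply: eq_bigr => i _.
by rewrite mulr_sumr; apply: eq_bigr => j _; rewrite mulrA.
Qed.

Lemma pair_center t :
  \sum_(i < n) \sum_(j < n | (i < j)%N)
    P i j * (expR (t * pair_coef i j) - 1 - t * pair_coef i j) =
  \sum_(i < n) \sum_(j < n | (i < j)%N) P i j * (expR (t * pair_coef i j) - 1) -
  t * \sum_(i < n) \sum_(j < n | (i < j)%N) P i j * pair_coef i j.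
Proof.
rewrite mulr_sumr -sumrB; apply: eq_bigr => i _.
rewrite mulr_sumr -sumrB; apply: eq_bigr => j _; ring.
Qed.

Lemma pair_upper_tail (t : R) : 0 < t ->
  graph_Pr P (fun A => eps * L * q < \sum_(i in S) \sum_(j in T) deviation P A i j) <=
  expR (\sum_(i < n) \sum_(j < n | (i < j)%N)
          P i j * (expR (t * pair_coef i j) - 1 - t * pair_coef i j) - t * (eps * L * q)).
Proof.
move=> t0; have := graph_tail P01 (fun i j => t * pair_coef i j)
  (t * (eps * L * q + \sum_(i < n) \sum_(j < n | (i < j)%N) P i j * pair_coef i j)).
set e1 := expR _; set e2 := expR _.
have -> : e1 = e2.
  by rewrite /e1 /e2 pair_center; congr expR; ring.
apply: le_trans; apply: (ler_graph_Pr P01) => A sA; rewrite deviation_sum // => h.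
rewrite pair_scale ler_wpM2l ?(ltW t0) //.
by have /andP[h0 _] := pair_diag; move: h h0; lra.
Qed.

Lemma pair_lower_tail (t : R) : 0 < t ->
  graph_Pr P (fun A => \sum_(i in S) \sum_(j in T) deviation P A i j < - (eps * L * q)) <=
  expR (\sum_(i < n) \sum_(j < n | (i < j)%N)
          P i j * (expR (- t * pair_coef i j) - 1 - - t * pair_coef i j) -
        t * (eps * L * q - b * L / n%:R * q)).
Proof.
move=> t0; have := graph_tail P01 (fun i j => - t * pair_coef i j)
  (t * (eps * L * q - b * L / n%:R * q -
     \sum_(i < n) \sum_(j < n | (i < j)%N) P i j * pair_coef i j)).
set e1 := expR _; set e2 := expR _.
have -> : e1 = e2.
  by rewrite /e1 /e2 pair_center; congr expR; ring.
apply: le_trans; apply: (ler_graph_Pr P01) => A sA; rewrite deviation_sum // => h.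
rewrite pair_scale mulNr -mulrN ler_wpM2l ?(ltW t0) //.
by have /andP[_ h0] := pair_diag; move: h h0; lra.
Qed.

Variables (c0 t1 t2 : R).
Hypothesis (t1_gt0 : 0 < t1) (t2_gt0 : 0 < t2).
Hypothesis (t1_eps : 4 <= t1 * eps) (c0_t1 : b * c0 * expR (2 * t1) <= 1).
Hypothesis (c0_eps : b * c0 <= eps).
Hypothesis (t2_small : t2 <= 4^-1) (t2_eps : 8 * b * t2 <= eps).
Hypothesis (n_large : 4 * b <= eps * n%:R) (L_large : 12 <= t2 * eps * c0 * L).

(** For a small parameter the centred exponential moment is quadratic. *)
Lemma quad_mass (t : R) : `|t| <= 4^-1 ->
  \sum_(i < n) \sum_(j < n | (i < j)%N)
    P i j * (expR (t * pair_coef i j) - 1 - t * pair_coef i j) <=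
  4 * t ^+ 2 * (b * L * q).
Proof.
move=> tt; apply: le_trans (_ : 4 * t ^+ 2 *
  (\sum_(i < n) \sum_(j < n | (i < j)%N) P i j * pair_coef i j) <= _); last first.
  by rewrite ler_wpM2l ?pair_mass_n // mulr_ge0 // sqr_ge0.
rewrite mulr_sumr; apply: ler_sum => i _; rewrite mulr_sumr; apply: ler_sum => j _.
rewrite mulrCA ler_wpM2l //; first by case/andP: (P01 i j).
have c2 := pair_coef_le2 i j; have c1 := pair_coef_ge0 i j.
apply: le_trans (expR_le_quad _) _.
  move: tt; rewrite ler_norml => /andP[_ tt]; nra.
rewrite exprMn; have := pair_coef_sqr i j; have := sqr_ge0 t; nra.
Qed.

(** If [q <= c0 n], then the expected number of edges is at most [b c0 L q], so
    small that the lower deviation is impossible and the upper one is excluded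
    with a large exponential parameter [t1].  For larger sets a small parameter
    [t2] suffices, since the allowed deviation is then at least a constant
    times [n L], which beats the number [4 ^ n] of pairs of sets. *)
Lemma pair_tail :
  graph_Pr P (fun A => eps * L * q < `|\sum_(i in S) \sum_(j in T) deviation P A i j|) <=
  expR (- L) * expR (- (2 * L * q)) + 2 * expR (- (3 * n%:R)).
Proof.
have n0 : 0 < n%:R :> R by rewrite ltr0n.
have q0 : 0 <= q by rewrite /q.
have e3 : 0 <= 2 * expR (- (3 * n%:R)) :> R by rewrite mulr_ge0 ?expR_ge0.
have e2 : 0 <= expR (- L) * expR (- (2 * L * q)) by rewrite mulr_ge0 ?expR_ge0.
have eL : 0 < eps * L by rewrite mulr_gt0.
case: (posnP (#|S| + #|T|)%N) => [st0|st_gt0].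
  rewrite (_ : graph_Pr _ _ = 0) ?addr_ge0 //.
  apply/eqP; rewrite eq_le graph_Pr_ge0 // andbT.
  rewrite [leRHS](_ : 0 = graph_Pr P (fun=> False)); last first.
    by rewrite /graph_Pr big1 // => A /andP[_ /asboolP].
  apply: (ler_graph_Pr P01) => A _; move/eqP: st0; rewrite addn_eq0.
  move=> /andP[/eqP/card0_eq S0 _]; rewrite big_pred0 // normr0.
  by rewrite ltNge mulr_ge0 // ltW.
have q1 : 1 <= q by rewrite /q ler1n.
apply: le_trans (_ : graph_Pr P (fun A =>
    eps * L * q < \sum_(i in S) \sum_(j in T) deviation P A i j \/
    \sum_(i in S) \sum_(j in T) deviation P A i j < - (eps * L * q)) <= _).
  by apply: (ler_graph_Pr P01) => A _; rewrite ltr_normr ltrNr => /orP[]; [left|right].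
apply: le_trans (graph_PrU P01 _ _) _.
have Lq : 0 <= L * q by rewrite mulr_ge0 // ltW.
have [small|large] := lerP q (c0 * n%:R).
  have st : b * L / n%:R * (#|S|%:R * #|T|%:R) <= b * c0 * (L * q).
    rewrite mulrAC ler_pdivrMr // -!mulrA ler_wpM2l ?(ltW b_gt0) //.
    rewrite [leRHS]mulrCA ler_wpM2l ?(ltW L_gt0) // -natrM.
    apply: le_trans (_ : q * q <= _); last by rewrite [leRHS]mulrCA ler_wpM2l.
    by rewrite -natrM ler_nat leq_mul ?leq_addr ?leq_addl.
  rewrite [X in _ + X <= _](_ : _ = 0) ?addr0.
    rewrite -[leLHS]addr0 lerD //; apply: le_trans (pair_upper_tail t1_gt0) _.
    rewrite -expRD ler_expR.
    have : \sum_(i < n) \sum_(j < n | (i < j)%N)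
        P i j * (expR (t1 * pair_coef i j) - 1 - t1 * pair_coef i j) <= L * q.
      apply: le_trans (_ : expR (2 * t1) *
        (\sum_(i < n) \sum_(j < n | (i < j)%N) P i j * pair_coef i j) <= _).
        rewrite mulr_sumr; apply: ler_sum => i _.
        rewrite mulr_sumr; apply: ler_sum => j _.
        rewrite mulrCA ler_wpM2l //; first by case/andP: (P01 i j).
        exact: exp_pair_le (ltW t1_gt0).
      apply: le_trans (ler_wpM2l (expR_ge0 _) (le_trans pair_mass st)) _.
      by rewrite [leLHS]mulrA ler_piMl // mulrC.
    move=> h; have := ler_wpM2r Lq t1_eps.
    have : L <= L * q by rewrite ler_peMr // ltW.
    by move: h; lra.
  apply/eqP; rewrite eq_le graph_Pr_ge0 // andbT.
  rewrite [leRHS](_ : 0 = graph_Pr P (fun=> False)); last first.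
    by rewrite /graph_Pr big1 // => A /andP[_ /asboolP].
  apply: (ler_graph_Pr P01) => A sA; apply/negP; rewrite -leNgt.
  rewrite lerNl; apply: le_trans (_ : \sum_(i in S) \sum_(j in T) P i j <= _).
    rewrite -sumrN; apply: ler_sum => i _; rewrite -sumrN; apply: ler_sum => j _.
    by rewrite mxE opprB gerBl.
  apply: le_trans (_ : b * L / n%:R * (#|S|%:R * #|T|%:R) <= _).
    apply: le_trans (_ : \sum_(i in S) \sum_(j in T) b * L / n%:R <= _).
      by apply: ler_sum => i _; apply: ler_sum.
    under eq_bigr do rewrite sumr_const.
    by rewrite sumr_const -mulrnA -[leLHS]mulr_natr natrM (mulrC #|S|%:R).
  by apply: le_trans st _; rewrite -[leRHS]mulrA ler_wpM2r.
have nq : 12 * n%:R <= t2 * eps * (L * q).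
  have h1 : 12 * n%:R <= t2 * eps * c0 * L * n%:R by rewrite ler_wpM2r.
  apply: le_trans h1 _.
  have -> : t2 * eps * c0 * L * n%:R = t2 * eps * L * (c0 * n%:R) by ring.
  by rewrite [leRHS]mulrA ler_wpM2l ?(ltW large) // !mulr_ge0 // ltW.
have quad : 4 * t2 ^+ 2 * (b * L * q) <= 2^-1 * (t2 * eps * (L * q)).
  have -> : 4 * t2 ^+ 2 * (b * L * q) = 2^-1 * (t2 * (8 * b * t2) * (L * q)) by field.
  by rewrite ler_wpM2l // ler_wpM2r // ler_wpM2l // ltW.
have t2n : `|t2| <= 4^-1 by rewrite gtr0_norm.
rewrite -[leLHS]add0r lerD // mulr2n mulrDl mul1r; apply: lerD.
  apply: le_trans (pair_upper_tail t2_gt0) _; rewrite ler_expR.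
  by have := quad_mass t2n; move: quad nq; lra.
apply: le_trans (pair_lower_tail t2_gt0) _; rewrite ler_expR.
have t2n' : `|- t2| <= 4^-1 by rewrite normrN.
have := quad_mass t2n'; rewrite sqrrN => h.
have : t2 * (b * L / n%:R * q) <= 4^-1 * (t2 * eps * (L * q)).
  have -> : t2 * (b * L / n%:R * q) = t2 * (b / n%:R) * (L * q) by ring.
  rewrite [leRHS]mulrA ler_wpM2r // [leRHS]mulrCA ler_wpM2l ?(ltW t2_gt0) //.
  rewrite ler_pdivrMr //.
  by move: n_large; lra.
by move: quad nq h; lra.
Qed.

End Pair.

(** Union bound over all pairs of sets.  The first term of [pair_tail] sums to
    [(1 + expR (- 2 L)) ^ (2 n) <= expR 2], up to the factor [expR (- L)]. *)
Lemma discrepancy_tail (eps c0 t1 t2 : R) :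
  0 < eps -> 0 < t1 -> 0 < t2 -> 4 <= t1 * eps ->
  b * c0 * expR (2 * t1) <= 1 -> b * c0 <= eps -> t2 <= 4^-1 -> 8 * b * t2 <= eps ->
  4 * b <= eps * n%:R -> 12 <= t2 * eps * c0 * L ->
  graph_Pr P (fun A => ~ low_discrepancy P (eps * L) A) <=
  (expR 2 + 2) * expR (- L).
Proof.
move=> eps0 t10 t20 h1 h2 h3 h4 h5 h6 h7.
apply: le_trans (_ : graph_Pr P (fun A => exists ST : {set 'I_n} * {set 'I_n},
   eps * L * (#|ST.1| + #|ST.2|)%:R <
   `|\sum_(i in ST.1) \sum_(j in ST.2) deviation P A i j|) <= _).
  apply: (ler_graph_Pr P01) => A _ /existsNP[S /existsNP[T /negP]].
  by rewrite -ltNge => h; exists (S, T).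
apply: le_trans (graph_PrU_fin P01 _) _.
apply: le_trans (_ : \sum_(ST : {set 'I_n} * {set 'I_n})
  (expR (- L) * expR (- (2 * L * (#|ST.1| + #|ST.2|)%:R)) + 2 * expR (- (3 * n%:R))) <= _).
  apply: ler_sum => -[S T] _.
  exact: (pair_tail S T eps0 t10 t20 h1 h2 h3 h4 h5 h6 h7).
rewrite big_split /= [leRHS]mulrDl; apply: lerD.
  rewrite -mulr_sumr mulrC ler_wpM2r ?expR_ge0 //.
  pose x : R := expR (- (2 * L)).
  have gen : \sum_(S : {set 'I_n}) x ^+ #|S| = (1 + x) ^+ n.
    have -> : (1 + x) ^+ n = \prod_(i < n) (x + 1) by rewrite prodr_const card_ord addrC.
    rewrite bigA_distr; apply: eq_bigr => S _.
    by rewrite big_if /= prodr_const big1 ?mulr1 //; congr (_ ^+ _); apply: eq_card => i; rewrite inE.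
  have le1 : (1 + x) ^+ n <= expR 1.
    apply: le_trans (_ : expR x ^+ n <= _).
      by rewrite lerXn2r ?nnegrE ?expR_ge0 ?addr_ge0 // ?expR_ge0 // expR_ge1Dx.
    rewrite -expRM_natl ler_expR -expL /x -expRD -[leRHS]expR0 ler_expR; move: L_gt0; lra.
  have -> : \sum_(ST : {set 'I_n} * {set 'I_n}) expR (- (2 * L * (#|ST.1| + #|ST.2|)%:R)) =
      (\sum_(S : {set 'I_n}) x ^+ #|S|) * (\sum_(T : {set 'I_n}) x ^+ #|T|).
    rewrite mulr_suml (eq_bigr (fun S : {set 'I_n} =>
      \sum_(T : {set 'I_n}) x ^+ #|S| * x ^+ #|T|)) => [|S _]; last by rewrite mulr_sumr.
    rewrite pair_bigA; apply: eq_bigr => -[S T] _ /=.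
    by rewrite -exprD -expRM_natl; congr expR; ring.
  rewrite gen (_ : 2 = 1 + 1 :> R) // expRD ler_pM //;
    by rewrite exprn_ge0 // addr_ge0 ?expR_ge0.
have cs : #|{: {set 'I_n}}| = (2 ^ n)%N.
  by rewrite -cardsT -powersetT card_powerset cardsT card_ord.
rewrite sumr_const card_prod !cs -[leLHS]mulr_natl mulrCA ler_wpM2l //.
rewrite -expnD natrX addnn -muln2 mulnC exprM -natrX.
have e4 : ((2 ^ 2)%N)%:R <= expR 2 :> R.
  rewrite (_ : 2 = 1 + 1 :> R) // expRD natrX expr2 ler_pM //;
  by have := expR_ge1Dx (1 : R).
apply: le_trans (_ : expR 2 ^+ n * expR (- (3 * n%:R)) <= _).
  by rewrite ler_wpM2r ?expR_ge0 // lerXn2r ?nnegrE ?expR_ge0.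
rewrite -expRM_natl -expRD ler_expR.
have : L <= n%:R by rewrite -expL (le_trans _ (expR_ge1Dx L)) // lerDr.
by move: (ler0n R n); lra.
Qed.

End GraphEvents.

(** * Votes and reference vectors of the random graph *)

Section MegaCommunityEvents.
Variables (R : realType) (n d m : nat) (c : 'I_n -> d.-tuple bool).
Hypothesis c_bal : forall x : d.-tuple bool, #|[set v | c v == x]%SET| = m.
Hypothesis m_gt0 : (0 < m)%N.
Variables (w : seq bool) (r : nat).
Hypothesis (rE : (size w + r.+1)%N = d).
Variable p : nat -> R.

Let S := mega_community c w.
Let N := #|S|.
Let P i j : R := p (tree_dist (c i) (c j)).
Let l1 := ref_l1 m r p.
Let l2 := ref_l2 m r p.
Let f2 : 'rV[R]_N := ref_side R c w.
Let tau : R := ref_scale R c w.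

Hypothesis P01 : forall i j, 0 <= P i j <= 1.

Lemma tree_prob_sym i j : P i j = P j i. Proof. by rewrite /P tree_distC. Qed.

(** Chernoff bound for the difference between the numbers of neighbours on the
    two sides; [(l1 + l2) / 2] and [(l1 - l2) / 2] are the total probabilities
    of each side, and the summand [1] pays for the absent loop at [v]. *)
Lemma margin_tail v (t s : R) : v \in S ->
  graph_Pr P (fun A => t * (side R c w v * \sum_(j in S) (A v j)%:R * side R c w j) <= s) <=
  expR ((l1 + l2) / 2 * (expR (- t) - 1) + (l1 - l2) / 2 * (expR t - 1) + 1 + s).
Proof.
move=> vS; pose h j : R := if j \in S then - t * (side R c w v * side R c w j) else 0.
have hv : h v = - t by rewrite /h vS side_sqr mulr1.
have tot : \sum_j P v j * (expR (h j) - 1) =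
    (l1 + l2) / 2 * (expR (- t) - 1) + (l1 - l2) / 2 * (expR t - 1).
  pose u : R := (expR (- t) + expR t) / 2 - 1.
  pose z : R := (expR (- t) - expR t) / 2.
  transitivity (\sum_(j in S) (u * P v j + z * side R c w v * (side R c w j * P v j))).
    rewrite [RHS]big_mkcond; apply: eq_bigr => j _; rewrite /h; case: ifP => jS; last first.
      by rewrite expR0 subrr mulr0.
    rewrite [RHS](_ : _ = P v j * (u + z * (side R c w v * side R c w j))); last by ring.
    congr (_ * _); rewrite (side_mul R rE vS jS) /u /z.
    by case: ifP => _; rewrite ?mulr1 ?mulrN1 ?opprK; field.
  rewrite big_split /= -!mulr_sumr (sum_mega c_bal rE p vS) (sum_mega_side c_bal rE p vS).
  rewrite -/(ref_l1 m r p) -/(ref_l2 m r p) -/l1 -/l2.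
  have := side_sqr R c w v; set sv := side R c w v => sv2.
  rewrite [_ * (sv * l2)](_ : _ = z * (sv * sv) * l2); last by ring.
  by rewrite sv2 /u /z; field.
have := @row_tail R n P P01 tree_prob_sym v (fun=> True) (fun=> h)
  ((l1 + l2) / 2 * (expR (- t) - 1) + (l1 - l2) / 2 * (expR t - 1) + 1) (- s).
rewrite opprK; move=> /(_ _)/(le_trans _); apply; last first.
  move=> _ _; rewrite -tot [X in _ <= X + 1](bigD1 v) //= hv.
  have [p0 p1] := andP (P01 v v); have e0 := expR_ge0 (- t).
  have : 0 <= P v v * expR (- t) by rewrite mulr_ge0.
  by move: p1; lra.
apply: (ler_graph_Pr P01) => A _ hA; split=> //.
rewrite lerNl -sumrN (_ : \sum_j _ = t * (side R c w v * \sum_(j in S) (A v j)%:R * side R c w j)) //.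
rewrite !mulr_sumr [RHS]big_mkcond; apply: eq_bigr => j _; rewrite /h.
by case: ifP => _; [ring | rewrite mulr0 oppr0].
Qed.

Variables (b L delta kappa eta : R).
Hypothesis (n_gt0 : (0 < n)%N) (L_gt0 : 0 < L) (b_gt0 : 0 < b).
Hypothesis (P_le : forall i j, P i j <= b * L / n%:R).

Lemma sum_abs_le (z : 'rV[R]_N) : tau * \sum_a `|z 0 a| <= nrm z.
Proof.
pose y : 'rV[R]_N := \row_a `|z 0 a|.
have ny : nrm y = nrm z.
  by rewrite /nrm; congr Num.sqrt; apply: eq_bigr => a _; rewrite !mxE -!expr2 real_normK ?num_real.
have := dot_CS (ref_const R c w) y.
rewrite (_ : nrm (ref_const R c w) = 1) ?mul1r ?ny; last first.
  by rewrite /nrm (dot_ref_const R c_bal m_gt0 rE) sqrtr1.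
apply: le_trans; apply: le_trans (ler_norm _).
by rewrite mulr_sumr ler_sum // => a _; rewrite !mxE.
Qed.

(** The reference vector of the graph with [v] isolated does not depend on row
    [v], and its error is small in mean square; the exponential moment of its
    weighted sum over the neighbours of [v] is taken after division by its
    largest entry. *)
Lemma refs_tail (a : 'I_N) (t : R) : 0 < t -> 0 <= 4 * kappa / delta ->
  graph_Pr P (fun A => ~ (
    let x := reference m c w r p delta kappa (isolate (enum_val a) A) in
    is_reference m r p delta kappa (induced_adjacency R (isolate (enum_val a) A) S) x ->
    forall Y, tau <= Y -> (forall k, `|x 0 k - f2 0 k| <= Y) ->
    \sum_k (A (enum_val a) (enum_val k))%:R * `|x 0 k - f2 0 k| <= eta * Y)) <=
  expR (b * L * (4 * kappa / delta) * (t * expR t) - t * eta).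
Proof.
move=> t0 e0; have tau0 : 0 < tau := ref_scale_gt0 R c_bal m_gt0 rE.
pose ref B := reference m c w r p delta kappa B.
pose F B := is_reference m r p delta kappa (induced_adjacency R B S) (ref B).
pose g B k : R := `|ref B 0 k - f2 0 k|.
pose Y0 B : R := \big[Num.max/tau]_k g B k.
have Y0tau B : tau <= Y0 B by exact: bigmax_ge_id.
have Y0pos B : 0 < Y0 B := lt_le_trans tau0 (Y0tau B).
have gY0 B k : g B k <= Y0 B by exact: le_bigmax.
have g0 B k : 0 <= g B k by exact: normr_ge0.
pose h B (j : 'I_n) : R := \sum_k (enum_val k == j)%:R * (t * g B k / Y0 B).
have h_enum (G : 'I_n -> R) B : \sum_j G j * h B j =
    t / Y0 B * \sum_k G (enum_val k) * g B k.
  rewrite /h; under eq_bigr do rewrite mulr_sumr.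
  rewrite exchange_big mulr_sumr; apply: eq_bigr => k _ /=.
  rewrite (bigD1 (enum_val k)) //= eqxx mul1r big1 ?addr0 => [|j]; first by ring.
  by rewrite eq_sym => /negbTE->; rewrite mul0r mulr0.
have h_ge0 B j : 0 <= h B j.
  by apply: sumr_ge0 => k _; rewrite !mulr_ge0 ?invr_ge0 // ltW.
have h_le B j : h B j <= t.
  case: (boolP (j \in S)) => jS; last first.
    rewrite /h big1 ?ltW // => k _; case: eqP => [kj|]; rewrite ?mul0r //.
    by rewrite -kj enum_valP in jS.
  rewrite /h (bigD1 (enum_rank_in jS j)) //= enum_rankK_in // eqxx mul1r.
  rewrite big1 ?addr0 => [|k /eqP kj]; last first.
    case: eqP => [e|]; rewrite ?mul0r //; case: kj.
    by apply: enum_val_inj; rewrite enum_rankK_in.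
  rewrite ler_pdivrMr // ler_wpM2l ?(ltW t0) //.
have hF B : F B -> \sum_(j | j != enum_val a) P (enum_val a) j * (expR (h B j) - 1) <=
    b * L * (4 * kappa / delta) * (t * expR t).
  move=> [mu [_ _ _ hnear]].
  have ineq (y : R) : expR y - 1 <= y * expR y.
    have := ler_wpM2r (expR_ge0 y) (expR_ge1Dx (- y)).
    by rewrite [leRHS]mulrC expRxMexpNx_1; lra.
  have bLn : 0 <= b * L / n%:R by rewrite divr_ge0 // mulr_ge0 // ltW.
  apply: le_trans (_ : \sum_j b * L / n%:R * (h B j * expR t) <= _).
    rewrite big_mkcond; apply: ler_sum => j _; case: ifP => _; last first.
      by rewrite mulr_ge0 // mulr_ge0 ?expR_ge0.
    have [p0 _] := andP (P01 (enum_val a) j).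
    have e1 : 0 <= expR (h B j) - 1 by rewrite subr_ge0 -[leLHS]expR0 ler_expR.
    apply: ler_pM => //; apply: le_trans (ineq _) _.
    by rewrite ler_wpM2l // ler_expR.
  rewrite -mulr_sumr -mulr_suml.
  have -> : \sum_j h B j = t / Y0 B * \sum_k g B k.
    transitivity (\sum_j 1 * h B j); first by under [RHS]eq_bigr do rewrite mul1r.
    by rewrite (h_enum (fun=> 1)); under eq_bigr do rewrite mul1r.
  have mass : \sum_k g B k <= tau * n%:R * (4 * kappa / delta).
    have h1 : tau * \sum_k g B k <= 4 * kappa / delta.
      apply: le_trans hnear; have := sum_abs_le (ref B - ref_side R c w).
      rewrite (eq_bigr (g B)) // => k _.
      by rewrite [X in `|X|]mxE [X in `|_ + X|]mxE.
    have tN : tau ^+ 2 * n%:R >= 1.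
      rewrite -[leLHS](ref_scale_sqr R c_bal m_gt0 rE) [leLHS]mulrC ler_wpM2l ?sqr_ge0 // ler_nat.
      by rewrite -[X in (_ <= X)%N]card_ord max_card.
    rewrite -(ler_pM2l tau0); apply: le_trans h1 _.
    rewrite (_ : tau * (tau * n%:R * _) = tau ^+ 2 * n%:R * (4 * kappa / delta)); last by ring.
    by rewrite ler_peMl.
  have tY : t / Y0 B * \sum_k g B k <= t * n%:R * (4 * kappa / delta).
    rewrite mulrAC ler_pdivrMr // -!mulrA ler_wpM2l ?(ltW t0) //.
    have -> : n%:R * (4 * (kappa * (delta^-1 * Y0 B))) =
        Y0 B * (n%:R * (4 * kappa / delta)) by ring.
    by apply: le_trans mass _; rewrite -[leLHS]mulrA ler_wpM2r // mulr_ge0.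
  rewrite (_ : b * L * (4 * kappa / delta) * (t * expR t) =
    b * L / n%:R * (t * n%:R * (4 * kappa / delta) * expR t)); last first.
    by move: (4 * kappa / delta) => e; field; rewrite pnatr_eq0 -lt0n.
  by rewrite ler_wpM2l // ler_wpM2r ?expR_ge0.
apply: le_trans (row_tail P01 tree_prob_sym (t * eta) hF).
apply: (ler_graph_Pr P01) => A _ /not_implyP[refA].
move=> /existsNP[Y /not_implyP[tY /not_implyP[gY /negP]]]; rewrite -ltNge => big.
split; first exact: refA.
rewrite h_enum mulrAC ler_pdivlMr // -mulrA ler_wpM2l ?(ltW t0) //.
have etaY : eta * Y0 (isolate (enum_val a) A) <= \sum_k (A (enum_val a) (enum_val k))%:R * g (isolate (enum_val a) A) k.
  case: (lerP 0 eta) => eta0.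
    apply: le_trans (ltW big); rewrite ler_wpM2l //.
    by apply/bigmax_leP; split=> // k _; exact: gY.
  apply: le_trans (_ : 0 <= _); first by rewrite nmulr_rle0 // ltW.
  by apply: sumr_ge0 => k _; rewrite mulr_ge0.
exact: etaY.
Qed.

End MegaCommunityEvents.

(** * Probability of an incorrect split *)

Lemma ball_sumZ (R : realType) (s : R) (a : nat -> R) r :
  ball_sum (fun k => s * a k) r = s * ball_sum a r.
Proof.
rewrite /ball_sum mulrDr mulr_sumr; congr (_ + _).
by apply: eq_bigr => t _; rewrite mulrCA.
Qed.

Lemma abar_ball_sum (R : realType) (a : nat -> R) r :
  abar a r.+1 = ball_sum a r / 2 ^+ r.
Proof. by rewrite /abar /ball_sum subn1. Qed.

Lemma abs_ball_sum_diff (R : realType) (a : nat -> R) r :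
  (forall k, (k <= r)%N -> a k.+1 < a k) \/ (forall k, (k <= r)%N -> a k < a k.+1) ->
  `|ball_sum a r - 2 ^+ r * a r.+1| = \sum_(k < r.+1) `|a k - a k.+1| * 2 ^+ k.
Proof.
rewrite ball_sum_abel => -[h|h].
  rewrite ger0_norm; last first.
    by apply: sumr_ge0 => k _; rewrite mulr_ge0 ?exprn_ge0 // subr_ge0 ltW // h // -ltnS.
  by apply: eq_bigr => k _; rewrite mulrC gtr0_norm // subr_gt0 h // -ltnS.
rewrite ler0_norm; last first.
  rewrite -oppr_ge0 -sumrN; apply: sumr_ge0 => k _.
  by rewrite -mulrN mulr_ge0 ?exprn_ge0 // opprB subr_ge0 ltW // h // -ltnS.
rewrite -sumrN; apply: eq_bigr => k _.
by rewrite mulrC -mulNr ltr0_norm // subr_lt0 h // -ltnS.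
Qed.

(** For monotone [a] the second eigenvalue is the sum of all [r + 1] terms of
    [abs_ball_sum_diff], and the rest of the spectrum only sees the first
    [r]. *)
Lemma spectral_gap_constant (R : realType) (a : nat -> R) r :
  0 < ball_sum a r -> 0 < a r.+1 ->
  (forall k, (k <= r)%N -> a k.+1 < a k) \/ (forall k, (k <= r)%N -> a k < a k.+1) ->
  exists2 g : R, 0 < g &
    \sum_(k < r) `|a k - a k.+1| * 2 ^+ k + 2 * g <= `|ball_sum a r - 2 ^+ r * a r.+1| /\
    `|ball_sum a r - 2 ^+ r * a r.+1| + 2 * g <= ball_sum a r + 2 ^+ r * a r.+1.
Proof.
move=> b0 a0 mono; have e2 : 0 < 2 ^+ r * a r.+1 by rewrite mulr_gt0 ?exprn_gt0.
pose g1 : R := `|a r - a r.+1| * 2 ^+ r.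
pose g2 : R := ball_sum a r + 2 ^+ r * a r.+1 - `|ball_sum a r - 2 ^+ r * a r.+1|.
have g10 : 0 < g1.
  rewrite mulr_gt0 ?exprn_gt0 // normr_gt0 subr_eq0.
  by case: mono => /(_ _ (leqnn r)) h; [rewrite gt_eqF | rewrite lt_eqF].
have g20 : 0 < g2.
  rewrite subr_gt0 ltr_norml; apply/andP; split; move: b0 e2; lra.
exists (Num.min g1 g2 / 2); first by rewrite divr_gt0 // lt_min g10.
have E : 2 * (Num.min g1 g2 / 2) = Num.min g1 g2 by field.
rewrite E; split.
  by rewrite (abs_ball_sum_diff mono) big_ord_recr /= lerD2l ge_min lexx.
by rewrite -lerBrDl ge_min lexx orbT.
Qed.

Section SplitFailure.
Variables (R : realType) (d : nat) (a : nat -> R).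
Hypothesis a_gt0 : forall k, (k <= d)%N -> 0 < a k.
Variables (w : seq bool) (r : nat).
Hypothesis (rE : (size w + r.+1)%N = d).
Hypothesis threshold :
  Num.sqrt (2 ^+ (d - r)) < `|Num.sqrt (abar a r.+1) - Num.sqrt (a r.+1)|.

Let y : R := abar a r.+1.
Let y' : R := a r.+1.

Lemma ball_sum_gt0 : 0 < ball_sum a r.
Proof.
rewrite /ball_sum ltr_wpDr ?a_gt0 // big_nat_cond; apply: sumr_ge0 => k /andP[/andP[_ kr] _].
by rewrite mulr_ge0 ?exprn_ge0 // ltW // a_gt0 //; lia.
Qed.

Lemma abar_gt0 : 0 < y. Proof. by rewrite /y abar_ball_sum divr_gt0 ?ball_sum_gt0 ?exprn_gt0. Qed.
Lemma cross_gt0 : 0 < y'. Proof. by rewrite a_gt0 //; lia. Qed.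

Let t : R := ln (Num.sqrt y / Num.sqrt y').

Lemma sqrt_abar_gt0 : 0 < Num.sqrt y. Proof. by rewrite sqrtr_gt0 abar_gt0. Qed.
Lemma sqrt_cross_gt0 : 0 < Num.sqrt y'. Proof. by rewrite sqrtr_gt0 cross_gt0. Qed.

Lemma exp_tilt : expR t = Num.sqrt y / Num.sqrt y'.
Proof. by rewrite lnK // posrE divr_gt0 ?sqrt_abar_gt0 ?sqrt_cross_gt0. Qed.

Lemma exp_tiltN : expR (- t) = Num.sqrt y' / Num.sqrt y.
Proof. by rewrite expRN exp_tilt invf_div. Qed.

(** The tilt [t] minimises the exponent [y e^(-t) + y' e^t], and its value there
    is where the squared difference of square roots comes from. *)
Lemma tilt_exponent :
  y * (expR (- t) - 1) + y' * (expR t - 1) = - (Num.sqrt y - Num.sqrt y') ^+ 2.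
Proof.
have h : Num.sqrt y != 0 by rewrite gt_eqF ?sqrt_abar_gt0.
have h' : Num.sqrt y' != 0 by rewrite gt_eqF ?sqrt_cross_gt0.
rewrite exp_tilt exp_tiltN.
have e1 : y = Num.sqrt y ^+ 2 by rewrite sqr_sqrtr // ltW ?abar_gt0.
have e2 : y' = Num.sqrt y' ^+ 2 by rewrite sqr_sqrtr // ltW ?cross_gt0.
rewrite {1}e1 {2}e2; move: (Num.sqrt y) (Num.sqrt y') h h' => s s' h h'.
by field; rewrite h h'.
Qed.

Lemma tilt_sign : Num.sg (y - y') = Num.sg t /\ t != 0.
Proof.
have dif : Num.sqrt y != Num.sqrt y'.
  apply: contraTneq threshold => e; rewrite -/y -/y' e subrr normr0 -leNgt.
  exact: sqrtr_ge0.
have s0 : 0 < Num.sqrt y / Num.sqrt y' by rewrite divr_gt0 ?sqrt_abar_gt0 ?sqrt_cross_gt0.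
case: (ltgtP (Num.sqrt y) (Num.sqrt y')) => [h|h|h]; last by rewrite h eqxx in dif.
  have t0 : t < 0 by rewrite ln_lt0 // s0 ltr_pdivrMr ?sqrt_cross_gt0 // mul1r.
  rewrite (ltr0_sg t0) lt_eqF //; split=> //; apply: ltr0_sg.
  by rewrite subr_lt0 -(ltr_sqrt _ cross_gt0).
have t0 : 0 < t by rewrite ln_gt0 // ltr_pdivlMr ?sqrt_cross_gt0 // mul1r.
rewrite (gtr0_sg t0) gt_eqF //; split=> //; apply: gtr0_sg.
by rewrite subr_gt0 -(ltr_sqrt _ abar_gt0).
Qed.

(** The hypothesis on the square roots says that the exponent at one vertex,
    divided by [ln n], exceeds [1]; the excess [z] survives the union bound over
    the vertices. *)
Lemma threshold_excess : exists2 z : R, 0 < z &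
  2 ^+ r / 2 ^+ d * (Num.sqrt y - Num.sqrt y') ^+ 2 = 1 + z.
Proof.
exists (2 ^+ r / 2 ^+ d * (Num.sqrt y - Num.sqrt y') ^+ 2 - 1); last by rewrite subrKC.
have p : 0 < 2 ^+ (d - r) :> R by rewrite exprn_gt0.
rewrite subr_gt0; have -> : 2 ^+ r / 2 ^+ d = (2 ^+ (d - r))^-1 :> R.
  have -> : 2 ^+ d = 2 ^+ (d - r) * 2 ^+ r :> R by rewrite -exprD subnK //; lia.
  by field; rewrite !expf_neq0.
rewrite mulrC ltr_pdivlMr // mul1r.
have := threshold; rewrite -/y -/y' -ltr_sqr ?nnegrE ?sqrtr_ge0 //.
by rewrite sqr_sqrtr ?(ltW p) // real_normK ?num_real.
Qed.

(** All quantities are measured in units of [L = ln n]: the spectral gap is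
    [gamma], degrees are at most [C], the deviation from the expected matrix has
    norm at most [kappa0], the vote of the neighbours exceeds [2 xi0], and
    reference vectors disturb it by at most [eta0] times their largest error.
    [theta] is the exponential parameter for the latter, and [eps], [K], [t1],
    [t2], [c0] are the parameters of the discrepancy bound. *)
Section FixedSize.
Variables (n m : nat) (c : 'I_n -> d.-tuple bool).
Hypothesis c_bal : forall x : d.-tuple bool, #|[set v | c v == x]%SET| = m.
Hypothesis (m_gt0 : (0 < m)%N) (nE : n = (m * 2 ^ d)%N).

Let L : R := ln n%:R.
Let p k : R := rho R n * a k.
Let P i j : R := p (tree_dist (c i) (c j)).
Let S := mega_community c w.

Variables (g b C xi0 eta0 kappa0 eps t1 t2 c0 theta z : R) (K : nat).
Let gamma := g / 2 ^+ d.
Hypothesis g_gt0 : 0 < g.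
Hypothesis gap32 :
  \sum_(k < r) `|a k - a k.+1| * 2 ^+ k + 2 * g <= `|ball_sum a r - 2 ^+ r * a r.+1|.
Hypothesis gap21 :
  `|ball_sum a r - 2 ^+ r * a r.+1| + 2 * g <= ball_sum a r + 2 ^+ r * a r.+1.
Hypothesis (b_gt0 : 0 < b) (a_le : forall k, (k <= d)%N -> a k <= b).
Hypothesis (CE : C = 2 + b * (expR 1 - 1)).
Hypothesis (xi0_gt0 : 0 < xi0) (eta0_ge0 : 0 <= eta0) (kappa0_ge0 : 0 <= kappa0).
Hypothesis (kappa_small : 16 * kappa0 <= gamma) (eta_small : 24 * eta0 <= gamma).
Hypothesis (eta_xi : eta0 * (4 * (3 * (C + gamma) / gamma) + 1) <= xi0).
Hypothesis (K_gt0 : (0 < K)%N) (kappa_K : 4 * (2 * eps * K%:R + (C + b) / K%:R) <= kappa0).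
Hypothesis (theta_gt0 : 0 < theta).
Hypothesis (theta_eta : b * (4 * kappa0 / gamma) * (theta * expR theta) - theta * eta0 <= - 2).
Hypothesis (eps_gt0 : 0 < eps) (t1_gt0 : 0 < t1) (t2_gt0 : 0 < t2).
Hypothesis (t1_eps : 4 <= t1 * eps) (c0_t1 : b * c0 * expR (2 * t1) <= 1) (c0_eps : b * c0 <= eps).
Hypothesis (t2_le : t2 <= 4^-1) (t2_eps : 8 * b * t2 <= eps).
Hypothesis zE : 2 ^+ r / 2 ^+ d * (Num.sqrt y - Num.sqrt y') ^+ 2 = 1 + z.
Hypothesis xi0_z : 2 * xi0 * `|t| <= z / 2.
Hypothesis (L_gt0 : 0 < L) (L_large : 16 * C <= gamma ^+ 2 * L).
Hypothesis (n_large : b * L <= n%:R) (n_eps : b * L <= eps * L * n%:R) (n_eps4 : 4 * b <= eps * n%:R).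
Hypothesis (L_disc : 12 <= t2 * eps * c0 * L).

Lemma size_gt0 : (0 < n)%N. Proof. by rewrite nE muln_gt0 m_gt0 expn_gt0. Qed.
Lemma size_gt0R : 0 < n%:R :> R. Proof. by rewrite ltr0n size_gt0. Qed.

Lemma exp_ln_size : expR L = n%:R. Proof. by rewrite /L lnK // posrE size_gt0R. Qed.

Lemma gap_gt0 : 0 < gamma. Proof. by rewrite divr_gt0 // exprn_gt0. Qed.

Lemma edge_prob_bounds i j : 0 <= P i j <= b * L / n%:R.
Proof.
have kd := tree_dist_ub (c i) (c j); have rho0 : 0 < rho R n by rewrite divr_gt0 // size_gt0R.
rewrite /P /p mulr_ge0 ?(ltW rho0) ?(ltW (a_gt0 kd)) //=.
rewrite (_ : b * L / _ = rho R n * b); last by rewrite /rho -/L; ring.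
by rewrite ler_wpM2l ?(ltW rho0) // a_le.
Qed.

Lemma edge_prob01 i j : 0 <= P i j <= 1.
Proof.
have [-> /le_trans] := andP (edge_prob_bounds i j); apply.
by rewrite ler_pdivrMr ?size_gt0R // mul1r.
Qed.

Lemma block_rho : m%:R * rho R n = L / 2 ^+ d.
Proof.
rewrite /rho -/L nE natrM natrX; field.
by rewrite pnatr_eq0 -lt0n m_gt0 expf_neq0.
Qed.

Lemma ref_l2_ln : ref_l2 m r p = L / 2 ^+ d * (ball_sum a r - 2 ^+ r * a r.+1).
Proof. by rewrite /ref_l2 /p ball_sumZ -block_rho; ring. Qed.

Lemma ref_l1_ln : ref_l1 m r p = L / 2 ^+ d * (ball_sum a r + 2 ^+ r * a r.+1).
Proof. by rewrite /ref_l1 /p ball_sumZ -block_rho; ring. Qed.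

Lemma ln_over_gt0 : 0 < L / 2 ^+ d. Proof. by rewrite divr_gt0 // exprn_gt0. Qed.

Lemma ref_l3_ln : ref_l3 m r p = L / 2 ^+ d * \sum_(k < r) `|a k - a k.+1| * 2 ^+ k.
Proof.
rewrite /ref_l3 mulr_sumr; apply: eq_bigr => k _.
rewrite /p -mulrBr normrM gtr0_norm; last by rewrite divr_gt0 // size_gt0R.
by rewrite -block_rho; ring.
Qed.

Lemma ball_sum_abar : ball_sum a r = 2 ^+ r * y.
Proof. by rewrite /y abar_ball_sum; field; rewrite expf_neq0. Qed.

Lemma ref_l2_sign : Num.sg (ref_l2 m r p) = Num.sg t.
Proof.
have [<- _] := tilt_sign; rewrite ref_l2_ln ball_sum_abar -mulrBr mulrA sgrM gtr0_sg ?mul1r //.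
by rewrite mulr_gt0 ?ln_over_gt0 ?exprn_gt0.
Qed.

Let margin_fails v (A : 'M[bool]_n) : Prop :=
  t * (side R c w v * \sum_(j in S) (A v j)%:R * side R c w j) <= 2 * xi0 * `|t| * L.

Lemma margin_failure v : v \in S ->
  graph_Pr P (margin_fails v) <= expR (1 - (1 + z / 2) * L).
Proof.
move=> vS; apply: le_trans (margin_tail c_bal rE edge_prob01 t _ vS) _; rewrite ler_expR.
have -> : (ref_l1 m r p + ref_l2 m r p) / 2 = L * (2 ^+ r / 2 ^+ d * y).
  by rewrite ref_l1_ln ref_l2_ln ball_sum_abar; field; rewrite expf_neq0.
have -> : (ref_l1 m r p - ref_l2 m r p) / 2 = L * (2 ^+ r / 2 ^+ d * y').
  by rewrite ref_l1_ln ref_l2_ln ball_sum_abar -/y'; field; rewrite expf_neq0.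
have -> : L * (2 ^+ r / 2 ^+ d * y) * (expR (- t) - 1) +
    L * (2 ^+ r / 2 ^+ d * y') * (expR t - 1) = - (L * (1 + z)).
  by rewrite -zE -[in RHS]mulrN -mulrN -tilt_exponent; ring.
have := ler_wpM2r (ltW L_gt0) xi0_z; lra.
Qed.

Let ref_good (A : 'M[bool]_n) (i : 'I_#|S|) : Prop :=
  let x := reference m c w r p (gamma * L) (kappa0 * L) (isolate (enum_val i) A) in
  is_reference m r p (gamma * L) (kappa0 * L)
    (induced_adjacency R (isolate (enum_val i) A) S) x ->
  forall Y, ref_scale R c w <= Y -> (forall k, `|x 0 k - ref_side R c w 0 k| <= Y) ->
  \sum_k (A (enum_val i) (enum_val k))%:R * `|x 0 k - ref_side R c w 0 k| <= eta0 * L * Y.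

Lemma ref_failure i : graph_Pr P (fun A => ~ ref_good A i) <= expR (- (2 * L)).
Proof.
have g0 := gap_gt0; have L0 := lt0r_neq0 L_gt0.
have e : 4 * (kappa0 * L) / (gamma * L) = 4 * kappa0 / gamma.
  by field; rewrite L0 gt_eqF.
have := @refs_tail R n d m c c_bal m_gt0 w r rE p edge_prob01 b L (gamma * L) (kappa0 * L) (eta0 * L)
  size_gt0 L_gt0 b_gt0 (fun i j => proj2 (andP (edge_prob_bounds i j))) i theta theta_gt0.
rewrite e => /(_ _)/le_trans; apply.
  by rewrite divr_ge0 ?(ltW g0) // mulr_ge0.
rewrite ler_expR; have := ler_wpM2r (ltW L_gt0) theta_eta; lra.
Qed.

(** The contrapositive of [split_correct]. *)
Lemma split_failure_cover A : simple_graph A -> ~ sign_splits_correctly R c A w ->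
  (exists i, C * L <= \sum_j (A i j)%:R) \/ ~ low_discrepancy P (eps * L) A \/
  (exists i : 'I_#|S|, margin_fails (enum_val i) A) \/ (exists i, ~ ref_good A i).
Proof.
move=> simpleA; have g0 := gap_gt0.
apply: contra_notP => /not_orP[deg /not_orP[disc /not_orP[marg refs]]].
have {}deg i : \sum_j (A i j)%:R <= C * L.
  by rewrite leNgt; apply/negP => h; apply: deg; exists i; exact: ltW.
move: disc => /contrapT disc.
have C0 : 0 <= C by rewrite CE addr_ge0 // mulr_ge0 ?(ltW b_gt0) // subr_ge0 -[leLHS]expR0 ler_expR.
have P_ge0 i j : 0 <= P i j by have [] := andP (edge_prob_bounds i j).
have P_le i j : P i j <= b * L / n%:R by have [] := andP (edge_prob_bounds i j).
have P_row i : \sum_j P i j <= b * L.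
  apply: le_trans (ler_sum _ (fun j _ => P_le i j)) _.
  by rewrite sumr_const card_ord -[leLHS]mulr_natr divfK // gt_eqF ?size_gt0R.
have P_eps i j : P i j <= eps * L.
  by apply: le_trans (P_le i j) _; rewrite ler_pdivrMr ?size_gt0R.
have Psym i j : P i j = P j i by rewrite /P tree_distC.
have [] := deviation_nrm Psym P_ge0 (mulr_gt0 eps_gt0 L_gt0) P_eps P_row K_gt0 simpleA disc deg
  (mulr_ge0 C0 (ltW L_gt0)) (mulr_ge0 (ltW b_gt0) (ltW L_gt0)).
have kK : 4 * (2 * (eps * L) * K%:R + (C * L + b * L) / K%:R) <= kappa0 * L.
  by have := ler_wpM2r (ltW L_gt0) kappa_K; apply: le_trans; rewrite le_eqVlt; apply/orP; left;
     apply/eqP; ring.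
move=> devA devB.
apply: (@split_correct R n d m c c_bal m_gt0 w r rE p (gamma * L) (kappa0 * L) (C * L) (eta0 * L)
   (xi0 * L)) => //.
- exact: mulr_gt0.
- rewrite ref_l2_ln ref_l3_ln normrM (gtr0_norm ln_over_gt0) (_ : 2 * (gamma * L) = L / 2 ^+ d * (2 * g)).
    by rewrite -mulrDr ler_wpM2l // ltW ?ln_over_gt0.
  by rewrite /gamma; ring.
- rewrite ref_l2_ln ref_l1_ln normrM (gtr0_norm ln_over_gt0) (_ : 2 * (gamma * L) = L / 2 ^+ d * (2 * g)).
    by rewrite -mulrDr ler_wpM2l // ltW ?ln_over_gt0.
  by rewrite /gamma; ring.
- by rewrite mulr_ge0 // ltW.
- by rewrite mulrA ler_wpM2r // ltW.
- by rewrite exprMn mulrA [L ^+ 2]expr2 mulrA ler_wpM2r // ltW.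
- by rewrite mulr_ge0 // ltW.
- by rewrite mulrA ler_wpM2r // ltW.
- exact: mulr_gt0.
- have -> : 3 * (C * L + gamma * L) / (gamma * L) = 3 * (C + gamma) / gamma.
    by field; rewrite !gt_eqF.
  by rewrite mulrAC ler_wpM2r // ltW.
- by move=> x; apply: le_trans (devA x) _; rewrite ler_wpM2r // sqrtr_ge0.
- by move=> v x; apply: le_trans (devB v x) _; rewrite ler_wpM2r // sqrtr_ge0.
- move=> v vS; rewrite leNgt; apply/negP => h; apply: marg.
  exists (enum_rank_in vS v); rewrite enum_rankK_in // /margin_fails; move: h; rewrite ref_l2_sign => h.
  have [_ tn] := tilt_sign.
  have := ler_wpM2l (normr_ge0 t) (ltW h); rewrite mulrA [`|t| * _]mulrC -numEsg -/S => h'.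
  by apply: le_trans h' _; rewrite le_eqVlt; apply/orP; left; apply/eqP; ring.
- move=> i x hx Y tY gY; have good : ref_good A i by apply: contrapT => h; apply: refs; exists i.
  exact: good hx Y tY gY.
Qed.

Lemma split_failure_bound :
  graph_Pr P (fun A => ~ sign_splits_correctly R c A w) <=
  (expR 2 + 4) * expR (- L) + expR 1 * expR (- (z / 2 * L)).
Proof.
have Psym i j : P i j = P j i by rewrite /P tree_distC.
have P_le i j : P i j <= b * L / n%:R by have [] := andP (edge_prob_bounds i j).
apply: le_trans (ler_graph_Pr edge_prob01 split_failure_cover) _.
apply: le_trans (graph_PrU edge_prob01 _ _) _.

have h1 := degree_tail edge_prob01 Psym size_gt0 exp_ln_size P_le.
have h2 := discrepancy_tail edge_prob01 Psym size_gt0 exp_ln_size L_gt0 b_gt0 P_le eps_gt0 t1_gt0 t2_gt0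
   t1_eps c0_t1 c0_eps t2_le t2_eps n_eps4 L_disc.
have h3 : graph_Pr P (fun A => exists i : 'I_#|S|, margin_fails (enum_val i) A) <= expR 1 * expR (- (z / 2 * L)).
  apply: le_trans (graph_PrU_fin edge_prob01 (fun (i : 'I_#|S|) A => margin_fails (enum_val i) A)) _.
  apply: le_trans (ler_sum _ (fun i _ => margin_failure (enum_valP i))) _.
  rewrite sumr_const -[leLHS]mulr_natr; apply: le_trans (_ : expR (1 - (1 + z / 2) * L) * n%:R <= _).
    by rewrite ler_pM2l ?expR_gt0 // ler_nat card_ord -[X in (_ <= X)%N](card_ord n) max_card.
  by rewrite -exp_ln_size -!expRD ler_expR; lra.
have h4 : graph_Pr P (fun A => exists i, ~ ref_good A i) <= expR (- L).
  apply: le_trans (graph_PrU_fin edge_prob01 (fun i A => ~ ref_good A i)) _.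
  apply: le_trans (ler_sum _ (fun i _ => ref_failure i)) _.
  rewrite sumr_const -[leLHS]mulr_natr; apply: le_trans (_ : expR (- (2 * L)) * n%:R <= _).
    by rewrite ler_pM2l ?expR_gt0 // ler_nat card_ord -[X in (_ <= X)%N](card_ord n) max_card.
  by rewrite -exp_ln_size -expRD ler_expR; lra.
have h34 := graph_PrU edge_prob01 (fun A => exists i : 'I_#|S|, margin_fails (enum_val i) A) (fun A => exists i, ~ ref_good A i).
have h234 := graph_PrU edge_prob01 (fun A => ~ low_discrepancy P (eps * L) A)
  (fun A => (exists i : 'I_#|S|, margin_fails (enum_val i) A) \/ (exists i, ~ ref_good A i)).
rewrite -CE in h1.
by move: h1 h2 h3 h4 h34 h234; lra.
Qed.

End FixedSize.
End SplitFailure.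

(** * Choice of the constants *)

Lemma mul_ln_le (R : realType) (b x : R) : 0 < x -> 0 < ln x -> 2 * b <= ln x ->
  b * ln x <= x.
Proof.
move=> x0 lx hb; rewrite -[leRHS](lnK (_ : _ \is Num.pos)) ?posrE //.
apply: le_trans (le_trans _ (expR_ge1Dxn 1 (ltW lx))) _; last exact: lexx.
apply: le_trans (_ : ln x ^+ 2 / 2 <= _); last by rewrite lerDr.
by rewrite expr2 mulrAC ler_pM2r // ler_pdivlMr // mulrC.
Qed.

(** The constants are chosen one after the other: the gap [gamma] and the degree
    bound [C] depend on [a] only; the excess [z] fixes the margin [xi0], the
    margin fixes the admissible disturbance [eta0], this fixes the parameter
    [theta] and the norm bound [kappa0], and the latter fixes [K] and then
    [eps], which determines the rest. *)
Lemma split_failure_rate (R : realType) (d : nat) (a : nat -> R) (w : seq bool) (r : nat) :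
  (forall k, (k <= d)%N -> 0 < a k) ->
  (forall k, (k < d)%N -> a k.+1 < a k) \/ (forall k, (k < d)%N -> a k < a k.+1) ->
  (size w + r.+1)%N = d ->
  Num.sqrt (2 ^+ (d - r)) < `|Num.sqrt (abar a r.+1) - Num.sqrt (a r.+1)| ->
  exists C1 c1 L0 : R, 0 < c1 /\
    forall (n m : nat) (c : 'I_n -> d.-tuple bool),
    (forall x : d.-tuple bool, #|[set v | c v == x]%SET| = m) ->
    (0 < m)%N -> n = (m * 2 ^ d)%N -> L0 <= ln n%:R ->
    graph_Pr (fun i j => rho R n * a (tree_dist (c i) (c j)))
      (fun A => ~ sign_splits_correctly R c A w) <= C1 * expR (- (c1 * ln n%:R)).
Proof.
move=> a_gt0 a_mono rE threshold.
have split_sum (x1 x2 x3 x4 u : R) : 0 < x1 -> 0 < x2 -> 0 < x3 -> 0 < x4 ->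
    1 + x1 + x2 + x3 + x4 <= u -> [/\ 0 < u, x1 <= u, x2 <= u, x3 <= u & x4 <= u].
  by move=> *; split; lra.
have half (u v : R) : 8 * v <= u -> u / 2 + 4 * v <= u by lra.
have rd : (r < d)%N by lia.
have mono : (forall k, (k <= r)%N -> a k.+1 < a k) \/ (forall k, (k <= r)%N -> a k < a k.+1).
  by case: a_mono => h; [left|right] => k kr; apply: h; lia.
have [g g0 [gap32 gap21]] := spectral_gap_constant (ball_sum_gt0 a_gt0 rE threshold) (a_gt0 _ rd) mono.
have [z z0 zE] := threshold_excess rE threshold.
have [_ tn0] := tilt_sign a_gt0 rE threshold.
move Et : (ln _) tn0 => t tn0; have t0 : 0 < `|t| by rewrite normr_gt0.
pose gamma := g / 2 ^+ d.
have gamma0 : 0 < gamma by rewrite divr_gt0 ?exprn_gt0.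
pose b : R := 1 + \sum_(k < d.+1) a k.
have sum0 (D : pred 'I_d.+1) : 0 <= \sum_(k < d.+1 | D k) a k.
  by apply: sumr_ge0 => k _; rewrite ltW // a_gt0 // -ltnS.
have b0 : 0 < b by rewrite ltr_pwDl.
have a_le k : (k <= d)%N -> a k <= b.
  rewrite -ltnS => kd; rewrite /b (bigD1 (Ordinal kd)) //= addrCA lerDl addr_ge0 //.
pose C : R := 2 + b * (expR 1 - 1).
have e1 : 0 <= expR 1 - 1 :> R by rewrite subr_ge0 -[leLHS]expR0 ler_expR.
have C0 : 0 < C by rewrite ltr_pwDl // mulr_ge0 // ltW.
pose xi0 := z / (4 * `|t|).
have xi00 : 0 < xi0 by rewrite divr_gt0 // mulr_gt0.
pose X := 4 * (3 * (C + gamma) / gamma) + 1.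
have X0 : 0 < X by rewrite ltr_wpDl // mulr_ge0 // divr_ge0 ?(ltW gamma0) // mulr_ge0 // addr_ge0 // ltW.
pose eta0 := Num.min (gamma / 24) (xi0 / X).
have eta00 : 0 < eta0 by rewrite lt_min; apply/andP; split; exact: divr_gt0.
pose theta := 3 / eta0.
have theta0 : 0 < theta by rewrite divr_gt0.
pose T := b * (theta * expR theta).
have T0 : 0 < T by rewrite mulr_gt0 // mulr_gt0 // expR_gt0.
pose kappa0 := Num.min (gamma / 16) (gamma / (4 * T)).
have kappa00 : 0 < kappa0 by rewrite lt_min; apply/andP; split; apply: divr_gt0 => //; exact: mulr_gt0.
pose K := (Num.truncn (8 * (C + b) / kappa0)).+1.
have KR : 0 < K%:R :> R by rewrite ltr0n.
have K_large : 8 * (C + b) / kappa0 <= K%:R by apply: ltW; exact: truncnS_gt.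
pose eps := kappa0 / (16 * K%:R).
have eps0 : 0 < eps by rewrite divr_gt0 // mulr_gt0.
pose t1 := 4 / eps.
have t10 : 0 < t1 by rewrite divr_gt0.
pose c0 := Num.min (eps / b) (expR (- (2 * t1)) / b).
have c00 : 0 < c0 by rewrite lt_min; apply/andP; split; apply: divr_gt0 => //; exact: expR_gt0.
pose t2 := Num.min (4^-1) (eps / (8 * b)).
have t20 : 0 < t2 by rewrite lt_min invr_gt0 ltr0n /= divr_gt0 // mulr_gt0.
have q0 : 0 < t2 * eps * c0 := mulr_gt0 (mulr_gt0 t20 eps0) c00.
(* One summand for each lower bound on [ln n] that is needed. *)
pose L0 := 1 + 2 * b + 16 * C / gamma ^+ 2 + 4 * b / eps + 12 / (t2 * eps * c0).
have p0 : 0 < 2 * b by exact: mulr_gt0.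
have p1 : 0 < 16 * C / gamma ^+ 2 by apply: divr_gt0; [exact: mulr_gt0 | exact: exprn_gt0].
have p2 : 0 < 4 * b / eps by apply: divr_gt0 => //; exact: mulr_gt0.
have p3 : 0 < 12 / (t2 * eps * c0) by exact: divr_gt0.
exists (expR 2 + 4 + expR 1), (Num.min 1 (z / 2)), L0; split.
  by rewrite lt_min ltr01 divr_gt0.
move=> n m c c_bal m_gt0 nE; move EL : (ln n%:R) => L L_ge.
have [L_gt0 L4 L1 L2 L3] := split_sum _ _ _ _ _ (p0) p1 p2 p3 L_ge.
have n0 : 0 < n%:R :> R by rewrite ltr0n nE muln_gt0 m_gt0 expn_gt0.
have eL : expR L = n%:R by rewrite -EL lnK // posrE.
have nL : L <= n%:R by rewrite -eL; apply: le_trans (expR_ge1Dx L); rewrite lerDr.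
have n_large : b * L <= n%:R by rewrite -EL mul_ln_le // EL.
have n_eps4 : 4 * b <= eps * n%:R.
  by rewrite [leRHS]mulrC -ler_pdivrMr //; exact: le_trans nL.
apply: le_trans (@split_failure_bound R d a a_gt0 w r rE threshold n m c c_bal m_gt0 nE
  g b C xi0 eta0 kappa0 eps t1 t2 c0 theta z K _ gap32 gap21 b0 a_le erefl xi00 (ltW eta00)
  (ltW kappa00) _ _ _ isT _ theta0 _ eps0 t10 t20 _ _ _ _ _ zE _ _ _ _ _ n_eps4 _) _ => //.
all: rewrite -?/gamma ?EL ?Et //.
- by rewrite mulrC -ler_pdivlMr // ge_min lexx.
- by rewrite mulrC -ler_pdivlMr // ge_min lexx.
- by rewrite -ler_pdivlMr // ge_min lexx orbT.
- have -> : 4 * (2 * eps * K%:R + (C + b) / K%:R) = kappa0 / 2 + 4 * ((C + b) / K%:R).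
    by rewrite /eps; field; rewrite gt_eqF.
  have h : 8 * ((C + b) / K%:R) <= kappa0.
    by rewrite mulrA ler_pdivrMr // [leRHS]mulrC -ler_pdivrMr.
  exact: half h.
- have -> : theta * eta0 = 3 by rewrite divfK // gt_eqF.
  rewrite lerBlDr (_ : b * (4 * kappa0 / gamma) * (theta * expR theta) = kappa0 * (4 * T) / gamma).
    rewrite (_ : - 2 + 3 = 1); last by ring.
    by rewrite ler_pdivrMr // mul1r -ler_pdivlMr ?ge_min ?lexx ?orbT //; exact: mulr_gt0.
  by rewrite /T; ring.
- by rewrite divfK // gt_eqF.
- have h : c0 <= expR (- (2 * t1)) / b by rewrite ge_min lexx orbT.
  apply: le_trans (_ : b * (expR (- (2 * t1)) / b) * expR (2 * t1) <= 1).
    by rewrite ler_pM2r ?expR_gt0 // ler_pM2l.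
  by rewrite [b * _]mulrC divfK ?gt_eqF // -expRD addNr expR0.
- by rewrite mulrC -ler_pdivlMr // ge_min lexx.
- by rewrite ge_min lexx.
- by rewrite mulrC -ler_pdivlMr ?ge_min ?lexx ?orbT //; exact: mulr_gt0.
- have -> : 2 * xi0 * `|t| = z / 2 by rewrite /xi0; field; rewrite normr_eq0.
  exact: lexx.
- by rewrite [leRHS]mulrC -ler_pdivrMr // exprn_gt0.
- rewrite mulrAC ler_pM2r //; apply: le_trans n_eps4.
  by rewrite ler_peMl ?(ltW b0) // ler1n.
- by rewrite [leRHS]mulrC -ler_pdivrMr.
rewrite [leRHS]mulrDl lerD //.
  rewrite ler_pM2l ?ler_expR; last by rewrite ltr_wpDl // expR_ge0.
  by rewrite lerN2 -[leRHS]mul1r ler_pM2r // ge_min lexx.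
by rewrite ler_pM2l ?expR_gt0 // ler_expR lerN2 ler_pM2r // ge_min lexx orbT.
Qed.

(** * Exact recovery *)

Lemma near_ln_size (R : realType) (d : nat) (x : R) :
  \forall m \near \oo, (0 < m)%N /\ x <= ln (m * 2 ^ d)%:R.
Proof.
near=> m; have m0 : (0 < m)%N by near: m; exact: nbhs_infty_gt.
have mx : expR x <= m%:R by near: m; exact: nbhs_infty_ger.
split=> //; rewrite -ler_expR lnK ?posrE ?ltr0n ?muln_gt0 ?m0 ?expn_gt0 //.
by apply: le_trans mx _; rewrite ler_nat leq_pmulr // expn_gt0.
Unshelve. all: by end_near. Qed.

Lemma exponential_rate_vanishes (R : realType) (d : nat) (C1 c1 : R) : 0 < c1 ->
  (fun m => C1 * expR (- (c1 * ln (m * 2 ^ d)%:R))) @ \oo --> (0 : R).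
Proof.
move=> c10; apply/cvgr0Pnorm_le => e e0.
have K0 : 0 < `|C1| + 1 by rewrite ltr_wpDl.
near=> m; have [_ hm] : (0 < m)%N /\ - ln (e / (`|C1| + 1)) / c1 <= ln (m * 2 ^ d)%:R :> R.
  by near: m; exact: near_ln_size.
rewrite normrM [`|expR _|]ger0_norm ?expR_ge0 //.
apply: le_trans (_ : (`|C1| + 1) * (e / (`|C1| + 1)) <= _); last first.
  by rewrite mulrC divfK // gt_eqF.
apply: ler_pM; rewrite ?expR_ge0 ?lerDl //.
rewrite -[leRHS](lnK (_ : _ \is Num.pos)) ?posrE ?divr_gt0 // ler_expR.
by rewrite lerNl [leRHS]mulrC -ler_pdivrMr.
Unshelve. all: by end_near. Qed.

Theorem theorem6p5 (R : realType) (d : nat) (a : nat -> R) (l : nat)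
    (c : forall m : nat, 'I_(m * 2 ^ d) -> d.-tuple bool)
    (c_balanced : forall (m : nat) (x : d.-tuple bool),
       #|[set v | c m v == x]%SET| = m)
    (a_mono : assortative d a \/ disassortative d a)
    (l_range : (1 <= l <= d)%N)
    (threshold : forall r : nat, (d - l + 1 <= r <= d)%N ->
       Num.sqrt (2 ^+ (d - r + 1))
         < `|Num.sqrt (abar a r) - Num.sqrt (a r)|) :
  (fun m : nat =>
     btsbm_prob (c m) (fun j : nat => rho R (m * 2 ^ d) * a j)
       (hcd_sign_exact_recovery R (c m) l))
    @ \oo --> (1 : R).
Proof.
have mono : (forall k, (k < d)%N -> a k.+1 < a k) \/ (forall k, (k < d)%N -> a k < a k.+1).
  by case: a_mono => -[]; [left | right].
have a_gt0 k : (k <= d)%N -> 0 < a k.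
  case: a_mono => [[dec ad]|[a0 inc]] kd.
    rewrite -(subKn kd); elim: (d - k)%N (leq_subr k d) => [|j IH] jd; first by rewrite subn0.
    by apply: lt_trans (IH (ltnW jd)) _; rewrite -(subnSK jd); apply: dec; lia.
  by elim: k kd => [|k IH] kd //; apply: lt_trans (IH (ltnW kd)) (inc _ kd).
pose P m i j : R := rho R (m * 2 ^ d) * a (tree_dist (c m i) (c m j)).
have P01 : \forall m \near \oo, forall i j, 0 <= P m i j <= 1.
  pose b : R := 1 + \sum_(k < d.+1) a k.
  have b0 : 0 < b.
    by rewrite ltr_pwDl // sumr_ge0 // => k _; rewrite ltW // a_gt0 // -ltnS.
  have a_le k : (k <= d)%N -> a k <= b.
    rewrite -ltnS => kd; rewrite /b (bigD1 (Ordinal kd)) //= addrCA lerDl addr_ge0 //.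
    by apply: sumr_ge0 => j _; rewrite ltW // a_gt0 // -ltnS.
  near=> m => i j.
  have [m0 hm] : (0 < m)%N /\ 2 * b <= ln (m * 2 ^ d)%:R :> R by near: m; exact: near_ln_size.
  have n0 : 0 < (m * 2 ^ d)%:R :> R by rewrite ltr0n muln_gt0 m0 expn_gt0.
  have L0 : 0 < ln (m * 2 ^ d)%:R :> R by apply: lt_le_trans hm; exact: mulr_gt0.
  have kd := tree_dist_ub (c m i) (c m j).
  rewrite /P mulr_ge0 ?(ltW (a_gt0 _ kd)) /rho ?divr_ge0 ?(ltW L0) ?(ltW n0) //=.
  rewrite mulrAC ler_pdivrMr // mul1r mulrC.
  apply: le_trans (mul_ln_le n0 L0 hm); rewrite ler_pM2r //; exact: a_le.
(* The split of [w] concerns the layer [r = d - size w] of the hypothesis. *)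
have split_fails w : (size w < l)%N ->
    (fun m => graph_Pr (P m) (fun A => ~ sign_splits_correctly R (c m) A w)) @ \oo --> (0 : R).
  move=> wl; have rE : (size w + (d - size w).-1.+1)%N = d by lia.
  have thr : Num.sqrt (2 ^+ (d - (d - size w).-1)) <
      `|Num.sqrt (abar a (d - size w).-1.+1) - Num.sqrt (a (d - size w).-1.+1)|.
    have -> : (d - (d - size w).-1 = d - (d - size w).-1.+1 + 1)%N by lia.
    by apply: threshold; lia.
  have [C1 [c1 [L0 [c10 rate]]]] := split_failure_rate a_gt0 mono rE thr.
  apply: squeeze_cvgr (cvg_cst 0) (exponential_rate_vanishes d C1 c10).
  near=> m; have [m0 hm] : (0 < m)%N /\ L0 <= ln (m * 2 ^ d)%:R by near: m; exact: near_ln_size.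
  rewrite (rate _ m) // andbT; apply: graph_Pr_ge0; near: m; exact: P01.
have recovery_fails : (fun m => graph_Pr (P m)
    (fun A => ~ hcd_sign_exact_recovery R (c m) l A)) @ \oo --> (0 : R).
  have sum0 : (fun m => \sum_(u : 'I_l * d.-tuple bool)
      graph_Pr (P m) (fun A => ~ sign_splits_correctly R (c m) A (take u.1 u.2))) @ \oo --> (0 : R).
    rewrite [X in _ --> X](_ : 0 = \sum_(u : 'I_l * d.-tuple bool) 0); last by rewrite big1.
    apply: (cvg_big (op := +%R)) => [|u _]; first exact: add_continuous.
    apply: split_fails.
    have ul := ltn_ord u.1; have [_ ld] := andP l_range.
    by rewrite size_takel // size_tuple ltnW // (leq_trans ul).
  apply: squeeze_cvgr (cvg_cst 0) sum0; near=> m.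
  have pm : forall i j, 0 <= P m i j <= 1 by near: m; exact: P01.
  rewrite graph_Pr_ge0 //=; apply: le_trans (graph_PrU_fin pm _); apply: (ler_graph_Pr pm) => A _.
  move=> /existsNP[w /not_implyP[wl fails]].
  have wd : (size w + (d - size w))%N = d by lia.
  (* Prefixes are enumerated by their length and a label that extends them. *)
  exists (Ordinal wl, tcast wd [tuple of in_tuple w ++ nseq (d - size w) false]) => /=.
  by rewrite val_tcast /= take_size_cat.
have -> : (1 : R) = 1 - 0 by rewrite subr0.
under eq_fun do rewrite [btsbm_prob _ _ _](graph_PrC (P _)).
exact: cvgB (cvg_cst _) recovery_fails.
Unshelve. all: by end_near. Qed.
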